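(* Let $n=2m$ with $m\ge 3$ odd. Fix a subgroup $A\subset\mathfrak{S}_m$ and the diagonal subgroup $$G:=A\times\mathfrak{S}_2\subset A\wr\mathfrak{S}_2\subset\mathfrak{S}_{2m}.$$ (a) For each field $F$ with absolute Galois group $\Gamma$ and each Galois representation (continuous homomorphism) $\rho:\Gamma\to G$, the twist ${}^{\rho}\overline{\mathcal M}_{0,n}$ is rational over $F$. (b) The $G$-action on $\overline{\mathcal M}_{0,n}$ is stably linearizable.
   Context: $\overline{\mathcal M}_{0,n}$ is the moduli space of stable $n$-pointed curves of genus zero; $\mathfrak{S}_n$ acts on it by permuting the marked points. The wreath product $A\wr\mathfrak{S}_2=A^2\rtimes\mathfrak{S}_2$ is embedded in $\mathfrak{S}_{2m}$ as permutations of pairs $(i,j)$, $i\in\{1,\dots,m\}$, $j\in\{1,2\}$: $A^2$ acts on $\{1,\dots,m\}\times\{1\}$ and $\{1,\dots,m\}\times\{2\}$ through its two factors, and $\mathfrak{S}_2$ permutes the index $j$. The subgroup $A\times\mathfrak{S}_2$ is the one in which $A$ is embedded diagonally in $A^2$. For a homomorphism $\rho$ from the absolute Galois group of $F$ to $\mathfrak{S}_n$, the twist ${}^{\rho}\overline{\mathcal M}_{0,n}$ is the $F$-variety obtained by Galois descent, twisting the standard Galois action on $\overline{\mathcal M}_{0,n}$ by $\rho$. A generically free regular action of a finite group $G$ on a projective variety $X$ is linearizable if $X$ is $G$-equivariantly birational to $\mathbb{P}(V)$ for a linear representation $V$ of $G$; it is stably linearizable if $X\times\mathbb{P}^r$,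 with trivial action on the second factor, is linearizable for some $r$. *)

(* Defs.v *)
From HB Require Import structures.
From mathcomp Require Import all_boot all_fingroup all_algebra.
From mathcomp Require Import separable mxrepresentation.
From mathcomp Require Import mpoly.

Set Implicit Arguments.
Unset Strict Implicit.
Unset Printing Implicit Defensive.

Import GRing.Theory.
Local Open Scope ring_scope.

(** Varieties over a field F are handled classically, by Galois descent: such
    a variety is given by its points over a separable closure Fs, as a subset
    of a product of projective spaces, together with the semilinear action of
    the absolute Galois group.  Points over Fs are Zariski dense in all the
    varieties considered below, which are smooth and irreducible. *)

Definition separable_closure (F Fs : fieldType) (iota : {rmorphism F -> Fs}) :=
  (forall x : Fs, exists2 p : {poly F},
     separable_poly p & root (map_poly iota p) x) /\
  (forall p : {poly Fs}, separable_poly p -> (1 < size p)%N ->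
     exists x, root p x).

Record galois_group (F Fs : fieldType) (iota : {rmorphism F -> Fs}) :=
  GaloisElt {
    gal_fun :> {rmorphism Fs -> Fs};
    gal_bij : bijective gal_fun;
    gal_fix : forall a : F, gal_fun (iota a) = iota a }.

(** Permutations are composed as functions here; note that the product of
    [{perm L}] is in the opposite order: [(s * t) i = t (s i)]. *)
Definition galois_hom (F Fs : fieldType) (iota : {rmorphism F -> Fs})
    (L : finType) (rho : galois_group iota -> {perm L}) :=
  forall g h gh : galois_group iota, (forall x, gh x = g (h x)) ->
    forall i, rho gh i = rho g (rho h i).

(** Continuity for the Krull topology on the source (basic neighbourhoods of g:
    the elements agreeing with g on a given finite set) and the discrete
    topology on the target. *)
Definition krull_continuous (F Fs : fieldType) (iota : {rmorphism F -> Fs})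
    (L : finType) (rho : galois_group iota -> {perm L}) :=
  forall g : galois_group iota, exists s : seq Fs,
    forall h : galois_group iota, {in s, forall x, h x = g x} -> rho h = rho g.

(** A map [block : coord -> factor] of finite sets encodes the product over
    b : factor of the projective spaces with homogeneous coordinates indexed by
    the fibre of [block] over b.  [locus] is a subset of this product, given on
    homogeneous coordinate vectors. *)
Record multiproj_set (K : fieldType) := MultiprojSet {
  coord : finType;
  factor : finType;
  block : coord -> factor;
  locus : {ffun coord -> K} -> Prop }.

Definition coords (K : fieldType) (X : multiproj_set K) := {ffun coord X -> K}.

Section Geometry.
Variable K : fieldType.
Implicit Types X Y : multiproj_set K.

Definition on X (x : coords X) : Prop :=
  (forall b : factor X, exists2 t, block t = b & x t != 0) /\ locus x.

Definition same_point X (x y : coords X) : Prop :=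
  exists2 c : factor X -> K, (forall b, c b != 0) &
    forall t, y t = c (block t) * x t.

Definition poly_on X := {mpoly K[#|coord X|]}.

Definition eval_on X (p : poly_on X) (x : coords X) : K :=
  p.@[fun k => x (enum_val k)].

Definition multihomog X (e : factor X -> nat) (p : poly_on X) : Prop :=
  forall m, m \in msupp p -> forall b : factor X,
    (\sum_(k < #|coord X| | block (enum_val k) == b) m k)%N = e b.

Definition zariski_open X (U : coords X -> Prop) : Prop :=
  exists2 S : poly_on X -> Prop,
    (forall p, S p -> exists e, multihomog e p) &
    forall x, U x <-> on x /\ exists2 p, S p & eval_on p x != 0.

(** For an irreducible variety the dense open subsets are the nonempty ones. *)
Definition nonempty_open X (U : coords X -> Prop) : Prop :=
  zariski_open U /\ exists x, U x.

Definition rational_map X Y := coord Y -> poly_on X.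

Definition well_formed X Y (f : rational_map X Y) : Prop :=
  forall b : factor Y, exists e : factor X -> nat,
    forall t, block t = b -> multihomog e (f t).

Definition map_at X Y (f : rational_map X Y) (x : coords X) : coords Y :=
  [ffun t => eval_on (f t) x].

Definition invariant (S : Type) X (act : S -> coords X -> coords X)
    (U : coords X -> Prop) : Prop :=
  forall s x, U x -> U (act s x).

(** Existence of an equivariant isomorphism between invariant nonempty open
    subsets, given with its inverse by multihomogeneous polynomials (a single
    formula suffices after shrinking the open subsets). *)
Definition equivariantly_birational (S : Type) X Y
    (actX : S -> coords X -> coords X) (actY : S -> coords Y -> coords Y) :=
  exists (U : coords X -> Prop) (V : coords Y -> Prop)
         (f : rational_map X Y) (g : rational_map Y X),
    [/\ [/\ nonempty_open U, nonempty_open V,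
            invariant actX U & invariant actY V],
        well_formed f /\ well_formed g,
        forall x, U x -> V (map_at f x) /\ same_point (map_at g (map_at f x)) x,
        forall y, V y -> U (map_at g y) /\ same_point (map_at f (map_at g y)) y &
        forall s x, U x -> same_point (map_at f (actX s x)) (actY s (map_at f x))].

Definition projective_space (T : finType) : multiproj_set K :=
  @MultiprojSet K T unit (fun=> tt) (fun=> True).

Definition fst_coords X Y (z : {ffun coord X + coord Y -> K}) : coords X :=
  [ffun t => z (inl t)].

Definition snd_coords X Y (z : {ffun coord X + coord Y -> K}) : coords Y :=
  [ffun t => z (inr t)].

Definition product X Y : multiproj_set K :=
  @MultiprojSet K (coord X + coord Y)%type (factor X + factor Y)%type
    (fun t => match t with inl u => inl (block u) | inr u => inr (block u) end)
    (fun z => locus (fst_coords z) /\ locus (snd_coords z)).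

Definition product_act X Y (a : coords X -> coords X) (b : coords Y -> coords Y)
    (z : coords (product X Y)) : coords (product X Y) :=
  [ffun t => match t with
             | inl u => a (fst_coords z) u
             | inr u => b (snd_coords z) u
             end].

Definition generically_free (gT : finGroupType) (G : {group gT}) X
    (act : gT -> coords X -> coords X) : Prop :=
  exists2 U : coords X -> Prop, nonempty_open U &
    forall x g, U x -> g \in G -> same_point (act g x) x -> g = 1%g.

End Geometry.

Section Descent.
Variables (F Fs : fieldType) (iota : {rmorphism F -> Fs}).

(** The standard Galois action, for varieties defined over the prime field. *)
Definition galois_act (T : finType) (g : galois_group iota) (x : {ffun T -> Fs}) :
    {ffun T -> Fs} := [ffun t => g (x t)].

(** [act] is the semilinear Galois action defining an F-form of X. *)
Definition rational_form (X : multiproj_set Fs)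
    (act : galois_group iota -> coords X -> coords X) : Prop :=
  exists d : nat,
    equivariantly_birational act
      (@galois_act (coord (projective_space Fs 'I_d.+1))).

Section Linearizable.
Variables (gT : finGroupType) (G : {group gT}).

Definition linear_act d (rG : mx_representation F G d) (g : gT)
    (v : {ffun 'I_d -> Fs}) : {ffun 'I_d -> Fs} :=
  [ffun j => \sum_i v i * iota (rG g i j)].

(** The birational map is required to be defined over F, i.e. equivariant for
    the standard Galois actions, and to be G-equivariant. *)
Definition linearizable (X : multiproj_set Fs)
    (act : gT -> coords X -> coords X) : Prop :=
  generically_free G act /\
  exists (d : nat) (rG : mx_representation F G d),
    @equivariantly_birational Fs (galois_group iota * subg_of G)%type
      X (projective_space Fs 'I_d)
      (fun s x => act (sgval s.2) (galois_act s.1 x))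
      (fun s v => linear_act rG (sgval s.2) (galois_act s.1 v)).

Definition stably_linearizable (X : multiproj_set Fs)
    (act : gT -> coords X -> coords X) : Prop :=
  exists r : nat,
    @linearizable (product X (projective_space Fs 'I_r.+1))
      (fun g => @product_act Fs X (projective_space Fs 'I_r.+1) (act g) id).

End Linearizable.
End Descent.

(** Points of the projective line, [None] being the point at infinity. *)
Definition P1 (K : fieldType) := option K.

Definition P1_coords (K : fieldType) (z : P1 K) : K * K :=
  if z is Some a then (a, 1) else (1, 0).

Definition bracket (K : fieldType) (y z : P1 K) : K :=
  (P1_coords y).1 * (P1_coords z).2 - (P1_coords y).2 * (P1_coords z).1.

(** A tree of projective lines with marked points indexed by L.  The components
    v and w meet when [adj v w], the point [node v w] of v being glued to the
    point [node w v] of w.  The fields say: the dual graph is a tree, the special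
    points of each component are distinct, and there are at least three. *)
Record stable_curve (K : fieldType) (L : finType) := StableCurve {
  comp : finType;
  adj : rel comp;
  node : comp -> comp -> P1 K;
  home : L -> comp;
  mark : L -> P1 K;
  adj_sym : ssrbool.symmetric adj;
  adj_irr : irreflexive adj;
  adj_connected : forall v w, connect adj v w;
  adj_acyclic : forall s, ucycle adj s -> (size s <= 2)%N;
  node_distinct : forall v w w', adj v w -> adj v w' ->
    node v w = node v w' -> w = w';
  mark_distinct : forall i j, home i = home j -> mark i = mark j -> i = j;
  node_mark_distinct : forall i w, adj (home i) w -> node (home i) w <> mark i;
  stability : forall v,
    (3 <= #|[pred i | home i == v]| + #|[pred w | adj v w]|)%N }.

(** The image of the i-th marked point under the contraction of the curve onto
    its component v: either this point itself, or the node of v leading to it. *)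
Definition projection (K : fieldType) (L : finType) (C : stable_curve K L)
    (v : comp C) (i : L) : P1 K :=
  if home C i == v then mark C i else
  if [pick w | adj v w &&
      connect [rel a b : comp C | [&& adj a b, a != v & b != v]] w (home C i)]
  is Some w then node v w else None.

Notation quadruple L := {q : 4.-tuple L | uniq q}.

(** [x] lists the cross-ratios of the 4-pointed stabilizations of C: for each
    quadruple q, the point (x (q, false) : x (q, true)) is the cross-ratio of the
    projections of the marked points q to any component v on which no three of
    them coincide.  Such components exist, and the equation below is trivial for
    the other ones. *)
Definition cross_ratios (K : fieldType) (L : finType) (C : stable_curve K L)
    (x : {ffun quadruple L * bool -> K}) : Prop :=
  forall (q : quadruple L) (v : comp C),
    let p k := projection v (tnth (val q) (inord k)) in
    x (q, false) * (bracket (p 0%N) (p 3%N) * bracket (p 1%N) (p 2%N)) =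
    x (q, true) * (bracket (p 0%N) (p 2%N) * bracket (p 1%N) (p 3%N)).

(** The moduli space of stable L-pointed curves of genus zero, in its closed
    embedding by cross-ratios into the product, over all quadruples of distinct
    labels, of projective lines (Gerritzen, Herrlich and van der Put, Stable
    n-pointed trees of projective lines). *)
Definition Mbar (K : fieldType) (L : finType) : multiproj_set K :=
  @MultiprojSet K (quadruple L * bool)%type (quadruple L) fst
    (fun x => exists C : stable_curve K L, cross_ratios C x).

Lemma relabel_uniq (L : finType) (s : {perm L}) (q : quadruple L) :
  uniq [tuple of map s (val q)].
Proof. by rewrite /= map_inj_uniq ?(valP q) //; apply: perm_inj. Qed.

Definition relabel_quadruple (L : finType) (s : {perm L}) (q : quadruple L) :
  quadruple L := exist _ [tuple of map s (val q)] (relabel_uniq s q).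

(** [(C, p_i)] is sent to [(C, p'_i)] with [p'_(s i) = p_i]. *)
Definition permute_marks (K : fieldType) (L : finType) (s : {perm L})
    (x : coords (Mbar K L)) : coords (Mbar K L) :=
  [ffun t => x (relabel_quadruple s^-1%g t.1, t.2)].

(** Galois acts on marked curves over Fs, followed by the relabelling rho. *)
Definition twisted_act (F Fs : fieldType) (iota : {rmorphism F -> Fs})
    (L : finType) (rho : galois_group iota -> {perm L}) (g : galois_group iota)
    (x : coords (Mbar Fs L)) : coords (Mbar Fs L) :=
  permute_marks (rho g) (galois_act g x).

Section DiagonalSubgroup.
Variable m : nat.

Definition pair_fun (a : 'S_m) (s : 'S_2) (ij : 'I_m * 'I_2) : 'I_m * 'I_2 :=
  (a ij.1, s ij.2).

Lemma pair_fun_inj a s : injective (pair_fun a s).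
Proof. by move=> [i j] [i' j'] [/perm_inj -> /perm_inj ->]. Qed.

Definition pair_perm (a : 'S_m) (s : 'S_2) : {perm 'I_m * 'I_2} :=
  perm (@pair_fun_inj a s).

Definition diagonal_set (A : {set 'S_m}) : {set {perm 'I_m * 'I_2}} :=
  [set pair_perm a s | a in A, s in [set: 'S_2]].

Lemma diagonal_group_set (A : {group 'S_m}) : group_set (diagonal_set A).
Proof.
apply/group_setP; split.
  apply/imset2P; exists 1%g 1%g; rewrite ?inE ?group1 //.
  by apply/permP=> -[i j]; rewrite perm1 permE /pair_fun /= !perm1.
move=> _ _ /imset2P[a s Aa _ ->] /imset2P[b t Ab _ ->].
apply/imset2P; exists (a * b)%g (s * t)%g; rewrite ?inE ?groupM //.
by apply/permP=> -[i j]; rewrite permM !permE /pair_fun /= !permM.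
Qed.

Definition diagonal_group (A : {group 'S_m}) : {group {perm 'I_m * 'I_2}} :=
  Group (diagonal_group_set A).

End DiagonalSubgroup.

(* Main.v *)
(** Write the labels as p_i = (i, 0) and q_i = (i, 1).  Let O be a set of 2e+3
    indices and let W be a space of functions on O, of dimension e+2 and in
    general position.  By Cauchy interpolation the points p_i, i in O, of a
    generic configuration can be written (u(i) : w(i)) for a unique pencil
    <u, w> in W.  Up to PGL_2 they thus amount to a point of Gr(2, W), and the
    reduced basis of the pencil provides a frame of the projective line which
    depends only on the p_i; the same holds for the q_i.  What remains is the
    matrix pairing the first frame with the second one, up to scalars, and the
    positions in these frames of the points outside of O.  Exchanging the p_i
    with the q_i transposes the matrix, so that A x S_2 merely permutes all
      these
    coordinates.

    For (a), W is chosen stable under the Galois group, as the polynomials of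
    degree at most e+1 in an element theta which separates an odd orbit of
      indices;
    the permutation of the coordinates is then removed by Hilbert's Theorem 90.
    For (b), O is the set of all indices and W is spanned by the powers of m
    additional unknowns theta_i permuted by A.
      They are provided by a factor P^m
    with trivial action: products of cross-ratios of the (p_i, q_i, p_k,
      q_k) give
    m distinct functions permuted by A, whose Vandermonde matrix trivializes
    the permutation representation. *)

Require Import Defs.
From HB Require Import structures.
From mathcomp Require Import all_boot all_fingroup all_algebra.
From mathcomp Require Import separable mxrepresentation.
From mathcomp Require Import mpoly.
From mathcomp Require Import cyclic ring zify.
From Stdlib Require Import Classical FunctionalExtensionality.

Set Implicit Arguments.
Unset Strict Implicit.
Unset Printing Implicit Defensive.

Import GRing.Theory.
Local Open Scope ring_scope.

(** The oddness of 2e+3 is a count of parameters. A pair of functions in W has 2(e+2) coefficients,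
    and proportionality to given points on O imposes 2e+3 linear conditions, which leaves just a
    common scalar. The coordinates number 4 + 4e + 2(m - (2e+3)) = 2m-2. As the matrix is only
    defined up to scalars, one of its entries is scaled to 1, and all coordinates together become
    homogeneous coordinates on a projective space of dimension 2m-3, that of the moduli space. In
    (b) the theta_i add m on both sides.

    Rational maps are tuples of multihomogeneous polynomials, which are awkward to compose. Each
    formula is therefore shown to stay inside an arbitrary class of functions closed under the ring
    or field operations. This is applied to regular functions on open sets and, for formulas without
    division, to functions that are polynomial along lines. The latter give nonempty open sets: over
    an infinite field each nonvanishing condition may have a witness of its own. Since F may be
    finite, these witnesses are sought over Fs, which is always infinite. *)

(** * Rings and fields of functions *)

(* Functions are identified when they agree on [D]. *)
Record fun_ring (K : fieldType) (T : Type) (D : T -> Prop)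
    (R : (T -> K) -> Prop) : Prop := FunRing {
  fun_const : forall c, R (fun=> c);
  fun_add : forall f g, R f -> R g -> R (fun t => f t + g t);
  fun_mul : forall f g, R f -> R g -> R (fun t => f t * g t);
  fun_ext : forall f g, (forall t, D t -> f t = g t) -> R f -> R g }.

(** Inverses are asked only of functions without zeros on [D], as holds for regular functions on an
    open set. Functions that are polynomial along lines form only a [fun_ring]. *)
Record fun_field (K : fieldType) (T : Type) (D : T -> Prop)
    (R : (T -> K) -> Prop) : Prop := FunField {
  fun_field_ring : fun_ring D R;
  fun_inv : forall f, (forall t, D t -> f t != 0) -> R f ->
    R (fun t => (f t)^-1) }.

Section FunRingTheory.
Variables (K : fieldType) (T : Type) (D : T -> Prop) (R : (T -> K) -> Prop).
Hypothesis RR : fun_ring D R.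

Lemma fun_opp f : R f -> R (fun t => - f t).
Proof.
move=> Rf; apply: (fun_ext RR) (fun_mul RR (fun_const RR (-1)) Rf).
by move=> t _; rewrite mulN1r.
Qed.

Lemma fun_sub f g : R f -> R g -> R (fun t => f t - g t).
Proof. by move=> Rf Rg; apply: (fun_add RR) => //; apply: fun_opp. Qed.

Lemma fun_sum (I : Type) (r : seq I) (P : pred I) (f : I -> T -> K) :
  (forall i, P i -> R (f i)) -> R (fun t => \sum_(i <- r | P i) f i t).
Proof.
move=> Rf; elim: r => [|i r IH].
  by apply: (fun_ext RR) (fun_const RR 0) => t _; rewrite big_nil.
case Pi: (P i).
  apply: (fun_ext RR) (fun_add RR (Rf i Pi) IH) => t _.
  by rewrite big_cons Pi.
by apply: (fun_ext RR) IH => t _; rewrite big_cons Pi.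
Qed.

Lemma fun_prod (I : Type) (r : seq I) (P : pred I) (f : I -> T -> K) :
  (forall i, P i -> R (f i)) -> R (fun t => \prod_(i <- r | P i) f i t).
Proof.
move=> Rf; elim: r => [|i r IH].
  by apply: (fun_ext RR) (fun_const RR 1) => t _; rewrite big_nil.
case Pi: (P i).
  apply: (fun_ext RR) (fun_mul RR (Rf i Pi) IH) => t _.
  by rewrite big_cons Pi.
by apply: (fun_ext RR) IH => t _; rewrite big_cons Pi.
Qed.

Lemma fun_exp f n : R f -> R (fun t => f t ^+ n).
Proof.
move=> Rf; elim: n => [|n IH].
  by apply: (fun_ext RR) (fun_const RR 1) => t _; rewrite expr0.
by apply: (fun_ext RR) (fun_mul RR Rf IH) => t _; rewrite exprS.
Qed.

Lemma fun_det n (M : T -> 'M[K]_n) :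
  (forall i j, R (fun t => M t i j)) -> R (fun t => \det (M t)).
Proof.
move=> RM; apply: fun_sum => s _; apply: (fun_mul RR).
  exact: (fun_const RR).
by apply: fun_prod => i _; apply: RM.
Qed.

End FunRingTheory.

Lemma fun_div (K : fieldType) (T : Type) (D : T -> Prop) (R : (T -> K) -> Prop)
    (RR : fun_field D R) f g :
  (forall t, D t -> g t != 0) -> R f -> R g -> R (fun t => f t / g t).
Proof.
move=> g0 Rf Rg; apply: (fun_mul (fun_field_ring RR)) => //.
exact: (fun_inv RR).
Qed.

(** * Square linear systems and Cramer's rule *)

Section LinearSystem.
Variables (K : fieldType) (I J : finType) (cardIJ : #|I| = #|J|).

(** Equations and unknowns may have different index types, matched through their enumerations. What
    matters of the determinant is where it vanishes and that it is a polynomial in the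
    coefficients. *)
Definition sys_mx (A : I -> J -> K) : 'M[K]_#|J| :=
  \matrix_(i, j) A (enum_val (cast_ord (esym cardIJ) i)) (enum_val j).

Definition sys_det (A : I -> J -> K) : K := \det (sys_mx A).

Definition sys_sol (A : I -> J -> K) (b : I -> K) (j : J) : K :=
  \sum_i invmx (sys_mx A) (enum_rank j) i *
         b (enum_val (cast_ord (esym cardIJ) i)).

Lemma sys_mxE A (x : J -> K) i :
  \sum_j A (enum_val (cast_ord (esym cardIJ) i)) j * x j =
  (sys_mx A *m (\col_k x (enum_val k))) i 0.
Proof.
rewrite mxE (reindex (@enum_val J J)) /=; last first.
  by apply: onW_bij; apply: enum_val_bij.
by apply: eq_bigr => j _; rewrite !mxE.
Qed.

Lemma cast_rank (i : I) :
  enum_val (cast_ord (esym cardIJ) (cast_ord cardIJ (enum_rank i))) = i.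
Proof. by rewrite cast_ordK enum_rankK. Qed.

Lemma sys_det_inj A : sys_det A != 0 ->
  forall x, (forall i, \sum_j A i j * x j = 0) -> forall j, x j = 0.
Proof.
move=> detA x Ax0 j.
have uA : sys_mx A \in unitmx by rewrite unitmxE unitfE.
have: sys_mx A *m (\col_k x (enum_val k)) = 0.
  by apply/colP=> i; rewrite -sys_mxE Ax0 mxE.
move/(congr1 (mulmx (invmx (sys_mx A)))); rewrite mulKmx // mulmx0.
by move/colP/(_ (enum_rank j)); rewrite !mxE enum_rankK.
Qed.

Lemma sys_det_neq0 A :
  (forall x, (forall i, \sum_j A i j * x j = 0) -> forall j, x j = 0) ->
  sys_det A != 0.
Proof.
move=> injA; rewrite /sys_det -det_tr; apply/det0P=> -[v v0 vA].
case/negP: v0; apply/eqP/rowP=> k; rewrite [RHS]mxE.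
rewrite -(enum_valK k); apply: (injA (fun j => v 0 (enum_rank j))) => i.
rewrite -(cast_rank i) sys_mxE.
have ->: \col_k0 v 0 (enum_rank (enum_val k0)) = v^T :> 'cV_#|J|.
  by apply/colP=> k0; rewrite !mxE enum_valK.
by rewrite -[sys_mx A]trmxK -trmx_mul vA trmx0 mxE.
Qed.

Lemma sys_solP A b : sys_det A != 0 ->
  forall i, \sum_j A i j * sys_sol A b j = b i.
Proof.
move=> detA i; have uA : sys_mx A \in unitmx by rewrite unitmxE unitfE.
rewrite -{1}(cast_rank i) sys_mxE.
have ->: \col_k sys_sol A b (enum_val k) =
   invmx (sys_mx A) *m \col_k b (enum_val (cast_ord (esym cardIJ) k)).
  apply/colP=> k; rewrite !mxE /sys_sol enum_valK.
  by apply: eq_bigr => l _; rewrite mxE.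
by rewrite mulKVmx // mxE cast_rank.
Qed.

Lemma sys_sol_uniq A b x : sys_det A != 0 ->
  (forall i, \sum_j A i j * x j = b i) -> forall j, x j = sys_sol A b j.
Proof.
move=> detA Ax j; apply/eqP; rewrite -subr_eq0; apply/eqP.
apply: (sys_det_inj detA (x := fun j => x j - sys_sol A b j)) => i.
under eq_bigr do rewrite mulrBr.
by rewrite sumrB Ax sys_solP // subrr.
Qed.

Lemma fun_sys_det (T : Type) (D : T -> Prop) (R : (T -> K) -> Prop)
    (RR : fun_ring D R) (A : T -> I -> J -> K) :
  (forall i j, R (fun t => A t i j)) -> R (fun t => sys_det (A t)).
Proof.
move=> RA; apply: (fun_det RR) => i j.
by apply: (fun_ext RR) (RA _ _) => t _; rewrite mxE.
Qed.

Lemma fun_sys_sol (T : Type) (D : T -> Prop) (R : (T -> K) -> Prop)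
    (RR : fun_field D R) (A : T -> I -> J -> K) (b : T -> I -> K) :
  (forall t, D t -> sys_det (A t) != 0) ->
  (forall i j, R (fun t => A t i j)) -> (forall i, R (fun t => b t i)) ->
  forall j, R (fun t => sys_sol (A t) (b t) j).
Proof.
move=> detA RA Rb j; have R1 := fun_field_ring RR.
apply: (fun_sum R1) => i _; apply: (fun_mul R1) => //.
(* The cofactor: by Cramer's rule, the entry of the inverse is its quotient by the determinant. *)
pose C t := (-1) ^+ (i + enum_rank j) *
  \det (row' i (col' (enum_rank j) (sys_mx (A t)))).
apply: (fun_ext R1 (f := fun t => (sys_det (A t))^-1 * C t)) => [t Dt|].
  rewrite /invmx unitmxE unitfE -/(sys_det _) detA // !mxE /cofactor /C.
  by congr (_ * _).
apply: (fun_mul R1).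
  by apply: (fun_inv RR) => //; apply: (fun_sys_det R1).
apply: (fun_mul R1); first exact: (fun_const R1).
apply: (fun_det R1) => k l.
by apply: (fun_ext R1) (RA _ _) => t _; rewrite !mxE.
Qed.

End LinearSystem.

(** * Regular functions on open subsets of multiprojective sets *)

Section Regular.
Variables (K : fieldType) (X : multiproj_set K).
Implicit Types (U : coords X -> Prop) (f g : coords X -> K).

Definition hom_fun (e : factor X -> nat) f : Prop :=
  exists2 p : poly_on X, multihomog e p & forall x, eval_on p x = f x.

Lemma hom_fun_ext e f g : f =1 g -> hom_fun e f -> hom_fun e g.
Proof. by move=> fg [p hp pf]; exists p => // x; rewrite pf fg. Qed.

Lemma hom_const c : hom_fun (fun=> 0%N) (fun=> c).
Proof.
exists c%:MP => [m|x]; last by rewrite /eval_on mevalC.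
rewrite msuppC; case: eqP => // _; rewrite inE => /eqP-> b.
by rewrite big1 // => k _; rewrite mnm0E.
Qed.

Lemma hom_coord t : hom_fun (fun b => (block t == b) : nat) (fun x => x t).
Proof.
exists ('X_(enum_rank t)) => [m|x]; last first.
  by rewrite /eval_on mevalXU enum_rankK.
rewrite msuppX inE => /eqP-> b.
under eq_bigr do rewrite mnm1E.
rewrite big_mkcond (bigD1 (enum_rank t)) //= enum_rankK eqxx big1 ?addn0.
  by case: eqP.
by move=> k /negPf; rewrite eq_sym => ->; case: ifP.
Qed.

Lemma hom_add e f g : hom_fun e f -> hom_fun e g -> hom_fun e (fun x =>
    f x + g x).
Proof.
move=> [p hp pf] [q hq qg]; exists (p + q) => [m|x].
  by move/msuppD_le; rewrite mem_cat => /orP[/hp|/hq].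
by rewrite /eval_on mevalD -pf -qg.
Qed.

Lemma hom_mul e e' f g : hom_fun e f -> hom_fun e' g ->
  hom_fun (fun b => e b + e' b)%N (fun x => f x * g x).
Proof.
move=> [p hp pf] [q hq qg]; exists (p * q) => [m|x].
  move/msuppM_le=> /allpairsP[[m1 m2] /= [m1p m2q ->]] b.
  under eq_bigr do rewrite mnmDE.
  by rewrite big_split /= (hp _ m1p) (hq _ m2q).
by rewrite /eval_on mevalM -pf -qg.
Qed.

Lemma hom_prod (I : Type) (r : seq I) (P : pred I)
    (e : I -> factor X -> nat) (f : I -> coords X -> K) :
  (forall i, P i -> hom_fun (e i) (f i)) ->
  exists e', hom_fun e' (fun x => \prod_(i <- r | P i) f i x).
Proof.
move=> hf; elim: r => [|i r [e' IH]].
  by eexists; apply: hom_fun_ext (hom_const 1) => x; rewrite big_nil.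
case Pi: (P i); last first.
  by exists e'; apply: hom_fun_ext IH => x; rewrite big_cons Pi.
eexists; apply: hom_fun_ext (hom_mul (hf i Pi) IH) => x.
by rewrite big_cons Pi.
Qed.

Lemma hom_fun_same e f (x y : coords X) (c : factor X -> K) :
  (forall t, y t = c (block t) * x t) -> hom_fun e f ->
  f y = (\prod_b c b ^+ e b) * f x.
Proof.
move=> cP [p hp pf]; rewrite -!pf /eval_on !mevalE mulr_sumr.
rewrite big_seq [RHS]big_seq; apply: eq_bigr => m mp.
rewrite mulrCA; congr (_ * _).
under eq_bigr do rewrite cP exprMn.
rewrite big_split /=; congr (_ * _).
rewrite (partition_big (fun k => block (enum_val k)) predT) //=.
apply: eq_bigr => b _.
rewrite -(hp _ mp).
apply: (big_rec2 (fun v n => v = c b ^+ n)) => [|k v n /eqP kb ->].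
  by rewrite expr0.
by rewrite exprD kb.
Qed.

Lemma hom_fun_deg e e' f : e =1 e' -> hom_fun e f -> hom_fun e' f.
Proof. by move=> ee' [p hp pf]; exists p => // m mp b; rewrite hp. Qed.

(** A fraction of equal multidegrees descends to points. One fraction serves the whole of [U], in
    place of local ones, because every function below is given by one formula. *)
Definition regular U f : Prop := exists e P Q,
  [/\ hom_fun e P, hom_fun e Q &
      forall x, U x -> Q x != 0 /\ f x = P x / Q x].

Lemma regular_frac U e P Q : hom_fun e P -> hom_fun e Q ->
  (forall x, U x -> Q x != 0) -> regular U (fun x => P x / Q x).
Proof. by move=> hP hQ Q0; exists e, P, Q; split=> // x /Q0. Qed.

Lemma regular_field U : fun_field U (regular U).
Proof.
split; first split.
- move=> c; exists (fun=> 0%N), (fun=> c), (fun=> 1).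
  by split=> [||x _]; rewrite ?oner_eq0 ?divr1 //; apply: hom_const.
- move=> f g [e [P [Q [hP hQ fE]]]] [e' [P' [Q' [hP' hQ' gE]]]].
  exists (fun b => e b + e' b)%N, (fun x => P x * Q' x + P' x * Q x).
  exists (fun x => Q x * Q' x); split.
  + apply: (hom_add (f := fun x => P x * Q' x)); first exact: hom_mul.
    by apply: hom_fun_deg (hom_mul hP' hQ) => b; rewrite addnC.
  + exact: hom_mul.
  + move=> x Ux; have [Q0 ->] := fE x Ux; have [Q'0 ->] := gE x Ux.
    split; first exact: mulf_neq0; by field; apply/andP.
- move=> f g [e [P [Q [hP hQ fE]]]] [e' [P' [Q' [hP' hQ' gE]]]].
  exists (fun b => e b + e' b)%N, (fun x => P x * P' x).
  exists (fun x => Q x * Q' x); split; [exact: hom_mul | exact: hom_mul |].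
  move=> x Ux; have [Q0 ->] := fE x Ux; have [Q'0 ->] := gE x Ux.
  split; first exact: mulf_neq0; by field; apply/andP.
- move=> f g fg [e [P [Q [hP hQ fE]]]]; exists e, P, Q; split=> // x Ux.
  by rewrite -fg //; apply: fE.
move=> f f0 [e [P [Q [hP hQ fE]]]]; exists e, Q, P; split=> // x Ux.
have [Q0 fx] := fE x Ux; rewrite fx invf_div; split=> //.
by apply: contraNneq (f0 x Ux) => P0; rewrite fx P0 mul0r.
Qed.

Lemma regular_sub U V f : (forall x, V x -> U x) -> regular U f -> regular V f.
Proof.
by move=> VU [e [P [Q [hP hQ fE]]]]; exists e, P, Q; split=> // x /VU /fE.
Qed.

Lemma regular_same U f x y : regular U f -> U x -> U y -> same_point x y ->
  f x = f y.
Proof.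
move=> [e [P [Q [hP hQ fE]]]] Ux Uy [c c0 cP].
have [Qx ->] := fE x Ux; have [Qy ->] := fE y Uy.
move: Qy; rewrite (hom_fun_same cP hP) (hom_fun_same cP hQ).
by rewrite mulf_eq0 => /norP[d0 _]; rewrite -mulf_div divff // mul1r.
Qed.

Lemma same_point_sym (x y : coords X) : same_point x y -> same_point y x.
Proof.
move=> [c c0 cP]; exists (fun b => (c b)^-1) => [b|t];
  first by rewrite invr_eq0.
by rewrite cP mulKf.
Qed.

Lemma same_point_trans (x y z : coords X) :
  same_point x y -> same_point y z -> same_point x z.
Proof.
move=> [c c0 cP] [d d0 dP]; exists (fun b => d b * c b) => [b|t].
  by rewrite mulf_neq0.
by rewrite dP cP mulrA.
Qed.

Definition locus_closed : Prop :=
  forall x y : coords X, same_point x y -> locus x -> locus y.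

Lemma on_same (x y : coords X) :
  locus_closed -> same_point x y -> on x -> on y.
Proof.
move=> LX xy [x0 lx]; split; last exact: LX xy lx.
have [c c0 cP] := xy => b; have [t tb xt] := x0 b; exists t => //.
by rewrite cP mulf_neq0.
Qed.

Lemma zariski_open_same U (x y : coords X) :
  locus_closed -> zariski_open U -> same_point x y -> U x -> U y.
Proof.
move=> LX [S hS US] xy /US[ox [p Sp px]]; apply/US.
split; first exact: on_same xy ox.
exists p => //; have [c c0 cP] := xy; have [e he] := hS p Sp.
rewrite (hom_fun_same (f := eval_on p) (e := e) cP); last by exists p.
by rewrite mulf_neq0 //; apply/prodf_neq0=> b _; rewrite expf_neq0.
Qed.

Lemma open_hom e P : hom_fun e P -> zariski_open (fun x => on x /\ P x != 0).
Proof.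
move=> [p hp pP]; exists (fun q => q = p) => [_ ->|x]; first by exists e.
split=> [[ox Px]|[ox [_ -> px]]]; last by rewrite -pP.
by split=> //; exists p; rewrite ?pP.
Qed.

(** On [U] the zeros of [f] are those of its numerator, so it suffices to multiply by this numerator
    all the polynomials that define [U]. *)
Lemma open_regular U f : zariski_open U -> regular U f ->
  zariski_open (fun x => U x /\ f x != 0).
Proof.
move=> [S hS US] [e [P [Q [[p hp pP] _ fE]]]].
have f0 x : U x -> (f x != 0) = (P x != 0).
  move=> Ux; have [Q0 ->] := fE x Ux.
  by rewrite mulf_eq0 invr_eq0 (negPf Q0) orbF.
exists (fun q => exists2 r, S r & q = r * p) => [_ [r Sr ->]|x].
  have [e' he'] := hS r Sr.
  have [q hq qE]: hom_fun (fun b => e' b + e b)%N (eval_on (r * p)).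
    apply: hom_fun_ext (hom_mul (f := eval_on r) (g := eval_on p) _ _).
    - by move=> x; rewrite /eval_on mevalM.
    - by exists r.
    - by exists p.
  exists (fun b => e' b + e b)%N => m /msuppM_le.
  move=> /allpairsP[[m1 m2] /= [m1p m2q ->]] b.
  under eq_bigr do rewrite mnmDE.
  by rewrite big_split /= (he' _ m1p) (hp _ m2q).
split=> [[Ux]|[ox [_ [r Sr ->]]]].
  rewrite (f0 x Ux) => Px; have [ox [r Sr rx]] := (US x).1 Ux; split=> //.
  exists (r * p); first by exists r.
  by rewrite /eval_on mevalM mulf_neq0 // -/(eval_on _ _) pP.
rewrite /eval_on mevalM mulf_eq0 => /norP[rx px].
have Ux: U x by apply/US; split=> //; exists r.
by split=> //; rewrite (f0 x Ux) -pP.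
Qed.

End Regular.

(** Multiplying all coordinates by the product of all denominators leaves polynomials. They share
    one multidegree, since each fraction has numerator and denominator of the same multidegree. *)
Lemma regular_map (K : fieldType) (X Y : multiproj_set K)
    (U : coords X -> Prop) (F : coords X -> coords Y) :
  (forall t, regular U (fun x => F x t)) ->
  exists2 f : rational_map X Y, well_formed f &
    forall x, U x -> same_point (F x) (map_at f x).
Proof.
move=> FU.
have {}FU t : exists a : (factor X -> nat) * ((coords X -> K)
    * (coords X -> K)),
    [/\ hom_fun a.1 a.2.1, hom_fun a.1 a.2.2 &
      forall x, U x -> a.2.2 x != 0 /\ F x t = a.2.1 x / a.2.2 x].
  by have [e [P [Q PQ]]] := FU t; exists (e, (P, Q)).
have [a aP] := fin_all_exists FU.
pose deg b := (\sum_t (a t).1 b)%N.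
pose G t x := (\prod_t' (a t').2.2 x) * F x t.
have hG t : exists2 p : poly_on X, multihomog deg p &
    forall x, U x -> eval_on p x = G t x.
  have hprod (r : seq (Defs.coord Y)) :
      hom_fun (fun b => \sum_(t' <- r) (a t').1 b)%N
              (fun x => \prod_(t' <- r) (a t').2.2 x).
    elim: r => [|t' r IH].
      apply: hom_fun_ext (hom_fun_deg _ (hom_const X 1)) => [x|b];
        by rewrite big_nil.
    have [_ hQ _] := aP t'.
    apply: hom_fun_ext (hom_fun_deg _ (hom_mul hQ IH)) => [x|b];
      by rewrite big_cons.
  have [hP _ _] := aP t.
  (* In the common product, the denominator of the coordinate [t] is replaced by its numerator. *)
  have [p hp pE] := hom_mul hP (hprod (rem t (index_enum (Defs.coord Y)))).
  have pm : perm_eq (index_enum (Defs.coord Y))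
      (t :: rem t (index_enum (Defs.coord Y))).
    by apply: perm_to_rem; rewrite mem_index_enum.
  exists p => [m mp b|x Ux].
    by rewrite (hp m mp b) /deg (perm_big _ pm) big_cons.
  rewrite pE /G (perm_big _ pm) /= big_cons.
  by have [_ _ /(_ x Ux)[Q0 ->]] := aP t; field.
have [f fP fE] := fin_all_exists2 hG.
exists f => [b|x Ux]; first by exists deg => t _; apply: fP.
exists (fun=> \prod_t' (a t').2.2 x) => [_|t].
  by apply/prodf_neq0=> t _; have [_ _ /(_ x Ux)[]] := aP t.
by rewrite ffunE fE.
Qed.

(* Only the inverse map [Psi] has to be equivariant: together with injectivity
   this determines the action of [S] on [U]. *)
Lemma birational_criterion (K : fieldType) (X Y : multiproj_set K) (S : Type)
    (actX : S -> coords X -> coords X) (actY : S -> coords Y -> coords Y)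
    (U : coords X -> Prop)
    (V : coords Y -> Prop) (F : coords X -> coords Y)
      (Psi : coords Y -> coords X) :
  locus_closed X -> locus_closed Y ->
  zariski_open U -> zariski_open V -> (exists y, V y) ->
  (forall t, regular U (fun x => F x t)) ->
  (forall t, regular V (fun y => Psi y t)) ->
  (forall x, U x -> V (F x) /\ same_point (Psi (F x)) x) ->
  (forall y, V y -> U (Psi y) /\ same_point (F (Psi y)) y) ->
  (forall s x x', same_point x x' -> same_point (actX s x) (actX s x')) ->
  (forall s y, V y -> V (actY s y) /\ same_point (Psi (actY s y))
    (actX s (Psi y))) ->
  equivariantly_birational actX actY.
Proof.
move=> LX LY oU oV [y0 Vy0] rF rPsi FP PsiP actX_same actP.
have [f wf fF] := regular_map rF; have [g wg gPsi] := regular_map rPsi.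
have F_same x x' : U x -> U x' -> same_point x x' -> F x = F x'.
  by move=> Ux Ux' xx'; apply/ffunP=> t; apply: regular_same (rF t) _ _ xx'.
have Psi_same y y' : V y -> V y' -> same_point y y' -> Psi y = Psi y'.
  by move=> Vy Vy' yy'; apply/ffunP=> t; apply: regular_same (rPsi t) _ _ yy'.
have fV x : U x -> V (map_at f x).
  by move=> Ux; apply: zariski_open_same (fF x Ux) (FP x Ux).1.
have gU y : V y -> U (map_at g y).
  by move=> Vy; apply: zariski_open_same (gPsi y Vy) (PsiP y Vy).1.
have actU s x : U x ->
    U (actX s x) /\ same_point (actX s x) (Psi (actY s (F x))).
  move=> Ux; have [VF Fx] := FP x Ux; have [Va Psia] := actP s _ VF.
  have sx : same_point (actX s x) (Psi (actY s (F x))).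
    apply: same_point_sym; apply: same_point_trans Psia _.
    exact: actX_same.
  split=> //; apply: zariski_open_same (same_point_sym sx) _ => //.
  exact: (PsiP _ Va).1.
exists U, V, f, g; split.
- split=> //; first by split=> //; exists (Psi y0); apply: (PsiP _ Vy0).1.
  + by split=> //; exists y0.
  + by move=> s x /(actU s)[].
  + by move=> s y /(actP s)[].
- by [].
- move=> x Ux; split; first exact: fV.
  have VF := (FP x Ux).1; apply: same_point_trans (FP x Ux).2.
  rewrite (Psi_same _ _ VF (fV x Ux) (fF x Ux)).
  exact: same_point_sym (gPsi _ (fV x Ux)).
- move=> y Vy; split; first exact: gU.
  have UPsi := (PsiP y Vy).1; apply: same_point_trans (PsiP y Vy).2.
  rewrite (F_same _ _ UPsi (gU y Vy) (gPsi y Vy)).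
  exact: same_point_sym (fF _ (gU y Vy)).
- move=> s x Ux; have Vf := fV x Ux; have [Ua _] := actU s x Ux.
  have [Va Psia] := actP s _ Vf; have [UPsi FPsi] := PsiP _ Va.
  apply: same_point_trans (same_point_sym (fF _ Ua)) _.
  rewrite (F_same _ (Psi (actY s (map_at f x))) Ua UPsi) //.
  apply: same_point_sym; apply: same_point_trans Psia _; apply: actX_same.
  rewrite -(Psi_same _ _ (FP x Ux).1 Vf (fF x Ux)); exact: (FP x Ux).2.
Qed.

(** * Marked points on the projective line and their cross-ratios *)

Section Configurations.
Variables (K : fieldType) (L : finType).
Implicit Types s : L -> K * K.

Definition br (u v : K * K) : K := u.1 * v.2 - u.2 * v.1.

Lemma br_P1 (y z : P1 K) : bracket y z = br (P1_coords y) (P1_coords z).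
Proof. by []. Qed.

Lemma br_anti (u v : K * K) : br u v = - br v u.
Proof. by rewrite /br; ring. Qed.

Lemma bracket_eq0 (y z : P1 K) : bracket y z = 0 -> y = z.
Proof.
case: y z => [a|] [b|]; rewrite /bracket /= ?(mulr1, mul1r, mul0r, mulr0).
- by move/eqP; rewrite subr_eq0 => /eqP->.
- by move/eqP; rewrite sub0r oppr_eq0 oner_eq0.
- by move/eqP; rewrite subr0 oner_eq0.
- by [].
Qed.

Definition toP1 (u : K * K) : P1 K := if u.2 == 0 then None else Some (u.1 /
    u.2).

Lemma toP1_coords (u : K * K) : u != 0 ->
  exists2 c, c != 0 & u = (c * (P1_coords (toP1 u)).1,
      c * (P1_coords (toP1 u)).2).
Proof.
case: u => a b u0; rewrite /toP1 /=; case: (eqVneq b 0) u0 => [-> u0|b0 _] /=.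
  exists a; last by rewrite mulr1 mulr0.
  by apply: contraNneq u0 => ->.
by exists b => //; rewrite mulr1 mulrC divfK.
Qed.

Definition nondegenerate s : Prop := forall l l',
    l != l' -> br (s l) (s l') != 0.

Definition xr s : coords (Mbar K L) :=
  [ffun t : quadruple L * bool =>
     let p k := s (tnth (val t.1) (inord k)) in
     if t.2 then br (p 0%N) (p 3%N) * br (p 1%N) (p 2%N)
            else br (p 0%N) (p 2%N) * br (p 1%N) (p 3%N)].

Lemma quadruple_neq (q : quadruple L) (a b : 'I_4) :
  a != b -> tnth (val q) a != tnth (val q) b.
Proof.
by move=> ab; rewrite (inj_eq (tuple_uniqP _ (valP q))).
Qed.

Lemma inord_neq4 (a b : nat) : (a < 4)%N -> (b < 4)%N -> a != b ->
  inord a != inord b :> 'I_4.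
Proof.
by move=> a4 b4; apply: contra_neq => /(congr1 (@nat_of_ord 4));
  rewrite !inordK.
Qed.

Lemma br_quadruple s (q : quadruple L) (a b : nat) : nondegenerate s ->
  (a < 4)%N -> (b < 4)%N -> a != b ->
  br (s (tnth (val q) (inord a))) (s (tnth (val q) (inord b))) != 0.
Proof.
by move=> nd a4 b4 ab; apply: nd; apply: quadruple_neq; apply: inord_neq4.
Qed.

Lemma xr_neq0 s t : nondegenerate s -> xr s t != 0.
Proof.
move=> nd; rewrite ffunE /=; case: t.2;
  by apply: mulf_neq0; apply: br_quadruple.
Qed.

(* The Pluecker relation among the four points. *)
Lemma xr_neq s q : nondegenerate s -> xr s (q, false) != xr s (q, true).
Proof.
move=> nd; rewrite -subr_eq0 !ffunE /=.
set p := fun k => s (tnth (val q) (inord k)).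
have ->: br (p 0%N) (p 2%N) * br (p 1%N) (p 3%N) -
         br (p 0%N) (p 3%N) * br (p 1%N) (p 2%N) =
         br (p 0%N) (p 1%N) * br (p 2%N) (p 3%N) by rewrite /br; ring.
by apply: mulf_neq0; apply: br_quadruple.
Qed.

Section SmoothCurve.
Variables (s : L -> K * K) (nd : nondegenerate s) (cardL : (3 <= #|L|)%N).

Lemma config_neq0 l : s l != 0.
Proof.
have [l' ll']: exists l', l != l'.
  have: (0 < #|predC1 l|)%N by rewrite cardC1 -ltnS prednK (ltn_trans _ cardL).
  by case/card_gt0P=> l'; rewrite inE eq_sym; exists l'.
by apply: contraNneq (nd ll') => ->; rewrite /br !mul0r subrr.
Qed.

Lemma smooth_mark_inj i j : toP1 (s i) = toP1 (s j) -> i = j.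
Proof.
move=> eij; apply/eqP/negPn/negP=> ij; case/negP: (nd ij).
have [c _ ->] := toP1_coords (config_neq0 i).
have [d _ ->] := toP1_coords (config_neq0 j).
by rewrite eij /br /=; apply/eqP; ring.
Qed.

Definition smooth_curve : stable_curve K L.
Proof.
apply: (@StableCurve K L unit (fun _ _ => false) (fun _ _ => None) (fun=> tt)
          (fun l => toP1 (s l))) => //.
- by move=> [] []; apply: connect0.
- by move=> p /andP[_] /card_uniqP <-; rewrite (leq_trans (max_card _))
  ?card_unit.
- by move=> i j _; apply: smooth_mark_inj.
- move=> []; rewrite (eq_card (B := L)); last by move=> i; rewrite !inE.
  exact: leq_trans (leq_addr _ _).
Defined.

Lemma xr_on : on (xr s).
Proof.
split=> [q|]; first by exists (q, false); rewrite ?xr_neq0.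
exists smooth_curve => q [] p; rewrite !ffunE /=.
have sE k : exists c, s (tnth (val q) (inord k)) =
    (c * (P1_coords (p k)).1, c * (P1_coords (p k)).2).
  by have [c _ cE] := toP1_coords (config_neq0 (tnth (val q) (inord k)));
    exists c.
have [c0 ->] := sE 0%N; have [c1 ->] := sE 1%N.
have [c2 ->] := sE 2%N; have [c3 ->] := sE 3%N.
by rewrite !br_P1 /br /=; ring.
Qed.

End SmoothCurve.

(** * Trees of projective lines and their leaves *)

Section Tree.
Variable C : stable_curve K L.

(** By maximality the neighbour [u] lies on the path; if it were not the second vertex, it would
    close a cycle with at least three vertices. *)
Lemma longest_path_end (x u : Defs.comp C) p :
  path (@adj _ _ C) x p -> uniq (x :: p) ->
  (forall y q, path (@adj _ _ C) y q -> uniq (y :: q) -> (size q <= size p)%N)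
    ->
  adj x u -> exists p', p = u :: p'.
Proof.
move=> xp uxp mx xu.
have up: u \in p.
  apply/negPn/negP=> up; have := mx u (x :: p); rewrite ltnn /= => H.
  suff: false by []; apply: H; first by rewrite adj_sym xu.
  rewrite -/(uniq (x :: p)) uxp inE negb_or up !andbT.
  by apply: contraTneq xu => ->; rewrite adj_irr.
case/splitPr: up xp uxp mx => p1 p2 xp uxp _.
have: ucycle (@adj _ _ C) (x :: rcons p1 u).
  move: xp uxp; rewrite -cat_rcons cat_path => /andP[xp _].
  rewrite -cat_cons cat_uniq => /andP[uxp _]; apply/andP; split=> //.
  by rewrite /= rcons_path last_rcons (adj_sym u) xu xp.
move/adj_acyclic; rewrite /= size_rcons !ltnS leqn0 size_eq0 => /eqP->.
by exists p2.
Qed.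

(** Both ends of a longest simple path are leaves: [longest_path_end] is applied to the path and to
    its reversal. *)
Lemma two_leaves (v w : Defs.comp C) : v != w ->
  exists (x y : Defs.comp C) p, [/\ path (@adj _ _ C) x (rcons p y),
      uniq (x :: rcons p y),
    forall a, adj x a -> a = head y p & forall a, adj y a -> a = last x p].
Proof.
move=> vw.
(* Here [n] counts edges, hence tuples of [n.+1] vertices. *)
pose P n := [exists t : n.+1.-tuple (Defs.comp C),
  sorted (@adj _ _ C) t && uniq t].
have [u vu]: exists u, adj v u.
  have /connectP[[|u p] /=] := adj_connected v w; first by move=> _ E;
      rewrite E eqxx in vw.
  by move=> /andP[vu _] _; exists u.
have P1 : P 1%N.
  apply/existsP; exists [tuple v; u] => /=; rewrite vu inE !andbT.
  by apply: contraTneq vu => ->; rewrite adj_irr.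
have bP n : P n -> (n <= #|Defs.comp C|)%N.
  case/existsP=> t /andP[_ /card_uniqP ut].
  by apply: leq_trans (max_card (mem t)); rewrite ut size_tuple.
have [n /existsP[t /andP[st ut]] mx] := ex_maxnP (ex_intro (fun n =>
    P n) 1%N P1) bP.
have {}mx y q : path (@adj _ _ C) y q -> uniq (y :: q) -> (size q <= n)%N.
  move=> pq uq; apply: mx; apply/existsP; exists (in_tuple (y :: q)).
  by rewrite /= pq; move: uq => /= ->.
have n1: (0 < n)%N by apply: (mx v [:: u]); rewrite /= ?vu // inE andbT;
  apply: contraTneq vu => ->; rewrite adj_irr.
case: t st ut => -[|x p] // sp; rewrite /= => xp uxp.
have {sp} sp: size p = n by apply/eqP.
case/lastP: p sp xp uxp => [|p y] sp xp uxp; first by rewrite -sp in n1.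
exists x, y, p; split=> // z xz.
  have [p' pE] : exists p', rcons p y = z :: p'.
    by apply: (longest_path_end xp uxp) xz => y' q pq uq; rewrite sp;
      apply: mx pq uq.
  by case: (p) pE => [|a p0] [->].
have Ey : y :: rcons (rev p) x = rev (x :: rcons p y).
  by rewrite rev_cons rev_rcons.
have yp : path (@adj _ _ C) y (rcons (rev p) x).
  have: sorted (@adj _ _ C) (rev (x :: rcons p y)).
    by rewrite rev_sorted /= (eq_path (e' := @adj _ _ C)) // => a b;
      apply: adj_sym.
  by rewrite -Ey.
have [p' pE] : exists p', rcons (rev p) x = z :: p'.
  apply: (longest_path_end yp) xz => [|y' q pq uq];
    first by rewrite Ey rev_uniq.
  by rewrite size_rcons size_rev -(size_rcons p y) sp; apply: mx pq uq.
case/lastP: (p) pE => [|p0 a]; first by case=> ->.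
by rewrite rev_rcons last_rcons => -[->].
Qed.

(** Stability asks for three special points, and at most one of them is a node. *)
Lemma leaf_marks (x u0 : Defs.comp C) : (forall u, adj x u -> u = u0) ->
  exists i j : L, [/\ i != j, home C i = x & home C j = x].
Proof.
move=> xu0; have A1 : (#|[pred w | adj x w]| <= 1)%N.
  by apply/card_le1P=> a ax b; rewrite !inE in ax *;
    apply/idP/eqP => [/xu0->|->//];
     rewrite (xu0 _ ax).
have: (1 < #|[pred i | home C i == x]|)%N.
  by have := leq_trans (stability x) (leq_add (leqnn _) A1); rewrite addn1.
by case/card_gt1P=> i [j] [/eqP ix /eqP jx ij]; exists i, j.
Qed.

End Tree.

(** A reducible curve has two end components, with marks i, j on one and k, l on the other. Seen
    from the first, k and l coincide, which forces the cross-ratio of (i, j, k, l) to be 1. Hence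
    the curve is a single line, and its marks form the configuration. *)
Lemma interior_config (x : coords (Mbar K L)) :
  on x -> (forall q : quadruple L, x (q, false) != x (q, true)) ->
  exists2 s, nondegenerate s & same_point (xr s) x.
Proof.
move=> [x0 [C xC]] xdiff.
have comp1 (v w : Defs.comp C) : v = w.
  apply/eqP/negPn/negP=> /two_leaves[a [b [p [ap ua aleaf bleaf]]]].
  have [i [j [ij ia ja]]] := leaf_marks aleaf.
  have [k [l [kl kb lb]]] := leaf_marks bleaf.
  have ab: a != b by move: ua; rewrite /= mem_rcons inE negb_or =>
      /andP[/andP[]].
  (* The neighbour returned by [pick] depends only on the component [b], so all marks of [b] project
     to the same node of [a]; the path from [a] to [b] shows that such a neighbour exists. *)
  have [c ac projE]: exists2 c, adj a c &
      forall k', home C k' = b -> projection a k' = node a c.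
    pose c0 := head b p.
    have ac0 : adj a c0 by rewrite /c0; case: (p) ap => /= [|c p'] /andP[].
    have c0b : connect [rel d e : Defs.comp C | [&& adj d e,
        d != a & e != a]] c0 b.
      rewrite /c0; case: (p) ap ua => [|c p'] //=.
      move=> /andP[_ cp] /andP[]; rewrite inE negb_or => /andP[ac ap'] _.
      apply/connectP; exists (rcons p' b); last by rewrite last_rcons.
      have {}ap' : all (predC1 a) (c :: rcons p' b).
        rewrite /= eq_sym ac; apply/allP=> z zp /=.
        by apply: contraNneq ap' => <-.
      elim: (rcons p' b) c cp ap' {ac} => //= e r IH c /andP[-> er].
      by move=> /and3P[-> ea ra]; rewrite ea IH //= ea.
    rewrite /projection.
    case E: [pick w | adj a w &
        connect [rel d e : Defs.comp C | [&& adj d e,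
          d != a & e != a]] w b] => [c|].
      exists c => [|k' ->]; last by rewrite eq_sym (negPf ab) E.
      by move: E; case: pickP => // c' /andP[ac' _] [<-].
    by move: E; case: pickP => // /(_ c0); rewrite ac0 c0b.
  have uq : uniq [tuple i; j; k; l].
    rewrite /= !inE !negb_or ij kl /= !andbT.
    have neq c' d : home C c' = a -> home C d = b -> c' != d.
      by move=> ca db; apply: contraNneq ab => cd; rewrite -ca cd db.
    by rewrite !neq.
  pose q0 : quadruple L := exist (fun q : 4.-tuple L => uniq q) _ uq.
  have := xC q0 a; rewrite /= !(tnth_nth i) !inordK //=.
  rewrite (projE k) // (projE l) // => E; case/negP: (xdiff q0); apply/eqP.
  move: E; rewrite [bracket _ (node a c) * _]mulrC.
  have nz i' : home C i' = a -> bracket (projection a i') (node a c) != 0.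
    move=> i'a; apply/eqP=> /bracket_eq0; rewrite /projection i'a eqxx => /esym.
    by move: ac; rewrite -{1 2}i'a; apply: node_mark_distinct.
  by apply: mulIf; rewrite mulf_neq0 ?nz.
have mark_inj i j : mark C i = mark C j -> i = j by apply: mark_distinct.
have nd : nondegenerate (fun l => P1_coords (mark C l)).
  move=> i j ij; apply: contra_neq ij => /bracket_eq0; exact: mark_inj.
exists (fun l => P1_coords (mark C l)) => //.
set s := fun l => _ in nd *.
have xE (q : quadruple L) :
    x (q, false) * xr s (q, true) = x (q, true) * xr s (q, false).
  have := xC q (home C (tnth (val q) (inord 0))); rewrite !ffunE /= /projection.
  by rewrite !(comp1 (home C _) (home C (tnth (val q) (inord 0)))) !eqxx.
exists (fun q => x (q, true) / xr s (q, true)) => [q|[q []] /=].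
- rewrite mulf_neq0 ?invr_eq0 ?xr_neq0 //.
  have [[q' b] /= qq' xq] := x0 q; rewrite {}qq' in xq.
  case: b xq => // xq; apply: contraNneq xq => x1; apply/eqP.
  by apply: (mulIf (xr_neq0 (q, true) nd)); rewrite xE x1 !mul0r.
- by rewrite divfK ?xr_neq0.
- apply: (mulIf (xr_neq0 (q, true) nd)); rewrite xE mulrAC divfK ?xr_neq0 //.
Qed.

End Configurations.

(** * Normal forms of configurations under PGL_2 *)

Section NormalForm.
Variables (K : fieldType) (L : finType).
Implicit Types (s : L -> K * K) (x : coords (Mbar K L)).

(* [g] is the matrix with columns [g.1] and [g.2]. *)
Definition lin (g : (K * K) * (K * K)) (w : K * K) : K * K :=
  (g.1.1 * w.1 + g.2.1 * w.2, g.1.2 * w.1 + g.2.2 * w.2).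

Definition scal (c : K) (w : K * K) : K * K := (c * w.1, c * w.2).

Lemma br_lin g u v : br (lin g u) (lin g v) = br g.1 g.2 * br u v.
Proof. by rewrite /br /lin /=; ring. Qed.

Lemma br_scal c d u v : br (scal c u) (scal d v) = c * d * br u v.
Proof. by rewrite /br /scal /=; ring. Qed.

Definition config_equiv s s' : Prop := exists g (lam : L -> K),
  [/\ br g.1 g.2 != 0, forall l, lam l != 0 &
      forall l, s' l = scal (lam l) (lin g (s l))].

(** Both monomials of a cross-ratio contain each of the four points once and are products of two
    brackets, whence a common factor: the squared determinant times the four scalars. *)
Lemma xr_equiv s s' : config_equiv s s' -> same_point (xr s) (xr s').
Proof.
move=> [g [lam [g0 lam0 sE]]].
exists (fun q => br g.1 g.2 ^+ 2 *
    \prod_(k < 4) lam (tnth (val q) k)) => [q|[q b]] /=.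
  by rewrite mulf_neq0 ?expf_neq0 //; apply/prodf_neq0.
rewrite !ffunE /= !big_ord_recr big_ord0 /= mul1r.
have kE k (k4 : (k < 4)%N) : inord k = Ordinal k4 :> 'I_4.
  by apply: val_inj; rewrite /= inordK.
rewrite !sE !br_scal !br_lin.
rewrite (kE 0%N isT) (kE 1%N isT) (kE 2%N isT) (kE 3%N isT).
rewrite (_ : widen_ord _ _ = Ordinal (isT : 0 < 4)%N); last exact: val_inj.
rewrite (_ : widen_ord _ _ = Ordinal (isT : 1 < 4)%N); last exact: val_inj.
rewrite (_ : widen_ord _ _ = Ordinal (isT : 2 < 4)%N); last exact: val_inj.
rewrite (_ : ord_max = Ordinal (isT : 3 < 4)%N); last exact: val_inj.
by case: b; ring.
Qed.

Lemma nondegenerate_equiv s s' :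
  config_equiv s s' -> nondegenerate s -> nondegenerate s'.
Proof.
move=> [g [lam [g0 lam0 sE]]] nd l l' ll'.
by rewrite !sE br_scal br_lin !mulf_neq0 ?nd.
Qed.

Variables (l0 l1 l2 : L) (q0 : quadruple L).
Hypothesis ul : uniq [:: l0; l1; l2].

(** The default [q0] occurs only for [l] among the three base labels, where [normal_form] does not
    consult the quadruple. *)
Definition quad4 (l : L) : quadruple L := insubd q0 [tuple l0; l1; l2; l].

(** The base points go to infinity, 0 and 1, and any other point is then its cross-ratio with them.
    This recovers a configuration from its cross-ratios by rational functions. *)
Definition normal_form x (l : L) : K * K :=
  if l == l0 then (1, 0) else if l == l1 then (0, 1) else
  if l == l2 then (1, 1) else (x (quad4 l, false) / x (quad4 l, true), 1).

Lemma normal_formP s : nondegenerate s -> config_equiv s (normal_form (xr s)).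
Proof.
move=> nd; move: ul; rewrite /= !inE !negb_or andbT =>
  /andP[/andP[l01 l02] l12].
(* The linear map that sends [s l0] to infinity, [s l1] to 0 and [s l2] to (1 : 1); its matrix is
   [g]. *)
pose f w := (br (s l1) w * br (s l0) (s l2), br (s l0) w * br (s l1) (s l2)).
have [l10 l20 l21] : [/\ l1 != l0, l2 != l0 & l2 != l1].
  by rewrite ![l1 == _]eq_sym ![l2 == _]eq_sym.
pose g := ((- (s l1).2 * br (s l0) (s l2), - (s l0).2 * br (s l1) (s l2)),
           ((s l1).1 * br (s l0) (s l2), (s l0).1 * br (s l1) (s l2))).
have fE w : lin g w = f w.
  by rewrite /lin /g /f /br /=; congr (_, _); ring.
pose c l := if l == l0 then (br (s l1) (s l0) * br (s l0) (s l2))^-1 else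
  if l == l1 then (br (s l0) (s l1) * br (s l1) (s l2))^-1 else
  if l == l2 then (br (s l1) (s l2) * br (s l0) (s l2))^-1
  else (br (s l0) (s l) * br (s l1) (s l2))^-1.
exists g, c; split.
- have ->: br g.1 g.2 = br (s l1) (s l0) * br (s l0) (s l2) * br (s l1) (s l2).
    by rewrite /g /br /=; ring.
  by rewrite !mulf_neq0 ?nd.
- move=> l; rewrite /c; case: ifP => [_|]; first by rewrite invr_eq0 mulf_neq0
  ?nd.
  move/negbT; rewrite eq_sym => ll0.
  by do 2?[case: ifP => [_|_]; first by rewrite invr_eq0 mulf_neq0 ?nd];
    rewrite invr_eq0 mulf_neq0 ?nd.
move=> l; rewrite fE /f /c /normal_form /scal.
have brxx u : br u u = 0 :> K by rewrite /br; ring.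
case: (eqVneq l l0) => [->|ll0].
  by rewrite /= brxx mul0r mulr0 mulVf ?mulf_neq0 ?nd.
case: (eqVneq l l1) => [->|ll1].
  by rewrite /= brxx mul0r mulr0 mulVf ?mulf_neq0 ?nd.
case: (eqVneq l l2) => [->|ll2].
  congr (_, _); rewrite /= ?mulVf ?mulf_neq0 ?nd //.
  by rewrite [br (s l0) _ * _]mulrC mulVf ?mulf_neq0 ?nd.
have uq : uniq [tuple l0; l1; l2; l].
  by rewrite /= !inE !negb_or l01 l02 l12 ![_ == l]eq_sym ll0 ll1 ll2.
rewrite /= mulVf ?mulf_neq0 ?nd 1?eq_sym // !ffunE /= val_insubd uq.
rewrite !(tnth_nth l0) !inordK //=; congr (_, _).
by rewrite mulrC [br (s l0) (s l2) * _]mulrC.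
Qed.

Lemma normal_form_same x x' : same_point x x' ->
    normal_form x =1 normal_form x'.
Proof.
move=> [c c0 cE] l; rewrite /normal_form; do 3![case: ifP => // _].
by rewrite !cE /= -mulf_div divff // mul1r.
Qed.

Lemma normal_form_interior x : on x ->
  (forall q : quadruple L, x (q, false) != x (q, true)) ->
  nondegenerate (normal_form x) /\ same_point (xr (normal_form x)) x.
Proof.
move=> ox xd; have [s nd sx] := interior_config ox xd.
have se : config_equiv s (normal_form x).
  have [g [lam [g0 lam0 E]]] := normal_formP nd.
  by exists g, lam; split=> // l; rewrite -(normal_form_same sx).
split; first exact: nondegenerate_equiv se nd.
apply: same_point_trans sx; apply: same_point_sym; exact: xr_equiv.
Qed.

Lemma fun_normal_form (T : Type) (D : T -> Prop) (R : (T -> K) -> Prop)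
    (RR : fun_field D R) (x : T -> coords (Mbar K L)) :
  (forall q, R (fun t => x t (q, false) / x t (q, true))) ->
  forall l, R (fun t => (normal_form (x t) l).1) /\
            R (fun t => (normal_form (x t) l).2).
Proof.
move=> Rx l; have Rc := fun_const (fun_field_ring RR).
rewrite /normal_form; case: (l == l0); first by split; apply: Rc.
case: (l == l1); first by split; apply: Rc.
case: (l == l2); first by split; apply: Rc.
by split; [apply: Rx | apply: Rc].
Qed.

End NormalForm.

Lemma Mbar_locus_closed (K : fieldType) (L : finType) : locus_closed (Mbar K L).
Proof.
move=> x y [c c0 cE] [C xC]; exists C => q v; have := xC q v.
by rewrite !cE /= -!mulrA => ->.
Qed.

(** * Interpolating pencils and the birational chart *)

(* The labels [I * 'I_2] are the points p_i = (i, 0) and q_i = (i, 1).  [E]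
   lists the values at the elements of [O] of the vectors of a basis, indexed by
   [D], of a space of functions on [O]; a function of this space is given by its
   coefficients. *)
Section Chart.
Variables (K : fieldType) (I : finType) (e : nat) (O : {set I}).

Local Notation D := (bool + 'I_e)%type.

Definition ev (E : I -> D -> K) (c : D -> K) (i : I) : K := \sum_t c t * E i t.

Definition ev2 (E : I -> D -> K) (Y : bool -> D -> K) (i : I) : K * K :=
  (ev E (Y false) i, ev E (Y true) i).

(* The coordinates [(r, r')] form the matrix pairing the frame of the p_i with
   the frame of the q_i; the other ones are the coefficients of the two reduced
   pencils, and the positions of the points outside of [O]. *)
Definition chart : finType :=
  (bool * bool + 'I_2 * (bool * 'I_e) + {i | i \notin O} * 'I_2)%type.

Implicit Types (E : I -> D -> K) (y : chart -> K).

Definition pairing y (r r' : bool) : K := y (inl (inl (r, r'))).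

Definition pencil y (j : 'I_2) (r : bool) (t : D) : K :=
  match t with
  | inl r' => (r == r')%:R
  | inr k => y (inl (inr (j, (r, k))))
  end.

Definition position y (i : I) (j : 'I_2) : K :=
  if insub i is Some i' then y (inr (i', j)) else 0.

Definition framed E y (j : 'I_2) (i : I) : K * K :=
  if i \in O then ev2 E (pencil y j) i else (position y i j, 1).

Definition dual_mx y : (K * K) * (K * K) :=
  ((- pairing y true false, pairing y false false),
   (- pairing y true true, pairing y false true)).

(* q_i is the kernel of the pairing with the framed point. *)
Definition chart_config E y (l : I * 'I_2) : K * K :=
  if l.2 == 0 then framed E y 0 l.1 else lin (dual_mx y) (framed E y 1 l.1).

(** [dual_mx] is the pairing matrix followed by a quarter turn of the plane, which turns the bracket
    into the bilinear form of the pairing. *)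
Lemma br_dual y u v : br u (lin (dual_mx y) v) =
  pairing y false false * (u.1 * v.1) + pairing y false true * (u.1 * v.2) +
  pairing y true false * (u.2 * v.1) + pairing y true true * (u.2 * v.2).
Proof. by rewrite /br /lin /=; ring. Qed.

Lemma evD E c d i : ev E (fun t => c t + d t) i = ev E c i + ev E d i.
Proof. by rewrite -big_split; apply: eq_bigr => t _; rewrite mulrDl. Qed.

Lemma evZ E a c i : ev E (fun t => a * c t) i = a * ev E c i.
Proof. by rewrite mulr_sumr; apply: eq_bigr => t _; rewrite mulrA. Qed.

Lemma ev_ext E c d i : c =1 d -> ev E c i = ev E d i.
Proof. by move=> cd; apply: eq_bigr => t _; rewrite cd. Qed.

Definition lin_pencil (g : (K * K) * (K * K)) (Y : bool -> D -> K) (r : bool)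
    (t : D) : K :=
  if r then (lin g (Y false t, Y true t)).2 else (lin g (Y false t,
    Y true t)).1.

Lemma ev2_lin E g Y i : ev2 E (lin_pencil g Y) i = lin g (ev2 E Y i).
Proof. by rewrite /ev2 /lin_pencil /lin /= !evD !evZ. Qed.

Variables (i0 : I) (i0O : i0 \in O) (cardO : #|O| = (e.*2 + 3)%N).

(** A pencil has 2(e+2) unknown coefficients. Each of the 2e+3 indices gives one equation of
    proportionality, except [i0], which gives two because the value there is prescribed. *)
Lemma card_system : #|{: {i | i \in O} + unit}| = #|{: bool * D}|.
Proof.
rewrite card_sum card_sig card_unit card_prod card_sum !card_bool card_ord.
by rewrite cardO -addnn; clear; lia.
Qed.

(* The equations say that the value at [i] of the unknown pencil is proportional
   to [s i], and equal to it for [i = i0]. *)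
Definition interp_mx E (s : I -> K * K) (r : {i | i \in O} + unit)
    (c : bool * D) : K :=
  match r with
  | inl i =>
    if val i == i0 then (~~ c.1)%:R * E i0 c.2
    else if c.1 then (s (val i)).1 * E (val i) c.2
    else - (s (val i)).2 * E (val i) c.2
  | inr _ => c.1%:R * E i0 c.2
  end.

Definition interp_rhs (s : I -> K * K) (r : {i | i \in O} + unit) : K :=
  match r with
  | inl i => if val i == i0 then (s i0).1 else 0
  | inr _ => (s i0).2
  end.

Definition interp_det E s : K := sys_det card_system (interp_mx E s).

Definition interp E s (r : bool) (t : D) : K :=
  sys_sol card_system (interp_mx E s) (interp_rhs s) (r, t).

Lemma interp_mxE E s (Y : bool -> D -> K) r :
  \sum_c interp_mx E s r c * Y c.1 c.2 =
  match r with
  | inl i => if val i == i0 then (ev2 E Y i0).1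
             else br (s (val i)) (ev2 E Y (val i))
  | inr _ => (ev2 E Y i0).2
  end.
Proof.
rewrite (eq_bigr (fun c => interp_mx E s r (c.1, c.2) * Y c.1 c.2));
  last by case.
rewrite -(pair_bigA _ (fun a t => interp_mx E s r (a,
  t) * Y a t)) /= big_bool /=.
case: r => [i|_] /=.
  case: eqP => _ /=.
    rewrite big1 ?add0r; last by move=> t _; rewrite mul0r mul0r.
    by apply: eq_bigr => t _; rewrite mul1r mulrC.
  rewrite /br /ev2 /ev /= !mulr_sumr -sumrB -big_split /=.
  by apply: eq_bigr => t _; ring.
rewrite addrC big1 ?add0r; last by move=> t _; rewrite mul0r mul0r.
by apply: eq_bigr => t _; rewrite mul1r mulrC.
Qed.

(** A vector in the kernel is a pencil proportional to [s] on [O] and zero at [i0], so the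
    determinant condition becomes a uniqueness statement about pencils. *)
Lemma interp_det_neq0 E s :
  (forall Y, (forall i, i \in O -> br (s i) (ev2 E Y i) = 0) ->
     ev2 E Y i0 = (0, 0) -> forall r t, Y r t = 0) ->
  interp_det E s != 0.
Proof.
move=> inj; apply: sys_det_neq0 => x Ax [r t].
have Ax' r' : \sum_c interp_mx E s r' c * x (c.1, c.2) = 0.
  by rewrite -[RHS](Ax r'); apply: eq_bigr => -[].
have {}Ax' r' := etrans (esym (interp_mxE E s (fun r t => x (r,
    t)) r')) (Ax' r').
have x0 : ev2 E (fun r t => x (r, t)) i0 = (0, 0).
  have := Ax' (inr tt); have := Ax' (inl (exist _ i0 i0O)); rewrite /= eqxx.
  by rewrite /ev2 /= => -> ->.
apply: (inj (fun r t => x (r, t))) => // i iO.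
have := Ax' (inl (exist _ i iO)) => /=; case: eqP => [->|] //.
by rewrite x0 /br !mulr0 subrr.
Qed.

Lemma interp_inj E s : interp_det E s != 0 ->
  forall Y, (forall i, i \in O -> br (s i) (ev2 E Y i) = 0) ->
     ev2 E Y i0 = (0, 0) -> forall r t, Y r t = 0.
Proof.
move=> det0 Y Ys Y0 r t.
apply: (sys_det_inj det0 (x := fun c => Y c.1 c.2)) (r, t) => -[i|u].
  by rewrite interp_mxE Y0 /=; case: eqP => //= _; apply: Ys (valP i).
by rewrite interp_mxE Y0 /=.
Qed.

Lemma interpP E s : interp_det E s != 0 ->
  (forall i, i \in O -> br (s i) (ev2 E (interp E s) i) = 0) /\
  ev2 E (interp E s) i0 = s i0.
Proof.
move=> det0; have sol r : \sum_c interp_mx E s r c * interp E s c.1 c.2 =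
  interp_rhs s r.
  by rewrite -(sys_solP (interp_rhs s) det0 r); apply: eq_bigr => -[].
have Y0 : ev2 E (interp E s) i0 = s i0.
  have := sol (inr tt); have := sol (inl (exist _ i0 i0O)).
  by rewrite !interp_mxE /= eqxx; case: (s i0) => a b /= <- <-.
split=> // i iO; have := sol (inl (exist _ i iO)); rewrite interp_mxE /=.
by case: eqP => // -> _; rewrite Y0 /br; ring.
Qed.

Lemma interp_uniq E s Y : interp_det E s != 0 ->
  (forall i, i \in O -> br (s i) (ev2 E Y i) = 0) -> ev2 E Y i0 = s i0 ->
  forall r t, interp E s r t = Y r t.
Proof.
move=> det0 Ys Y0 r t; rewrite /interp.
rewrite -(sys_sol_uniq (x := fun c => Y c.1 c.2) (b := interp_rhs s) det0) //.
case=> [i|u]; rewrite interp_mxE Y0 /= //.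
by case: eqP => // _; apply: Ys (valP i).
Qed.

Lemma br0_scal (u v : K * K) : u != 0 -> br u v = 0 -> exists c, v = scal c u.
Proof.
case: u v => [a b] [c d] u0; rewrite /br /scal /= => /eqP;
  rewrite subr_eq0 => /eqP E.
have [a0|a0] := eqVneq a 0.
  have b0 : b != 0 by apply: contraNneq u0 => ->; rewrite a0.
  exists (d / b); rewrite divfK // a0 mulr0; congr (_, _).
  by apply: (mulfI b0); rewrite -E a0 mul0r mulr0.
exists (c / a); rewrite divfK //; congr (_, _).
by apply: (mulfI a0); rewrite E mulrA mulrCA divff // mulr1 mulrC.
Qed.

End Chart.

Arguments br : simpl never.
Arguments lin : simpl never.
Arguments scal : simpl never.

(** * Linear algebra of the plane *)

Section Linear2.
Variable K : fieldType.
Implicit Types (g h : (K * K) * (K * K)) (u v : K * K).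

Definition adj2 h : (K * K) * (K * K) :=
  ((h.2.2, - h.1.2), (- h.2.1, h.1.1)).

Lemma br_adj2 h u v : br u (lin (adj2 h) v) = br (lin h u) v.
Proof. by rewrite /br /lin /=; ring. Qed.

Lemma lin_adj2 h v : lin h (lin (adj2 h) v) = scal (br h.1 h.2) v.
Proof. by rewrite /br /lin /scal /=; congr (_, _); ring. Qed.

Lemma adj2_lin h v : lin (adj2 h) (lin h v) = scal (br h.1 h.2) v.
Proof. by rewrite /br /lin /scal /=; congr (_, _); ring. Qed.

Lemma br_adj2_det h : br (adj2 h).1 (adj2 h).2 = br h.1 h.2.
Proof. by rewrite /br /=; ring. Qed.

Lemma lin_scal h c v : lin h (scal c v) = scal c (lin h v).
Proof. by rewrite /lin /scal /=; congr (_, _); ring. Qed.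

Lemma scal_scal c d v : scal c (scal d v) = scal (c * d) v.
Proof. by rewrite /scal /= !mulrA. Qed.

Lemma scal1 v : scal 1 v = v.
Proof. by case: v => a b; rewrite /scal /= !mul1r. Qed.

Lemma scal0 v : scal 0 v = (0, 0).
Proof. by rewrite /scal !mul0r. Qed.

Lemma lin0 h : lin h (0, 0) = (0, 0).
Proof. by rewrite /lin !mulr0 addr0. Qed.

Lemma lin_comp h g v : lin h (lin g v) = lin (lin h g.1, lin h g.2) v.
Proof. by rewrite /lin /=; congr (_, _); ring. Qed.

Lemma lin_eq0 h v : br h.1 h.2 != 0 -> lin h v = (0, 0) -> v = (0, 0).
Proof.
move=> h0 hv; have := adj2_lin h v; rewrite hv lin0.
case: v {hv} => a b [/esym/eqP Ea /esym/eqP Eb].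
by move: Ea Eb; rewrite !mulf_eq0 (negPf h0) => /eqP-> /eqP->.
Qed.

Lemma cramer2 h v : br h.1 h.2 != 0 ->
  lin h (br v h.2 / br h.1 h.2, br h.1 v / br h.1 h.2) = v.
Proof.
move=> h0; rewrite [RHS]surjective_pairing /lin /=.
by congr (_, _); apply: (mulIf h0); rewrite mulrDl !mulrA !divfK // /br; ring.
Qed.

Lemma lin_position h v : br h.1 v != 0 ->
  lin h (br v h.2 / br h.1 v, 1) = scal (br h.1 h.2 / br h.1 v) v.
Proof.
case: h v => -[a b] [c d] [x z]; rewrite /br /lin /scal /= => h0.
by congr (_, _); field.
Qed.

Lemma br_neq0l u v : br u v != 0 -> u != (0, 0).
Proof. by apply: contraNneq => ->; rewrite /br !mul0r subrr. Qed.

Lemma br_neq0r u v : br u v != 0 -> v != (0, 0).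
Proof. by rewrite br_anti oppr_eq0; apply: br_neq0l. Qed.

End Linear2.

(** * The chart and its inverse *)

Section Coordinates.
Variables (K : fieldType) (I : finType) (e : nat) (O : {set I}).
Variables (i0 : I) (i0O : i0 \in O) (cardO : #|O| = (e.*2 + 3)%N).

Local Notation D := (bool + 'I_e)%type.
Implicit Types (E : I -> D -> K) (y : chart e O -> K) (s : I * 'I_2 -> K * K).

Definition good_chart E y : Prop :=
  nondegenerate (chart_config E y) /\
  forall j, interp_det i0 cardO E (framed E y j) != 0.

Definition pencil_of E s (j : 'I_2) : bool -> D -> K :=
  interp i0 cardO E (fun i => s (i, j)).

Definition column (Y : bool -> D -> K) (t : D) : K * K := (Y false t, Y true t).

Definition frame_of E s (j : 'I_2) : (K * K) * (K * K) :=
  (column (pencil_of E s j) (inl false), column (pencil_of E s j) (inl true)).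

(** Interpolation recovers each pencil up to a linear change. The coefficients of its first two
    basis functions serve as a frame, in which Cramer's rule expresses the rest. The pairing matrix,
    known up to a scalar, is divided by its first entry. *)
Definition chart_of E s (t : chart e O) : K :=
  match t with
  | inl (inl (r, r')) =>
      br (column (pencil_of E s 0) (inl r)) (column (pencil_of E s 1)
        (inl r')) /
      br (column (pencil_of E s 0) (inl false)) (column (pencil_of E s 1)
        (inl false))
  | inl (inr (j, (r, k))) =>
      let h := frame_of E s j in let c := column (pencil_of E s j) (inr k) in
      (if r then br h.1 c else br c h.2) / br h.1 h.2
  | inr (i, j) =>
      let h := frame_of E s j in br (s (val i, j)) h.2 / br h.1 (s (val i, j))
  end.

Definition chartable E s : Prop :=
  [/\ forall j, interp_det i0 cardO E (fun i => s (i, j)) != 0,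
      forall j, br (frame_of E s j).1 (frame_of E s j).2 != 0,
      br (frame_of E s 0).1 (frame_of E s 1).1 != 0 &
      forall i j, i \notin O -> br (frame_of E s j).1 (s (i, j)) != 0].

Lemma framed_in E y j i : i \in O -> framed E y j i = ev2 E (pencil y j) i.
Proof. by rewrite /framed => ->. Qed.

Lemma I2_cases (j : 'I_2) : {j = 0} + {j = 1}.
Proof. by case: j => -[|[|//]] ltj; [left | right]; apply: val_inj. Qed.

Lemma framed_neq0 E y j i : nondegenerate (chart_config E y) ->
  framed E y j i != (0, 0).
Proof.
move=> nd; have := nd (i, 0) (i, 1); rewrite xpair_eqE eqxx => /(_ isT).
rewrite /chart_config /= => br0.
case: (I2_cases j) => ->; first exact: br_neq0l br0.
by apply: contraNneq (br_neq0r br0) => ->; rewrite lin0.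
Qed.

Lemma dual_det E y : (1 < #|O|)%N -> nondegenerate (chart_config E y) ->
  br (dual_mx y).1 (dual_mx y).2 != 0.
Proof.
move=> /card_gt1P[i [i' [_ _ ii']]] nd.
have := nd (i, 1) (i', 1); rewrite xpair_eqE negb_and ii' => /(_ isT).
by rewrite /chart_config /= br_lin; apply: contraNneq => ->; rewrite mul0r.
Qed.

(** Applying [adj2 h] to a pencil proportional to [s] makes it proportional to the framed points, so
    uniqueness passes from one system to the other. The factor [lam i0] appears because the value at
    [i0] is prescribed. *)
Lemma interp_framed E y j h (lam : I -> K) (s : I -> K * K) :
  interp_det i0 cardO E (framed E y j) != 0 -> framed E y j i0 != (0, 0) ->
  br h.1 h.2 != 0 -> (forall i, lam i != 0) ->
  (forall i, s i = scal (lam i) (lin h (framed E y j i))) ->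
  interp_det i0 cardO E s != 0 /\
  forall t, column (interp i0 cardO E s) t =
            scal (lam i0) (lin h (column (pencil y j) t)).
Proof.
move=> det0 f0 h0 lam0 sE.
have dets : interp_det i0 cardO E s != 0.
  apply: interp_det_neq0 => // Y Ys Y0 r t.
  have Y'0 : forall r t, lin_pencil (adj2 h) Y r t = 0.
    apply: (interp_inj det0) => [i iO|]; rewrite ev2_lin;
      last by rewrite Y0 lin0.
    rewrite br_adj2; apply/eqP; have /eqP := Ys i iO.
    rewrite sE -[ev2 E Y i]scal1 br_scal mulr1 mulf_eq0 (negPf (lam0 i)) /=.
    by rewrite scal1.
  have Yt : column Y t = (0, 0).
    apply: (lin_eq0 (h := adj2 h)); first by rewrite br_adj2_det.
    have E1 : (lin (adj2 h) (column Y t)).1 = 0 := Y'0 false t.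
    have E2 : (lin (adj2 h) (column Y t)).2 = 0 := Y'0 true t.
    by rewrite [lin _ _]surjective_pairing E1 E2.
  by move: Yt => [Y1 Y2]; case: r.
split=> // t.
pose Y r t := lam i0 * lin_pencil h (pencil y j) r t.
have YE i : ev2 E Y i = scal (lam i0) (lin h (ev2 E (pencil y j) i)).
  by rewrite -ev2_lin /ev2 /Y !evZ.
have YI : forall r t, interp i0 cardO E s r t = Y r t.
  apply: (interp_uniq dets) => [i iO|]; rewrite YE.
    by rewrite sE framed_in // br_scal br_lin /br; ring.
  by rewrite sE framed_in.
by rewrite /column !YI.
Qed.

Lemma chart_of_config E y s : good_chart E y -> pairing y false false = 1 ->
  config_equiv (chart_config E y) s -> chartable E s /\ chart_of E s =1 y.
Proof.
move=> [nd dets] y1 [g [lam [g0 lam0 sE]]].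
have O1 : (1 < #|O|)%N by rewrite cardO addnC.
have dual0 := dual_det O1 nd.
(* In the coordinates of [s], the frame of the p_i is moved by [g] and that of the q_i by the dual
   matrix followed by [g]. *)
pose h j := if j == 0 :> 'I_2 then g else (lin g (dual_mx y).1,
  lin g (dual_mx y).2).
have h0 j : br (h j).1 (h j).2 != 0.
  by rewrite /h; case: (j == 0) => //=; rewrite br_lin mulf_neq0.
have sj j i : s (i, j) = scal (lam (i, j)) (lin (h j) (framed E y j i)).
  rewrite sE /chart_config /h /=; case: (I2_cases j) => -> //=.
  by rewrite lin_comp.
have fj j := interp_framed (dets j) (framed_neq0 j i0 nd) (h0 j)
  (fun i => lam0 (i, j)) (sj j).
have colE j t : column (pencil_of E s j) t =
    scal (lam (i0, j)) (lin (h j) (column (pencil y j) t)) by case: (fj j).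
have cF j : (frame_of E s j).1 = scal (lam (i0, j)) (h j).1.
  by rewrite /= colE /column /= /lin /= !mulr1 !mulr0 !addr0.
have cT j : (frame_of E s j).2 = scal (lam (i0, j)) (h j).2.
  by rewrite /= colE /column /= /lin /= !mulr1 !mulr0 !add0r.
(* All four pairings carry the same factor, so scaling the first one to 1 recovers the entries of
   [y]. *)
have pairE r r' : br (column (pencil_of E s 0) (inl r))
    (column (pencil_of E s 1) (inl r')) =
    lam (i0, 0) * lam (i0, 1) * br g.1 g.2 * pairing y r r'.
  have h1 v : lin (h 1) v = lin g (lin (dual_mx y) v) by rewrite lin_comp.
  rewrite !colE br_scal h1 -[h 0]/g br_lin br_dual /column /=.
  by rewrite -mulrA; case: r r' => -[] /=; ring.
have den0 : br (frame_of E s 0).1 (frame_of E s 1).1 != 0.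
  by rewrite pairE y1 mulr1 !mulf_neq0.
have frE j : br (frame_of E s j).1 (frame_of E s j).2 =
    lam (i0, j) * lam (i0, j) * br (h j).1 (h j).2.
  by rewrite cF cT br_scal.
have posE j i : i \notin O -> br (frame_of E s j).1 (s (i, j)) =
    lam (i0, j) * lam (i, j) * br (h j).1 (h j).2.
  move=> iO; rewrite cF sj br_scal /framed (negPf iO).
  by rewrite /br /lin /=; ring.
split.
  split=> [j|j||i j iO] //; first by case: (fj j).
    by rewrite frE !mulf_neq0.
  by rewrite posE // !mulf_neq0.
case=> [[[r r']|[j [r k]]]|[i j]] /=.
- by rewrite !pairE y1 mulr1 -[RHS]mul1r mulrAC divff // !mulf_neq0.
- rewrite -[br (column _ (inl false)) (column _ (inl true))]/(br (frame_of E s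
  j).1 (frame_of E s j).2).
  rewrite frE; set d := _ * br _ _; have d0 : d != 0 by rewrite !mulf_neq0.
  apply: (mulIf d0); rewrite divfK //.
  have -> : (if r then br (column (pencil_of E s j) (inl false))
         (column (pencil_of E s j) (inr k))
      else br (column (pencil_of E s j) (inr k)) (column (pencil_of E s j)
        (inl true))) =
    (if r then br (frame_of E s j).1 (column (pencil_of E s j) (inr k))
      else br (column (pencil_of E s j) (inr k)) (frame_of E s j).2) by [].
  rewrite cF cT colE !br_scal /d; case: r; rewrite /br /lin /column /=; ring.
- have iO := valP i.
  rewrite -[column (pencil_of E s j) (inl false)]/((frame_of E s j).1).
  rewrite posE //; set d := _ * br _ _; have d0 : d != 0 by rewrite !mulf_neq0.
  apply: (mulIf d0); rewrite divfK //.
  rewrite -[column (pencil_of E s j) (inl true)]/((frame_of E s j).2) cT sj.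
  rewrite br_scal /framed (negPf iO) /position.
  have -> : insub (val i) = Some i by rewrite valK.
  by rewrite /d /br /lin /=; ring.
Qed.

Lemma chart_ofP E s : nondegenerate s -> chartable E s ->
  good_chart E (chart_of E s) ->
  pairing (chart_of E s) false false = 1 /\
  config_equiv s (chart_config E (chart_of E s)).
Proof.
move=> nds [dets fr0 den0 pos0] [nd _]; set y := chart_of E s in nd *.
have y1 : pairing y false false = 1 by rewrite /pairing /= divff.
split=> //; pose h := frame_of E s.
have hpencil j t : lin (h j) (column (pencil y j) t)
    = column (pencil_of E s j) t.
  case: t => [r|k].
    rewrite /h /frame_of /column /lin /=; case: r => /=;
    by rewrite ?(mulr1, mulr0, addr0, add0r).
  exact: (@cramer2 _ (h j) (column (pencil_of E s j) (inr k)) (fr0 j)).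
have hev2 j i : lin (h j) (ev2 E (pencil y j) i) = ev2 E (pencil_of E s j) i.
  rewrite -ev2_lin; congr (_, _); apply: ev_ext => t; rewrite /lin_pencil.
    exact: (congr1 fst (hpencil j t)).
  exact: (congr1 snd (hpencil j t)).
have s0 i j : s (i, j) != (0, 0).
  have [k ki] : exists k, k != j.
    by case: (I2_cases j) => ->; [exists 1 | exists 0].
  by apply: br_neq0l (nds _ (i, k) _); rewrite xpair_eqE eqxx eq_sym.
(* The inverse frame carries each point of [s] to a multiple of the framed point: on [O] by
   interpolation, elsewhere by the choice of the position. *)
have frame j i : exists2 mu, mu != 0 & framed E y j i =
    scal mu (lin (adj2 (h j)) (s (i, j))).
  have [mu E1] : exists mu, lin (h j) (framed E y j i) = scal mu (s (i, j)).
    have [iO|iO] := boolP (i \in O).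
      have [Ys _] := interpP i0O (dets j).
      rewrite framed_in // hev2; exact: br0_scal (s0 i j) (Ys i iO).
    exists (br (h j).1 (h j).2 / br (h j).1 (s (i, j))).
    have p0 := pos0 i j iO; rewrite -/(h j) in p0.
    rewrite /framed (negPf iO) /position insubT /= -/(h j).
    exact: (@lin_position _ (h j)).
  have mu0 : mu != 0.
    apply: contraTneq (framed_neq0 j i nd) => mu0; rewrite negbK; apply/eqP.
    by apply: (lin_eq0 (fr0 j)); rewrite -/(h j) E1 mu0 scal0.
  have d0 := fr0 j; rewrite -/(h j) in d0.
  exists ((br (h j).1 (h j).2)^-1 * mu); first by rewrite mulf_neq0 ?invr_eq0.
  by rewrite -scal_scal -lin_scal -E1 adj2_lin scal_scal mulVf // scal1.
have frame_choice (l : I * 'I_2) : exists mu, mu != 0 /\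
    framed E y l.2 l.1 = scal mu (lin (adj2 (h l.2)) (s l)).
  by case: l => i j; have [mu mu0 E1] := frame j i; exists mu.
have [mu muP] := fin_all_exists frame_choice.
(* The pairing of u and w is the bracket of [h 0] u with [h 1] w, up to a scalar; moving [h 0]
   across as an adjugate gives the dual matrix. *)
have dualE w : lin (dual_mx y) w =
    scal (br (h 0).1 (h 1).1)^-1 (lin (adj2 (h 0)) (lin (h 1) w)).
  by rewrite /lin /scal /dual_mx /pairing /= -/(h 0) -/(h 1);
    rewrite /br /=; congr (_, _); rewrite !mulrDr; ring.
exists (adj2 (h 0)), (fun l => if l.2 == 0 then mu l else
   (br (h 0).1 (h 1).1)^-1 * (mu l * br (h 1).1 (h 1).2)); split.
- by rewrite br_adj2_det; apply: fr0.
- by move=> l; have [mu0 _] := muP l; case: ifP => _ //;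
  rewrite !mulf_neq0 ?invr_eq0 ?fr0.
case=> i j; have [_ fE] := muP (i, j); rewrite /chart_config /= in fE *.
case: (I2_cases j) fE => -> /= fE; first by rewrite fE.
rewrite dualE fE lin_scal lin_adj2 lin_scal lin_scal scal_scal scal_scal.
by rewrite mulrA.
Qed.

End Coordinates.

(** * Rationality of the chart formulas *)

Section ChartFunctions.
Variables (K : fieldType) (T : Type) (Dom : T -> Prop) (R : (T -> K) -> Prop).

Definition fun_vec (f : T -> K * K) : Prop :=
  R (fun t => (f t).1) /\ R (fun t => (f t).2).

Section Ring.
Hypothesis RR : fun_ring Dom R.

Lemma fun_br f g : fun_vec f -> fun_vec g -> R (fun t => br (f t) (g t)).
Proof. by move=> [f1 f2] [g1 g2]; apply: (fun_sub RR); apply: (fun_mul RR). Qed.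

Lemma fun_lin g f : fun_vec (fun t => (g t).1) -> fun_vec (fun t => (g t).2) ->
  fun_vec f -> fun_vec (fun t => lin (g t) (f t)).
Proof.
move=> [g11 g12] [g21 g22] [f1 f2].
by split; apply: (fun_add RR); apply: (fun_mul RR).
Qed.

Lemma fun_xr (L : finType) (s : T -> L -> K * K) :
  (forall l, fun_vec (fun t => s t l)) -> forall q, R (fun t => xr (s t) q).
Proof.
move=> Rs [q b].
apply: (fun_ext RR (f := fun t => let p k := s t (tnth (val q) (inord k)) in
   if b then br (p 0%N) (p 3%N) * br (p 1%N) (p 2%N)
            else br (p 0%N) (p 2%N) * br (p 1%N) (p 3%N))).
  by move=> t _; rewrite ffunE.
by case: b; apply: (fun_mul RR); apply: fun_br.
Qed.

Variables (I : finType) (e : nat) (O : {set I}).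
Variables (E : T -> I -> bool + 'I_e -> K) (y : T -> chart e O -> K).
Hypothesis RE : forall i t', R (fun t => E t i t').
Hypothesis Ry : forall t', R (fun t => y t t').

Lemma fun_ev (c : T -> bool + 'I_e -> K) i :
  (forall t', R (fun t => c t t')) -> R (fun t => ev (E t) (c t) i).
Proof. by move=> Rc; apply: (fun_sum RR) => t' _; apply: (fun_mul RR). Qed.

Lemma fun_framed j i : fun_vec (fun t => framed (E t) (y t) j i).
Proof.
have Rp r t' : R (fun t => pencil (y t) j r t').
  by case: t' => [r'|k] /=; [apply: (fun_const RR) | apply: Ry].
rewrite /framed /position; case: (i \in O); first by split; apply: fun_ev.
split; last exact: (fun_const RR).
by case: insub => [i'|]; [apply: Ry | apply: (fun_const RR)].
Qed.

Lemma fun_dual : fun_vec (fun t => (dual_mx (y t)).1) /\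
                 fun_vec (fun t => (dual_mx (y t)).2).
Proof. by split; split; try apply: (fun_opp RR); apply: Ry. Qed.

Lemma fun_chart_config l : fun_vec (fun t => chart_config (E t) (y t) l).
Proof.
rewrite /chart_config; case: (l.2 == 0); first exact: fun_framed.
by apply: fun_lin; [exact: fun_dual.1 | exact: fun_dual.2 | exact: fun_framed].
Qed.

Variables (i0 : I) (cardO : #|O| = (e.*2 + 3)%N).

Lemma fun_interp_mx (s : T -> I -> K * K) (Rs : forall i,
    fun_vec (fun t => s t i)) r c :
  R (fun t => interp_mx i0 (E t) (s t) (O := O) r c).
Proof.
case: r => [i|_] /=; last by apply: (fun_mul RR) => //; apply: (fun_const RR).
have [R1 R2] := Rs (val i).
case: eqP => _; first by apply: (fun_mul RR) => //; apply: (fun_const RR).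
by case: c.1; apply: (fun_mul RR) => //; apply: (fun_opp RR).
Qed.

Lemma fun_interp_det (s : T -> I -> K * K) : (forall i,
    fun_vec (fun t => s t i)) ->
  R (fun t => interp_det i0 cardO (E t) (s t)).
Proof. by move=> Rs; apply: (fun_sys_det _ RR) => r c;
  apply: fun_interp_mx. Qed.

Lemma fun_framed_det j : R (fun t => interp_det i0 cardO (E t) (framed (E t)
    (y t) j)).
Proof. by apply: fun_interp_det => i; apply: fun_framed. Qed.

End Ring.

Section Field.
Hypothesis RR : fun_field Dom R.
Let R1 := fun_field_ring RR.

Variables (I : finType) (e : nat) (O : {set I}).
Variables (E : T -> I -> bool + 'I_e -> K) (s : T -> I * 'I_2 -> K * K).
Hypothesis RE : forall i t', R (fun t => E t i t').
Hypothesis Rs : forall l, fun_vec (fun t => s t l).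
Variables (i0 : I) (cardO : #|O| = (e.*2 + 3)%N).

Lemma fun_pencil_of j r t' :
  (forall t, Dom t -> interp_det i0 cardO (E t) (fun i => s t (i, j)) != 0) ->
  R (fun t => pencil_of i0 cardO (E t) (s t) j r t').
Proof.
move=> dets; apply: (fun_sys_sol RR) => [|r' c|[i|u]]; first exact: dets.
- exact: (fun_interp_mx R1).
- rewrite /=; case: eqP => _; last exact: (fun_const R1).
  exact: (proj1 (Rs (i0, j))).
- exact: (proj2 (Rs (i0, j))).
Qed.

Lemma fun_frames j :
  (forall t, Dom t -> interp_det i0 cardO (E t) (fun i => s t (i, j)) != 0) ->
  fun_vec (fun t => (frame_of i0 cardO (E t) (s t) j).1) /\
  fun_vec (fun t => (frame_of i0 cardO (E t) (s t) j).2).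
Proof. by move=> dets; split; split; apply: fun_pencil_of. Qed.

Lemma fun_chart_of :
  (forall t, Dom t -> chartable i0 cardO (E t) (s t)) ->
  forall c : chart e O, R (fun t => chart_of i0 cardO (E t) (s t) c).
Proof.
move=> ch c.
have dets j t : Dom t -> interp_det i0 cardO (E t) (fun i => s t (i, j)) != 0.
  by move=> /ch[].
have Rc j t' : fun_vec (fun t => column (pencil_of i0 cardO (E t) (s t) j) t').
  by split; apply: fun_pencil_of (dets j).
clear dets; case: c => [[[r r']|[j [r k]]]|[i j]] /=.
- apply: (fun_div RR) => [t /ch[]||] //; exact: (fun_br R1 (Rc _ _) (Rc _ _)).
- apply: (fun_div RR) => [t /ch[_ fr _ _]||]; first exact: fr.
    by case: r; apply: (fun_br R1 (Rc _ _) (Rc _ _)).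
  exact: (fun_br R1 (Rc _ _) (Rc _ _)).
- apply: (fun_div RR) => [t /ch[_ _ _ pos]||].
  + by apply: pos; apply: (valP i).
  + exact: (fun_br R1 (Rs _) (Rc _ _)).
  + exact: (fun_br R1 (Rc _ _) (Rs _)).
Qed.

End Field.
End ChartFunctions.

Section Conditions.
Variables (K : fieldType) (I : finType) (e : nat) (O : {set I}).
Variables (i0 : I) (cardO : #|O| = (e.*2 + 3)%N).
Implicit Types (E : I -> bool + 'I_e -> K) (y : chart e O -> K)
  (s : I * 'I_2 -> K * K).

(** Goodness as the nonvanishing of a single polynomial, the form in which it defines open sets and
    can be tested for genericity. *)
Definition good_fun E y : K :=
  (\prod_(p : (I * 'I_2) * (I * 'I_2) | p.1 != p.2)
     br (chart_config E y p.1) (chart_config E y p.2)) *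
  \prod_(j : 'I_2) interp_det i0 cardO E (framed E y j).

Lemma good_funP E y : good_fun E y != 0 <-> good_chart i0 cardO E y.
Proof.
rewrite mulf_eq0 negb_or; split.
  move=> /andP[/prodf_neq0 nd /prodf_neq0 dets]; split=> [l l' ll'|j].
    exact: (nd (l, l')).
  exact: dets.
move=> [nd dets]; apply/andP; split; first by apply/prodf_neq0 => p; apply: nd.
by apply/prodf_neq0 => j _; apply: dets.
Qed.

(** Kept apart from [frames_fun], whose entries are regular only where these determinants do not
    vanish: the open set is cut out in two steps. *)
Definition dets_fun E s : K :=
  \prod_(j : 'I_2) interp_det i0 cardO E (fun i => s (i, j)).

Definition frames_fun E s : K :=
  let h := frame_of i0 cardO E s in
  (\prod_(j : 'I_2) br (h j).1 (h j).2) * br (h 0).1 (h 1).1 *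
  \prod_(p : I * 'I_2 | p.1 \notin O) br (h p.2).1 (s p).

Lemma chartableP E s : dets_fun E s != 0 -> frames_fun E s != 0 ->
  chartable i0 cardO E s.
Proof.
move=> /prodf_neq0 dets; rewrite !mulf_eq0 !negb_or.
move=> /andP[/andP[/prodf_neq0 fr den] /prodf_neq0 pos]; split=> //.
- by move=> j; apply: dets.
- by move=> j; apply: fr.
- by move=> i j iO; apply: (pos (i, j)).
Qed.

Lemma chartable_dets E s : chartable i0 cardO E s -> dets_fun E s != 0.
Proof. by case=> dets _ _ _; apply/prodf_neq0. Qed.

Lemma chartable_frames E s : chartable i0 cardO E s -> frames_fun E s != 0.
Proof.
case=> dets fr den pos; rewrite !mulf_neq0 //.
  by apply/prodf_neq0 => j _; apply: fr.
by apply/prodf_neq0 => -[i j] iO; apply: pos.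
Qed.

End Conditions.

(** * Equivariance of the chart under permutations and field automorphisms *)

Section Equivariance.
Variables (K : fieldType) (I : finType) (e : nat) (O : {set I}).
Variables (i0 : I) (i0O : i0 \in O) (cardO : #|O| = (e.*2 + 3)%N).
Variables (sigma : {rmorphism K -> K}) (a : {perm I}) (tau : {perm 'I_2}).
Hypothesis sigma_bij : bijective sigma.
Hypothesis aO : forall i, (a i \in O) = (i \in O).

(** When [tau] exchanges the p_i with the q_i, the pairing matrix is transposed. The default of
    [insubd] is not reached if [a] preserves [O]. *)
Definition chart_perm (t : chart e O) : chart e O :=
  match t with
  | inl (inl (r, r')) => inl (inl (if tau 0 == 0 then (r, r') else (r', r)))
  | inl (inr (j, rk)) => inl (inr (tau j, rk))
  | inr (i, j) => inr (insubd i (a (val i)), tau j)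
  end.

Definition map_vec (u : K * K) : K * K := (sigma u.1, sigma u.2).

Lemma map_vec_lin g v :
  map_vec (lin g v) = lin (map_vec g.1, map_vec g.2) (map_vec v).
Proof. by rewrite /lin /map_vec /= !rmorphD !rmorphM. Qed.

Lemma br_map_vec u v : br (map_vec u) (map_vec v) = sigma (br u v).
Proof. by rewrite /br /= rmorphB !rmorphM. Qed.

Variables (E E' : I -> bool + 'I_e -> K) (y y' : chart e O -> K).
Hypothesis E'E : forall i t, E' (a i) t = sigma (E i t).
Hypothesis y'y : forall t, y' (chart_perm t) = sigma (y t).

Lemma pencil_act j r t : pencil y' (tau j) r t = sigma (pencil y j r t).
Proof.
case: t => [r'|k] /=; first by rewrite rmorph_nat.
by rewrite -(y'y (inl (inr (j, (r, k))))).
Qed.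

Lemma ev_act c c' i : (forall t, c' t = sigma (c t)) ->
  ev E' c' (a i) = sigma (ev E c i).
Proof.
by move=> cE; rewrite rmorph_sum; apply: eq_bigr => t _; rewrite cE E'E rmorphM.
Qed.

Lemma framed_act j i : framed E' y' (tau j) (a i) = map_vec (framed E y j i).
Proof.
rewrite /framed aO; case: ifP => iO.
  by rewrite /ev2 /map_vec /=; congr (_, _); apply: ev_act => t;
    apply: pencil_act.
rewrite /map_vec /= rmorph1; congr (_, _); rewrite /position.
have iN : i \notin O by rewrite iO.
have aiN : a i \notin O by rewrite aO.
rewrite !insubT -(y'y (inr (Sub i iN, j))) /=.
by congr (y' (inr (_, _))); apply: val_inj; rewrite /= val_insubd /= aiN.
Qed.

Lemma tau_cases : (tau 0 = 0 /\ tau 1 = 1) \/ (tau 0 = 1 /\ tau 1 = 0).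
Proof.
have: tau 0 != tau 1 by rewrite (inj_eq perm_inj).
case: (I2_cases (tau 0)) => ->; case: (I2_cases (tau 1)) => -> //;
  by [left | right].
Qed.

(** Without an exchange the configuration is merely permuted. With one, transposing the pairing
    matrix replaces the dual matrix by minus its adjugate; the adjugate is then the change of
    coordinates, and accounts for the sign and the determinant in [lam]. *)
Lemma chart_config_act : nondegenerate (chart_config E y) -> (1 < #|O|)%N ->
  exists g (lam : I * 'I_2 -> K), [/\ br g.1 g.2 != 0, forall l, lam l != 0 &
    forall i j, chart_config E' y' (a i, tau j) =
      scal (lam (i, j)) (lin g (map_vec (chart_config E y (i, j))))].
Proof.
move=> nd O1; have d0 := dual_det O1 nd.
pose M := (map_vec (dual_mx y).1, map_vec (dual_mx y).2).
have M0 : br M.1 M.2 != 0 by rewrite br_map_vec fmorph_eq0.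
case: tau_cases => -[t0 t1].
  exists ((1, 0), (0, 1)), (fun=> 1); split=> [|l|i j].
  - by rewrite /br /= mul1r mul0r subr0 oner_eq0.
  - by rewrite oner_eq0.
  have lin1 v : lin ((1, 0), (0, 1)) v = v :> K * K.
    by case: v => b c; rewrite /lin /= !mul1r !mul0r addr0 add0r.
  rewrite scal1 lin1 /chart_config /=.
  case: (I2_cases j) => ->; rewrite ?t0 ?t1 /=; first by rewrite -framed_act t0.
  rewrite map_vec_lin -framed_act t1; congr (lin _ _).
  have pE r r' : pairing y' r r' = sigma (pairing y r r').
    by rewrite -(y'y (inl (inl (r, r')))) /= t0.
  by rewrite /dual_mx /map_vec !pE /= !rmorphN.
exists (adj2 M), (fun l => if l.2 == 0 then -1 else (br M.1 M.2)^-1); split.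
- by rewrite br_adj2_det.
- by move=> l; case: ifP => _; rewrite ?oppr_eq0 ?oner_eq0 ?invr_eq0.
move=> i j; rewrite /chart_config /=.
case: (I2_cases j) => ->; rewrite ?t0 ?t1 /=; last first.
  rewrite map_vec_lin adj2_lin scal_scal mulVf // scal1.
  by rewrite -framed_act t1.
have pE r r' : pairing y' r r' = sigma (pairing y r' r).
  by rewrite -(y'y (inl (inl (r', r)))) /= t0.
rewrite -t0 framed_act /dual_mx !pE; case: (map_vec _) => b c.
by rewrite /lin /scal /M /dual_mx /map_vec /= !rmorphN; congr (_, _); ring.
Qed.

Lemma good_chart_act : good_chart i0 cardO E y -> good_chart i0 cardO E' y'.
Proof.
move=> [nd dets]; have O1 : (1 < #|O|)%N by rewrite cardO addnC.
split.
  have [g [lam [g0 lam0 gE]]] := chart_config_act nd O1.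
  move=> l l' ll'.
  have lE (k : I * 'I_2) : k = (a (a^-1%g k.1), tau (tau^-1%g k.2)).
    by case: k => i j; rewrite !permKV.
  rewrite (lE l) (lE l') !gE br_scal br_lin br_map_vec !mulf_neq0 // fmorph_eq0.
  apply: nd; apply: contra_neq ll' => -[E1 E2].
  by rewrite (lE l) (lE l') E1 E2.
move=> j'; rewrite -(permKV tau j'); set j := tau^-1%g j'.
(* The permutation may move [i0], so a pencil vanishing at [i0] need not pull back to one. A
   multiple [c] of the known pencil is subtracted first; evaluation at the preimage of [i0] then
   shows that [c] is 0. *)
apply: interp_det_neq0 => // Y' Ys' Y0' r t.
have [sinv sK sKV] := sigma_bij.
pose Y r t := sinv (Y' r t).
have YE r' t' : Y' r' t' = sigma (Y r' t') by rewrite sKV.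
have evE i : ev2 E' Y' (a i) = map_vec (ev2 E Y i).
  by rewrite /ev2 /map_vec /=; congr (_, _); apply: ev_act => t'; apply: YE.
have Ys i : i \in O -> br (framed E y j i) (ev2 E Y i) = 0.
  move=> iO; apply/eqP; rewrite -(fmorph_eq0 sigma)
    -br_map_vec -evE -framed_act.
  by rewrite Ys' // aO.
have [c cE] := br0_scal (framed_neq0 j i0 nd) (Ys i0 i0O).
pose Z r t := Y r t + (- c) * pencil y j r t.
have ZE i : ev2 E Z i = ((ev2 E Y i).1 - c * (ev2 E (pencil y j) i).1,
                         (ev2 E Y i).2 - c * (ev2 E (pencil y j) i).2).
  by rewrite /ev2 /Z !evD !evZ !mulNr.
have Z0 : forall r t, Z r t = 0.
  apply: (interp_inj (dets j)) => [i iO|].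
    rewrite ZE; have := Ys i iO; rewrite framed_in // /br /= => H.
    by rewrite -[RHS]H; ring.
  by rewrite ZE cE framed_in // /scal /= !subrr.
have c0 : c = 0.
  have := evE (a^-1%g i0); rewrite permKV Y0' => /esym.
  set i1 := a^-1%g i0; have i1O : i1 \in O by rewrite -aO permKV.
  have := framed_neq0 j i1 nd; rewrite framed_in //.
  have Yc : ev2 E Y i1 = scal c (ev2 E (pencil y j) i1).
    have YZ r' t' : Y r' t' = c * pencil y j r' t'.
      by apply/eqP; rewrite -subr_eq0 -mulNr -/(Z r' t') Z0.
    by rewrite /ev2 /scal /= -!evZ; congr (_, _); apply: ev_ext.
  rewrite Yc; case: (ev2 _ _ i1) => u v uv.
  rewrite /map_vec /scal /= => -[/eqP]; rewrite fmorph_eq0 mulf_eq0 => cu /eqP.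
  rewrite fmorph_eq0 mulf_eq0 => cv; apply/eqP; apply: contraNT uv => /negPf c0.
  by move: cu cv; rewrite c0 /= => /eqP-> /eqP->.
have := Z0 r t; rewrite /Z c0 oppr0 mul0r addr0 YE => ->; exact: rmorph0.
Qed.

End Equivariance.

(** * Generic points *)

Definition infinite_field (K : fieldType) : Prop :=
  forall n, exists2 s : seq K, uniq s & (n < size s)%N.

Section Lines.
Variables (K : fieldType) (A : finType).
Hypothesis Kinf : infinite_field K.
Implicit Types (v w : {ffun A -> K}) (f g : {ffun A -> K} -> K).

Definition line v w (c : K) : {ffun A -> K} := [ffun t =>
    v t + c * (w t - v t)].

Definition line_poly f : Prop :=
  forall v w, exists p : {poly K}, forall c, f (line v w c) = p.[c].

Lemma line_poly_ring : fun_ring (fun=> True) line_poly.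
Proof.
split=> [c v w|f g fP gP v w|f g fP gP v w|f g fg fP v w].
- by exists c%:P => d; rewrite hornerC.
- have [p pE] := fP v w; have [q qE] := gP v w.
  by exists (p + q) => c; rewrite hornerD pE qE.
- have [p pE] := fP v w; have [q qE] := gP v w.
  by exists (p * q) => c; rewrite hornerM pE qE.
- by have [p pE] := fP v w; exists p => c; rewrite -fg.
Qed.

Lemma line_poly_coord t : line_poly (fun v => v t).
Proof.
move=> v w; exists ((v t)%:P + 'X * (w t - v t)%:P) => c.
by rewrite !hornerE ffunE.
Qed.

Definition generic f : Prop := line_poly f /\ exists v, f v != 0.

(** On the line joining the two witnesses both functions restrict to nonzero polynomials in one
    variable, and their product has finitely many roots. *)
Lemma generic_mul f g : generic f -> generic g -> generic (fun v => f v * g v).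
Proof.
move=> [fP [v fv]] [gP [w gw]]; split; first exact: (fun_mul line_poly_ring).
have [p pE] := fP v w; have [q qE] := gP v w.
have line0 : line v w 0 = v by apply/ffunP=> t; rewrite ffunE mul0r addr0.
have line1 : line v w 1 = w by apply/ffunP=> t; rewrite ffunE mul1r subrKC.
have pq0 : p * q != 0.
  rewrite mulf_neq0 //.
    by apply: contraNneq fv => p0; rewrite -line0 pE p0 horner0.
  by apply: contraNneq gw => q0; rewrite -line1 qE q0 horner0.
have [s us ss] := Kinf (size (p * q)).
have [c _ cP] : exists2 c, c \in s & ~~ root (p * q) c.
  apply/allPn/negP=> rs; have := max_poly_roots pq0 rs us.
  by rewrite ltnNge (ltnW ss).
by exists (line v w c); rewrite pE qE -hornerM.
Qed.

Lemma generic1 : generic (fun=> 1).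
Proof.
split; first exact: (fun_const line_poly_ring).
by exists [ffun=> 0]; rewrite oner_eq0.
Qed.

Lemma generic_ext f g : f =1 g -> generic f -> generic g.
Proof.
move=> fg [fP [v fv]]; split; last by exists v; rewrite -fg.
by apply: (fun_ext line_poly_ring) fP => w _; apply: fg.
Qed.

Lemma generic_opp f : generic f -> generic (fun v => - f v).
Proof.
move=> [fP [v fv]]; split; first exact: (fun_opp line_poly_ring).
by exists v; rewrite oppr_eq0.
Qed.

Lemma generic_prod (N : Type) (r : seq N) (P : pred N)
    (f : N -> {ffun A -> K} -> K) :
  (forall n, P n -> generic (f n)) -> generic (fun v =>
    \prod_(n <- r | P n) f n v).
Proof.
move=> fP; elim: r => [|n r IH].
  by apply: generic_ext generic1 => v; rewrite big_nil.
case Pn: (P n); last by apply: generic_ext IH => v; rewrite big_cons Pn.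
by apply: generic_ext (generic_mul (fP n Pn) IH) => v; rewrite big_cons Pn.
Qed.

End Lines.

Section GenericChart.
Variables (K : fieldType) (I : finType) (e : nat) (O : {set I}).
Variables (i0 : I) (i0O : i0 \in O) (cardO : #|O| = (e.*2 + 3)%N).

Local Notation D := (bool + 'I_e)%type.

Definition reduced_pencil (al : bool -> 'I_e -> K) (r : bool) (t : D) : K :=
  match t with inl r' => (r == r')%:R | inr k => al r k end.

(** The first field says that the first two basis functions alone embed [O] in the projective line,
    the second that some pencil is determined up to a scalar by its points on [O]. They provide
    witnesses for distinct points and for the interpolation determinants respectively. *)
Record generic_basis (E : I -> D -> K) : Prop := GenericBasis {
  basis_indep : forall i i', i \in O -> i' \in O -> i != i' ->
    E i (inl false) * E i' (inl true) - E i (inl true) * E i' (inl false) != 0;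
  basis_rigid : exists al : bool -> 'I_e -> K,
    (forall i, i \in O -> ev2 E (reduced_pencil al) i != (0, 0)) /\
    forall Y, (forall i, i \in O -> br (ev2 E (reduced_pencil al) i)
      (ev2 E Y i) = 0) ->
      exists c, forall r t, Y r t = c * reduced_pencil al r t }.

Variables (A : finType) (Kinf : infinite_field K).
Variables (E : {ffun A -> K} -> I -> D -> K) (y : {ffun A -> K} ->
  chart e O -> K).
Variables (E0 : I -> D -> K) (E0P : generic_basis E0).
Hypothesis E_line : forall i t, line_poly (fun v => E v i t).
Hypothesis y_line : forall t, line_poly (fun v => y v t).
Hypothesis y_surj : forall y0, pairing y0 false false = 1 ->
  exists2 v, E v = E0 & y v = y0.

Definition mk_chart (b : bool -> bool -> K) (al : bool -> 'I_e -> K)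
    (z : I -> K)
    (t : chart e O) : K :=
  match t with
  | inl (inl (r, r')) => b r r'
  | inl (inr (j, (r, k))) => al r k
  | inr (i, j) => z (val i)
  end.

Definition basis_vec (z : I -> K) i : K * K :=
  if i \in O then (E0 i (inl false), E0 i (inl true)) else (z i, 1).

Lemma framed_mk b z j i : framed E0 (mk_chart b (fun _ _ =>
    0) z) j i = basis_vec z i.
Proof.
rewrite /framed /basis_vec /position; case: ifP => iO.
  by rewrite /ev2 /ev !big_sumType /= !big_bool /= !mul1r !mul0r
     !add0r !addr0 !big1 ?addr0 // => k _; rewrite mul0r.
by case: insubP => [i' _ /= ->|] //; rewrite iO.
Qed.

Lemma O_other i : exists2 i', i' \in O & i' != i.
Proof.
have: (0 < #|O :\ i|)%N by rewrite -(ltn_add2l (i \in O))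
    -cardsD1 cardO addn3; case: (i \in O).
by case/card_gt0P=> i'; rewrite !inE => /andP[]; exists i'.
Qed.

Lemma basis_vec_neq0 z i : basis_vec z i != (0, 0).
Proof.
rewrite /basis_vec; case: ifP => iO; last first.
  by apply/negP=> /eqP[_ /eqP]; rewrite oner_eq0.
have [i' i'O i'i] := O_other i.
by apply: contraNneq (basis_indep E0P i'O iO i'i) => -[-> ->];
  rewrite !mulr0 subrr.
Qed.

Lemma generic_framed j i i' : i != i' ->
  generic (fun v => br (framed (E v) (y v) j i) (framed (E v) (y v) j i')).
Proof.
move=> ii'; split.
  by apply: (fun_br (line_poly_ring K A)); apply: (fun_framed (line_poly_ring K
    A)).
have wit z : br (basis_vec z i) (basis_vec z i') != 0 ->
    exists v, br (framed (E v) (y v) j i) (framed (E v) (y v) j i') != 0.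
  move=> bz; have [v vE vy] := y_surj (y0 := mk_chart (fun _ _ =>
    1) (fun _ _ => 0) z) erefl.
  by exists v; rewrite vE vy !framed_mk.
have [iO|iO] := boolP (i \in O); have [i'O|i'O] := boolP (i' \in O).
- by apply: (wit (fun=> 0)); rewrite /basis_vec iO i'O; apply: basis_indep.
- have := basis_vec_neq0 (fun=> 0) i.
  have [u0 u1|u0 _] := eqVneq (basis_vec (fun=> 0) i).1 0.
    apply: (wit (fun=> 1)); move: u1 u0.
    rewrite /basis_vec iO (negPf i'O) /br /= => u1 u0;
      rewrite u0 mul0r mulr1 sub0r oppr_eq0.
    by apply: contraNneq u1 => ->; rewrite u0.
  apply: (wit (fun=> 0)); move: u0.
  by rewrite /basis_vec iO (negPf i'O) /br /= mulr0 subr0 mulr1.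
- have := basis_vec_neq0 (fun=> 0) i'.
  have [u0 u1|u0 _] := eqVneq (basis_vec (fun=> 0) i').1 0.
    apply: (wit (fun=> 1)); move: u1 u0.
    rewrite /basis_vec i'O (negPf iO) /br /= => u1 u0;
      rewrite u0 mulr0 mul1r subr0.
    by apply: contraNneq u1 => ->; rewrite u0.
  apply: (wit (fun=> 0)); move: u0.
  by rewrite /basis_vec i'O (negPf iO) /br /= mul0r sub0r mul1r oppr_eq0.
- apply: (wit (fun k => (k == i')%:R)).
  rewrite /basis_vec (negPf iO) (negPf i'O) /br /= eqxx (negPf ii').
  by rewrite mul0r sub0r mul1r oppr_eq0 oner_eq0.
Qed.

Lemma generic_dual_det : generic (fun v => br (dual_mx (y v)).1 (dual_mx (y
    v)).2).
Proof.
split.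
  have [d1 d2] := fun_dual (line_poly_ring K A) y_line.
  exact: (fun_br (line_poly_ring K A)).
have [v _ vy] := y_surj (y0 := mk_chart (fun r r' =>
    (r == r')%:R) (fun _ _ => 0) (fun=> 0)) erefl.
by exists v; rewrite vy /br /= mulr0 mul1r sub0r opprK oner_eq0.
Qed.

Lemma generic_pairing i i' : generic (fun v =>
  br (framed (E v) (y v) 0 i) (lin (dual_mx (y v)) (framed (E v) (y v) 1 i'))).
Proof.
split.
  have [d1 d2] := fun_dual (line_poly_ring K A) y_line.
  apply: (fun_br (line_poly_ring K A)); first exact: (fun_framed
    (line_poly_ring K A)).
  by apply: (fun_lin (line_poly_ring K A)) => //;
    apply: (fun_framed (line_poly_ring K A)).
set z : I -> K := fun=> 0.
have := basis_vec_neq0 z i; have := basis_vec_neq0 z i'.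
have wit b : b false false = 1 ->
    let u := basis_vec z i in let w := basis_vec z i' in
    b false false * (u.1 * w.1) + b false true * (u.1 * w.2) +
    b true false * (u.2 * w.1) + b true true * (u.2 * w.2) != 0 ->
    exists v, br (framed (E v) (y v) 0 i)
                 (lin (dual_mx (y v)) (framed (E v) (y v) 1 i')) != 0.
  move=> b1 u w buw; have [v vE vy] := y_surj (y0 := mk_chart b (fun _ _ =>
    0) z) b1.
  by exists v; rewrite vE vy !framed_mk br_dual.
case: (basis_vec z i) (basis_vec z i') wit => [u1 u2] [w1 w2] /= wit w0 u0.
(* The first entry of [b] has to be 1. The forms u1 w1, u1 (w1 + w2), (u1 + u2) w1 and (u1 + u2) (w1
   + w2) are tried in turn; for the last one only u2 w2 survives, and it cannot vanish. *)
have [uw|uw] := eqVneq (u1 * w1) 0; last first.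
  apply: (wit (fun r r' => (~~ r && ~~ r')%:R)) => //=.
  by rewrite mul1r !mul0r !addr0.
have [uw'|uw'] := eqVneq (u1 * w2) 0; last first.
  apply: (wit (fun r r' => (~~ r)%:R)) => //=.
  by rewrite uw !mul0r mulr0 !mul1r add0r !addr0.
have [uw''|uw''] := eqVneq (u2 * w1) 0; last first.
  apply: (wit (fun r r' => (~~ r')%:R)) => //=.
  by rewrite uw uw' !mul0r !mulr0 !mul1r !add0r !addr0.
apply: (wit (fun _ _ => 1)) => //=; rewrite uw uw' uw'' !mul1r !add0r.
rewrite mulf_neq0 //.
  apply: contraNneq u0 => u2z; move/eqP: uw; move/eqP: uw'.
  rewrite !mulf_eq0; case: (eqVneq u1 0) => [->|_] /=; first by rewrite u2z.
  by move=> /eqP w2z /eqP w1z; rewrite w1z w2z eqxx in w0.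
apply: contraNneq w0 => w2z; move/eqP: uw; move/eqP: uw''.
rewrite !mulf_eq0; case: (eqVneq w1 0) => [->|_]; first by rewrite w2z.
by rewrite !orbF => /eqP u2z /eqP u1z; rewrite u1z u2z eqxx in u0.
Qed.

Lemma generic_interp_det j :
  generic (fun v => interp_det i0 cardO (E v) (framed (E v) (y v) j)).
Proof.
split; first exact: (fun_framed_det (line_poly_ring K A)).
(* The rigid pencil is the witness: a kernel vector is a multiple of it that vanishes at [i0]. *)
have [al [al0 alP]] := basis_rigid E0P.
have [v vE vy] := y_surj (y0 := mk_chart (fun _ _ => 1) al (fun=> 0)) erefl.
exists v; rewrite vE vy.
have fE i : i \in O ->
    framed E0 (mk_chart (fun _ _ => 1) al (fun=> 0))
      j i = ev2 E0 (reduced_pencil al) i.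
  by move=> iO; rewrite framed_in.
apply: interp_det_neq0 => // Y Ys Y0.
have [i iO|c cE] := alP Y; first by rewrite -fE // Ys.
suff c0 : c = 0 by move=> r t; rewrite cE c0 mul0r.
have: ev2 E0 Y i0 = scal c (ev2 E0 (reduced_pencil al) i0).
  by rewrite /ev2 /scal /= -!evZ; congr (_, _); apply: ev_ext.
rewrite Y0; have := al0 i0 i0O; case: (ev2 _ _ i0) => u w uw.
rewrite /scal /= => -[/esym/eqP cu /esym/eqP cw].
apply/eqP; apply: contraNT uw => /negPf c0; move: cu cw.
by rewrite !mulf_eq0 c0 /= => /eqP-> /eqP->.
Qed.

Lemma generic_good : generic (fun v => good_fun i0 cardO (E v) (y v)).
Proof.
apply: (generic_mul Kinf); last by apply: (generic_prod Kinf) => j _;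
  apply: generic_interp_det.
apply: (generic_prod Kinf) => -[[i j] [i' j']];
  rewrite /chart_config /= xpair_eqE negb_and => ll'.
case: (I2_cases j) (I2_cases j') ll' => -> [] -> /=; rewrite ?orbF ?orbT.
- exact: generic_framed.
- by move=> _; apply: generic_pairing.
- move=> _; apply: generic_ext (generic_opp (generic_pairing i' i)) => v.
  by rewrite -br_anti.
- move=> ii'; apply: generic_ext (generic_mul Kinf generic_dual_det
  (generic_framed 1 ii')) => v.
  by rewrite br_lin.
Qed.

End GenericChart.

(** * Polynomial bases in general position *)

Section Bases.
Variables (K : fieldType) (I : finType) (e : nat) (O : {set I}).
Hypothesis cardO : #|O| = (e.*2 + 3)%N.

Local Notation D := (bool + 'I_e)%type.

(** The index type becomes the set of exponents 0, ..., e+1, the reduced part of a pencil being in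
    degrees 0 and 1. *)
Definition deg (t : D) : nat :=
  match t with inl r => r | inr k => k.+2 end.

Lemma deg_inj : injective deg.
Proof.
by move=> [[]|k] [[]|k'] //= [E]; congr inr; apply: val_inj.
Qed.

Lemma deg_lt t : (deg t < e.+2)%N.
Proof. by case: t => [[]|k] //=; rewrite !ltnS. Qed.

Definition powers (theta : I -> K) (i : I) (t : D) : K := theta i ^+ deg t.

Definition pol (c : D -> K) : {poly K} := \sum_t c t *: 'X^(deg t).

Lemma coef_pol c t : (pol c)`_(deg t) = c t.
Proof.
rewrite coef_sum (bigD1 t) //= coefZ coefXn eqxx mulr1 big1 ?addr0 // => t' t't.
by rewrite coefZ coefXn (inj_eq deg_inj) eq_sym (negPf t't) mulr0.
Qed.

Lemma size_pol c : (size (pol c) <= e.+2)%N.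
Proof.
apply: leq_trans (size_sum _ _ _) _; apply/bigmax_leqP=> t _.
by apply: leq_trans (size_scale_leq _ _) _; rewrite size_polyXn deg_lt.
Qed.

Lemma horner_pol theta c i : (pol c).[theta i] = ev (powers theta) c i.
Proof. by rewrite horner_sum; apply: eq_bigr => t _;
  rewrite hornerZ hornerXn. Qed.

(* The pencil spanned by 1 and X + X^(e+1) is rigid: if (u, w) is everywhere
   proportional to it on [O] then w = (X + X^(e+1)) u for reasons of degree. *)
Lemma powers_basis (theta : I -> K) : {in O &, injective theta} ->
  generic_basis O (powers theta).
Proof.
move=> th_inj; split.
  move=> i i' iO i'O ii'; rewrite /powers /= !expr0 !expr1 mul1r mulr1 subr_eq0
    eq_sym.
  by apply: contra_neq ii'; apply: th_inj.
(* The last element of ['I_e] has degree e+1. For e = 0 there is none, and the second generator is X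
   alone. *)
pose al (r : bool) (k : 'I_e) : K := (r && (k.+1 == e))%:R.
exists al; set P := reduced_pencil al.
have P0 : pol (P false) = 1.
  rewrite /pol big_sumType big_bool /= scale1r scale0r expr0 add0r big1 ?addr0
    // => k _.
  by rewrite scale0r.
have szb : size (pol (P true)) = e.+2.
  have [t0 dt0 t01] : exists2 t, deg t = e.+1 & P true t = 1.
    have [e0|e0] := posnP e; first by exists (inl true); rewrite //= e0.
    have lt_e : (e.-1 < e)%N by rewrite prednK.
    by exists (inr (Ordinal lt_e)); rewrite /P /= /al /= prednK ?eqxx.
  apply/eqP; rewrite eqn_leq size_pol ltnNge; apply/negP=> sz.
  by have := coef_pol (P true) t0; rewrite dt0 nth_default // t01 => /eqP;
    rewrite eq_sym oner_eq0.
split=> [i iO|Y Ys].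
  by rewrite /ev2 -horner_pol P0 hornerC; apply/negP=> /eqP[/eqP];
    rewrite oner_eq0.
pose u := pol (Y false); pose w := pol (Y true); pose b := pol (P true).
(* The difference has degree at most 2e+2 and vanishes at the 2e+3 values of [theta] on [O]. *)
have wu : w = b * u.
  apply/eqP; rewrite -subr_eq0; apply/negPn/negP=> q0.
  have := max_poly_roots q0 (rs := [seq theta i | i <- enum O]).
  have -> : all (root (w - b * u)) [seq theta i | i <- enum O].
    apply/allP=> x /mapP[i]; rewrite mem_enum => iO {x}->.
    rewrite /root !hornerE !horner_pol; have := Ys i iO.
    by rewrite /ev2 /br /= -[ev _ (P false) i]horner_pol P0 hornerC mul1r => ->.
  rewrite map_inj_in_uniq ?enum_uniq; last first.
    by move=> i i'; rewrite !mem_enum; apply: th_inj.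
  move=> /(_ isT isT); rewrite size_map -cardE cardO ltnNge => /negP; apply.
  apply: leq_trans (size_polyD _ _) _; rewrite size_polyN geq_max.
  rewrite (leq_trans (size_pol _)); last by rewrite -addnn; clear; lia.
  apply: leq_trans (size_polyMleq _ _) _; rewrite szb.
  by have := size_pol (Y false); rewrite -/u -addnn; move: (size u) => k; lia.
have b0 : b != 0 by rewrite -size_poly_gt0 szb.
have su : (size u <= 1)%N.
  have [->|u0] := eqVneq u 0; first by rewrite size_poly0.
  have := size_pol (Y true); rewrite -/w wu size_mul // szb.
  by move: u0; rewrite -size_poly_gt0; move: (size u) => k; lia.
have uE := size1_polyC su; set c := u`_0 in uE.
exists c => r t; case: r.
  by rewrite -[LHS]coef_pol -/w wu uE mulrC mul_polyC coefZ coef_pol.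
by rewrite -[LHS]coef_pol -/u uE -[c%:P]mulr1 -P0 mul_polyC coefZ coef_pol.
Qed.

End Bases.

Section ThreePoints.
Variables (K : fieldType) (I : finType) (O : {set I}) (i1 i2 i3 : I).
Hypothesis O3 : O = [set i1; i2; i3].
Hypothesis i12 : i1 != i2.
Hypothesis i13 : i1 != i3.
Hypothesis i23 : i2 != i3.

(* The points infinity, 0 and 1. *)
Definition three_basis (i : I) (t : bool + 'I_0) : K :=
  if i == i1 then (t == inl false)%:R else if i == i2 then (t == inl true)%:R
    else 1.

(** Its values 0 and 1 are Galois-fixed for every F. It replaces the powers of [theta] when all
    indices are fixed, as F may have fewer than three elements. *)
Lemma three_basisP : generic_basis O three_basis.
Proof.
have e1 t : three_basis i1 t = (t == inl false)%:R by rewrite /three_basis eqxx.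
have e2 t : three_basis i2 t = (t == inl true)%:R.
  by rewrite /three_basis eq_sym (negPf i12) eqxx.
have e3 t : three_basis i3 t = 1.
  by rewrite /three_basis ![i3 == _]eq_sym (negPf i13) (negPf i23).
have OP i : i \in O -> [\/ i = i1, i = i2 | i = i3].
  by rewrite O3 !inE -orbA => /or3P[] /eqP ->;
    [constructor 1|constructor 2|constructor 3].
split.
  move=> i i' /OP iO /OP i'O; case: iO i'O => -> [] ->; rewrite ?eqxx // => _;
  by rewrite ?e1 ?e2 ?e3 /= ?(mulr0, mulr1, subr0, sub0r) ?oppr_eq0 ?oner_eq0.
exists (fun _ _ => 0); set P := reduced_pencil _.
have evE Y i : ev2 three_basis Y i =
    (Y false (inl true) * three_basis i (inl true) +
     Y false (inl false) * three_basis i (inl false),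
     Y true (inl true) * three_basis i (inl true) +
     Y true (inl false) * three_basis i (inl false)).
  by rewrite /ev2 /ev !big_sumType /= !big_bool !big_ord0 !addr0.
have PE i : ev2 three_basis P i = (three_basis i (inl false),
    three_basis i (inl true)).
  by rewrite evE /= !mul1r !mul0r addr0 add0r.
split=> [i|Y Ys].
  by case/OP=> ->; rewrite PE ?e1 ?e2 ?e3 xpair_eqE /= oner_eq0 ?andbF.
have O1 : i1 \in O by rewrite O3 !inE eqxx.
have O2 : i2 \in O by rewrite O3 !inE eqxx orbT.
have O3' : i3 \in O by rewrite O3 !inE eqxx orbT.
have := Ys i1 O1; have := Ys i2 O2; have := Ys i3 O3'.
rewrite !PE !evE !e1 !e2 !e3 /br /= !(mulr0, mul0r, mulr1, mul1r, addr0,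
  add0r, subr0, sub0r).
move=> E3 /eqP; rewrite oppr_eq0 => /eqP E2 E1.
exists (Y false (inl false)) => r [r'|[k //]].
move: E3; rewrite E1 E2 addr0 add0r => /eqP; rewrite subr_eq0 => /eqP E3.
by case: r r' => -[] /=; rewrite ?mulr1 ?mulr0.
Qed.

End ThreePoints.

(** Multiplication by a nonzero x permutes the nonzero elements, and translation by 1 permutes all
    elements; compare the products, respectively the sums. *)
Lemma finite_field_frobenius (K : fieldType) (s : seq K) : uniq s ->
  (forall x, x \in s) ->
  (forall x : K, x ^+ size s = x) /\ (size s)%:R = 0 :> K.
Proof.
move=> us sK; have s0 : (0 < size s)%N by case: (s) (sK 0).
split=> [x|].
  have [->|x0] := eqVneq x 0; first by rewrite expr0n eqn0Ngt s0.
  pose s' := rem 0 s; have us' : uniq s' by rewrite rem_uniq.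
  have ms' y : (y \in s') = (y != 0) by rewrite mem_rem_uniq // !inE sK andbT.
  have pm : perm_eq [seq x * y | y <- s'] s'.
    apply: uniq_perm => //; first by rewrite map_inj_uniq //; apply: mulfI.
    move=> y; rewrite ms'; apply/mapP/idP => [[z]|y0].
      by rewrite ms' => z0 ->; rewrite mulf_neq0.
    by exists (x^-1 * y); rewrite ?ms' ?mulVKf // mulf_neq0 ?invr_eq0.
  have prod0 : \prod_(y <- s') y != 0.
    by rewrite big_seq prodf_seq_neq0; apply/allP=> y ys; apply/implyP;
      rewrite ms'.
  have : \prod_(y <- [seq x * y | y <- s']) y = \prod_(y <- s')
      y by apply: perm_big.
  rewrite big_map big_split /= big_const_seq count_predT iter_mulr_1 => E.
  have x1 : x ^+ size s' = 1 by apply: (mulIf prod0); rewrite E mul1r.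
  have := size_rem (sK 0); rewrite -/s' => sz.
  by rewrite -(prednK s0) -sz exprS x1 mulr1.
have pm : perm_eq [seq 1 + y | y <- s] s.
  apply: uniq_perm => //; first by rewrite map_inj_uniq //; apply: addrI.
  move=> y; rewrite sK; apply/mapP; exists (y - 1) => //.
  by rewrite addrC subrK.
have : \sum_(y <- [seq 1 + y | y <- s]) y = \sum_(y <- s) y by apply: perm_big.
rewrite big_map big_split /= big_const_seq count_predT iter_addr_0.
by move/eqP; rewrite -subr_eq0 addrK => /eqP.
Qed.

Lemma infinite_or_finite (K : fieldType) :
  infinite_field K \/ exists2 s : seq K, uniq s & forall x, x \in s.
Proof.
have [[s us sK]|nfin] := classic (exists2 s : seq K, uniq s & forall x,
    x \in s).
  by right; exists s.
left; elim=> [|n [s us ns]].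
  by exists [:: 0].
have [x xs] : exists x, x \notin s.
  apply: NNPP => nx; apply: nfin; exists s => // x.
  by apply/negPn/negP=> xs; apply: nx; exists x.
by exists (x :: s); rewrite //= xs.
Qed.

(** If Fs had q elements, X^q - X + 1 would have derivative -1, hence be separable, and yet take the
    value 1 everywhere. *)
Lemma separably_closed_infinite (F Fs : fieldType)
    (iota : {rmorphism F -> Fs}) :
  separable_closure iota -> infinite_field Fs.
Proof.
move=> [_ sc]; case: (infinite_or_finite Fs) => // -[s us sK].
have [frob q0] := finite_field_frobenius us sK.
have s1 : (1 < size s)%N.
  have := @uniq_leq_size _ [:: 0; 1] s; apply => [|y _]; last exact: sK.
  by rewrite /= inE eq_sym oner_eq0.
pose p : {poly Fs} := 'X^(size s) - 'X + 1.
have szp : size p = (size s).+1.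
  rewrite /p -addrA size_polyDl ?size_polyXn //.
  apply: leq_ltn_trans (size_polyD _ _) _.
  by rewrite size_polyN size_polyX size_poly1 !ltnS.
have sep : separable_poly p.
  rewrite separable_poly.unlock.
  have -> : p^`() = (-1)%:P.
    have s0 : (size s)%:R = 0 :> {poly Fs} by rewrite -polyC_natr q0.
    by rewrite /p !derivE -mulr_natr s0 mulr0 sub0r addr0 polyCN.
  by rewrite -alg_polyC coprimepZr ?oppr_eq0 ?oner_eq0 // coprimep1.
have [|x] := sc p sep; first by rewrite szp ltnS ltnW.
by rewrite /root /p !hornerE frob subrr add0r oner_eq0.
Qed.

(** * Galois descent *)

Lemma finite_roots (K : fieldType) (p : {poly K}) : p != 0 ->
  exists s : seq K, forall x, root p x -> x \in s.
Proof.
move=> p0.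
have step k : (exists s : seq K, forall x, root p x -> x \in s) \/
    exists s : seq K, [/\ uniq s, all (root p) s & size s = k].
  elim: k => [|k [IH|[s [us rs sk]]]]; [by right; exists [::] | by left |].
  have [all_s|nall] := classic (forall x, root p x -> x \in s); first by left;
      exists s.
  right; have [x [px xs]] : exists x, root p x /\ x \notin s.
    apply: NNPP => nx; apply: nall => x px.
    by apply/negPn/negP=> xs; apply: nx; exists x.
  by exists (x :: s); rewrite /= xs us px rs sk.
have [//|[s [us rs ss]]] := step (size p).
by have := max_poly_roots p0 rs us; rewrite ss ltnn.
Qed.

Lemma classical_filter (T : eqType) (P : T -> Prop) (s : seq T) :
  exists2 s', uniq s' & forall x, x \in s' <-> x \in s /\ P x.
Proof.
elim: s => [|x s [s' us' sP]]; first by exists [::] => // x; split=> // -[].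
have [xs'|xs'] := boolP (x \in s').
  exists s' => // y; rewrite sP inE; split=> [[-> ?]|[/orP[/eqP ->|->] Py]];
      rewrite ?orbT //.
  exact/sP.
have [Px|nPx] := classic (P x).
  exists (x :: s') => [|y]; first by rewrite /= xs'.
  rewrite !inE; split=> [/orP[/eqP->|/sP[-> Py]]|[/orP[->|ys] Py]];
    rewrite ?eqxx ?orbT //.
  by apply/orP; right; apply/sP.
exists s' => // y; rewrite sP inE; split=> [[-> Py]|[/orP[/eqP->|//]]].
  by rewrite orbT.
by move=> Px; case: nPx.
Qed.

(** The power x^k depends only on X^k modulo p, and over a finite F there are finitely many
    residues. *)
Lemma root_of_unity_of_finite (F Fs : fieldType) (iota : {rmorphism F -> Fs})
    (s : seq F) (p : {poly F}) (x : Fs) :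
  (forall a, a \in s) -> p != 0 -> root (map_poly iota p) x -> x != 0 ->
  exists2 n, (0 < n)%N & x ^+ n = 1.
Proof.
move=> sF p0 px x0.
have ltidx (a : F) : (index a s < size s)%N by rewrite index_mem.
pose code (k : nat) : {ffun 'I_(size p) -> 'I_(size s)} :=
  [ffun i : 'I_(size p) => Ordinal (ltidx ('X^k %% p)`_i)].
have code_inj k l : code k = code l -> x ^+ k = x ^+ l.
  move=> kl; have E : 'X^k %% p = 'X^l %% p.
    apply/polyP=> i; have [ip|ip] := ltnP i (size p); last first.
      by rewrite !nth_default // (leq_trans _ ip) // ltnW // ltn_modp.
    move/ffunP/(_ (Ordinal ip)): kl; rewrite !ffunE => /(congr1 val) /= kl.
    by rewrite -(nth_index 0 (sF ('X^k %% p)`_i)) kl nth_index.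
  have ev j : x ^+ j = (map_poly iota ('X^j %% p)).[x].
    rewrite -[LHS]hornerXn -(map_polyXn iota) {1}(divp_eq 'X^j p).
    by rewrite rmorphD rmorphM /= hornerD hornerM (rootP px) mulr0 add0r.
  by rewrite !ev E.
have [k [l [kl E]]] : exists k l : nat, (k < l)%N /\ code k = code l.
  pose N := #|{ffun 'I_(size p) -> 'I_(size s)}|.
  have ninj : ~~ injectiveb (fun i : 'I_N.+1 => code i).
    by apply/negP=> /injectiveP/leq_card; rewrite card_ord ltnn.
  have /injectivePn[k [l kl E]] := ninj.
  case: (ltngtP k l) => [lt_kl|lt_lk|eq_kl]; first by exists k, l.
    by exists l, k.
  by case/eqP: kl; apply: val_inj.
exists (l - k)%N; first by rewrite subn_gt0.
by apply: (mulIf (expf_neq0 k x0)); rewrite -exprD subnK ?(ltnW kl)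
  // mul1r (code_inj _ _ E).
Qed.

(** The group generated by x and y is a finite subgroup of the multiplicative group of a field,
    hence cyclic; z is a generator. *)
Lemma common_root_of_unity (K : fieldType) (x y : K) (n l : nat) :
  (0 < n)%N -> (0 < l)%N -> x ^+ n = 1 -> y ^+ l = 1 ->
  exists z i j a b, [/\ z = x ^+ i * y ^+ j, x = z ^+ a & y = z ^+ b].
Proof.
move=> n0 l0 xn yl.
pose rs := undup [seq x ^+ i * y ^+ j | i <- iota 0 n, j <- iota 0 l].
have rsP i j : x ^+ i * y ^+ j \in rs.
  rewrite mem_undup; apply/allpairsP; exists (i %% n, j %% l)%N => /=.
  by rewrite !mem_iota !ltn_mod n0 l0 !expr_mod.
have rsE z : z \in rs -> exists i j, z = x ^+ i * y ^+ j.
  by rewrite mem_undup => /allpairsP[[i j] /= [_ _ ->]]; exists i, j.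
have x0 : x != 0 by apply/eqP=> x0; move/eqP: xn;
    rewrite x0 expr0n eqn0Ngt n0 eq_sym oner_eq0.
have y0 : y != 0 by apply/eqP=> y0; move/eqP: yl;
    rewrite y0 expr0n eqn0Ngt l0 eq_sym oner_eq0.
have rs0 z : z \in rs -> z != 0 by case/rsE=> i [j ->];
    rewrite mulf_neq0 ?expf_neq0.
have urs : uniq rs by apply: undup_uniq.
have rsX z : z \in rs -> z ^+ size rs = 1.
  move=> zrs; have z0 := rs0 z zrs.
  have pm : perm_eq [seq z * w | w <- rs] rs.
    apply: uniq_perm => //; first by rewrite map_inj_uniq //; apply: mulfI.
    have sub : {subset [seq z * w | w <- rs] <= rs}.
      move=> _ /mapP[w /rsE[i [j ->]] ->]; have [i' [j' ->]] := rsE z zrs.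
      by rewrite mulrACA -!exprD.
    apply: (uniq_min_size _ sub _).2; last by rewrite size_map.
    by rewrite map_inj_uniq //; apply: mulfI.
  have prod0 : \prod_(w <- rs) w != 0.
    by rewrite big_seq prodf_seq_neq0; apply/allP=> w ws; rewrite rs0 ?implybT.
  have : \prod_(w <- [seq z * w | w <- rs]) w = \prod_(w <- rs)
      w by apply: perm_big.
  rewrite big_map big_split /= big_const_seq count_predT iter_mulr_1 => E.
  by apply: (mulIf prod0); rewrite E mul1r.
have szrs : (0 < size rs)%N by have := rsP 0%N 0%N; case: (rs).
have /hasP[z zrs zprim] : has (size rs).-primitive_root rs.
  apply: has_prim_root => //; apply/allP=> z /rsX zX; exact/unity_rootP.
have [i [j zE]] := rsE z zrs.
have xrs : x \in rs by have := rsP 1%N 0%N; rewrite expr1 expr0 mulr1.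
have yrs : y \in rs by have := rsP 0%N 1%N; rewrite expr1 expr0 mul1r.
have [a xE] := prim_rootP zprim (rsX x xrs).
have [b yE] := prim_rootP zprim (rsX y yrs).
by exists z, i, j, a, b.
Qed.

(** * Primitive elements and equivariant functions on finite Galois sets *)

Section Galois.
Variables (F Fs : fieldType) (iota : {rmorphism F -> Fs}).
Hypothesis hFs : separable_closure iota.
Implicit Types (g h : galois_group iota) (x y : Fs).

Lemma galois_one : exists g, forall x, g x = x.
Proof.
unshelve eexists (@GaloisElt F Fs iota idfun _ _) => //.
by exists id.
Qed.

Lemma galois_comp g h : exists gh : galois_group iota, forall x, gh x = g (h x).
Proof.
unshelve eexists (@GaloisElt F Fs iota (g \o h) _ _) => //.
- by apply: bij_comp; apply: gal_bij.
- by move=> a /=; rewrite !gal_fix.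
Qed.

Lemma galois_inv g : exists h, (forall x, h (g x) = x) /\ (forall x,
    g (h x) = x).
Proof.
have [f gK fK] := gal_bij g.
pose fR : {rmorphism Fs -> Fs} := HB.pack f
  (GRing.isZmodMorphism.Build _ _ f (can2_zmod_morphism gK fK))
  (GRing.isMonoidMorphism.Build _ _ f (can2_monoid_morphism gK fK)).
unshelve eexists (@GaloisElt F Fs iota fR _ _) => //.
- by exists g.
- by move=> a /=; rewrite -[X in f X](gal_fix g) gK.
Qed.

Lemma algebraic_elt x : exists2 p : {poly F}, p != 0 & root (map_poly iota p) x.
Proof.
have [alg _] := hFs; have [p sp px] := alg x.
by exists p => //; apply: separable_poly_neq0.
Qed.

Lemma galois_conjugates x : exists s : seq Fs, forall g, g x \in s.
Proof.
have [p p0 px] := algebraic_elt x.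
have [|s sP] := @finite_roots Fs (map_poly iota p);
    first by rewrite map_poly_eq0.
exists s => g; apply: sP.
have -> : map_poly iota p = map_poly g (map_poly iota p).
  by rewrite -map_poly_comp; apply: eq_map_poly => a /=; rewrite gal_fix.
by rewrite fmorph_root.
Qed.

(** Primitive elements are phrased through stabilisers, without intermediate fields. Over an
    infinite F, x + c y works for c outside a finite set; over a finite F, nonzero x and y are roots
    of unity, and z generates the group of both. *)
Lemma primitive_elt2 x y :
  exists z, forall g, g z = z <-> g x = x /\ g y = y.
Proof.
have [Finf|[s us sF]] := infinite_or_finite F.
  have [sx sxP] := galois_conjugates x; have [sy syP] := galois_conjugates y.
  (* The solutions c of u + c v = x + c y, for conjugates u of x and v of y. *)
  pose bad := [seq (u - x) / (y - v) | u <- sx, v <- sy].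
  have [t ut st] := Finf (size bad).
  have [c _ cbad] : exists2 c, c \in t & iota c \notin bad.
    apply/hasP; rewrite has_predC; apply/negP=> /allP all_bad.
    have := @uniq_leq_size _ [seq iota c | c <- t] bad.
    rewrite map_inj_uniq ?size_map; last exact: fmorph_inj.
    move=> /(_ ut) H; have : (size t <= size bad)%N.
      by apply: H => _ /mapP[c ct ->]; apply: all_bad.
    by rewrite leqNgt st.
  exists (x + iota c * y) => g; split=> [|[gx gy]]; last first.
    by rewrite rmorphD rmorphM /= gal_fix gx gy.
  rewrite rmorphD rmorphM /= gal_fix => E.
  have [gy|gy] := eqVneq (g y) y.
    by split=> //; apply: (addIr (iota c * y)); rewrite -{1}gy.
  case/negP: cbad; apply/allpairsP; exists (g x, g y) => /=; split=> //.
  have yg : y - g y != 0 by rewrite subr_eq0 eq_sym.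
  apply: (mulIf yg); rewrite divfK // mulrBr; apply/eqP.
  by rewrite subr_eq addrC addrA [_ + g x]addrC E addrC addKr.
have [->|x0] := eqVneq x 0.
  by exists y => g; split=> [|[]//]; split=> //; apply: rmorph0.
have [->|y0] := eqVneq y 0.
  by exists x => g; split=> [|[]//]; split=> //; apply: rmorph0.
have [p p0 px] := algebraic_elt x; have [q q0 qy] := algebraic_elt y.
have [n n0 xn] := root_of_unity_of_finite sF p0 px x0.
have [l l0 yl] := root_of_unity_of_finite sF q0 qy y0.
have [z [i [j [a [b [zE xE yE]]]]]] := common_root_of_unity n0 l0 xn yl.
exists z => g; split=> [gz|[gx gy]].
  by rewrite xE yE !rmorphXn /= gz.
by rewrite zE rmorphM !rmorphXn /= gx gy.
Qed.

Lemma primitive_elt (s : seq Fs) :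
  exists z, forall g, g z = z <-> {in s, forall x, g x = x}.
Proof.
elim: s => [|x s [z zP]]; first by exists 0 => g; split=> // _; apply: rmorph0.
have [w wP] := primitive_elt2 x z; exists w => g; rewrite wP; split.
  move=> [gx /zP gs] y; rewrite inE => /orP[/eqP->|] //; exact: gs.
move=> gs; split; first by apply: gs; rewrite inE eqxx.
by apply/zP=> y ys; apply: gs; rewrite inE ys orbT.
Qed.

Section GaloisSet.
Variables (T : finType) (act : galois_group iota -> T -> T).
Hypothesis actM : forall g h gh : galois_group iota,
  (forall x, gh x = g (h x)) -> forall t, act gh t = act g (act h t).
Hypothesis act_cont : exists s : seq Fs, forall g : galois_group iota,
  {in s, forall x, g x = x} -> forall t, act g t = t.

Lemma act_fix g : (forall x, g x = x) -> forall t, act g t = t.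
Proof. by move=> g1; have [s sP] := act_cont; apply: sP => x _. Qed.

Lemma act_inv g h : (forall x, h (g x) = x) -> forall t, act h (act g t) = t.
Proof.
move=> hg t; have [k kE] := galois_comp h g.
by rewrite -(actM kE) act_fix // => x; rewrite kE hg.
Qed.

Lemma stabilizer_elt (t : T) : exists z, forall g, g z = z <-> act g t = t.
Proof.
have [s sP] := act_cont; have [w wP] := primitive_elt s.
have wact g : g w = w -> forall t, act g t = t by move/wP/sP.
have [s1 s1P] := galois_conjugates w.
have [H uH HP] := classical_filter (fun y => exists2 h,
    act h t = t & h w = y) s1.
have memH h : act h t = t -> h w \in H by move=> ht; apply/HP; split=> //;
    exists h.
pose P := \prod_(y <- H) ('X - y%:P).
have mapP_ g : map_poly g P = \prod_(y <- [seq g y | y <- H]) ('X - y%:P).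
  by rewrite big_map rmorph_prod; apply: eq_bigr => y _;
    rewrite /= map_polyXsubC.
have [z zP] := primitive_elt P.
have {}zP g : g z = z <-> map_poly g P = P.
  rewrite zP; split=> [gP|gP y].
    apply/polyP=> i; rewrite coef_map /=.
    have [iP|iP] := ltnP i (size P); first by rewrite gP // mem_nth.
    by rewrite nth_default // rmorph0.
  by move=> /(nthP 0)[i _ <-]; rewrite -{2}gP coef_map.
exists z => g; rewrite zP; split=> [gP|gt].
  have gw : g w \in H.
    rewrite -root_prod_XsubC -/P -gP fmorph_root root_prod_XsubC.
    have [g1 g1E] := galois_one; rewrite -(g1E w); apply: memH; exact: act_fix.
  have [_ [h ht hw]] := (HP _).1 gw; have [k [kh hk]] := galois_inv h.
  have [l lE] := galois_comp k g.
  have /wact lt : l w = w by rewrite lE -hw kh.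
  have := lt t; rewrite (actM lE) => /(congr1 (act h)).
  by rewrite (act_inv hk) ht.
rewrite mapP_; apply: perm_big; apply: uniq_perm => //.
  by rewrite map_inj_uniq //; apply: fmorph_inj.
apply: (uniq_min_size _ _ _).2; last by rewrite size_map.
  by rewrite map_inj_uniq //; apply: fmorph_inj.
move=> _ /mapP[y /HP[_ [h ht <-]] ->]; have [k kE] := galois_comp g h.
by rewrite -kE; apply: memH; rewrite (actM kE) ht.
Qed.

Lemma orbit_rel : exists r : rel T,
  [/\ forall t t', r t t' <-> exists g, act g t = t', reflexive r,
      ssrbool.symmetric r & transitive r].
Proof.
have pick_bool (p : T * T) : exists b : bool, b <-> exists g, act g p.1 = p.2.
  have [ex|nex] := classic (exists g, act g p.1 = p.2); first by exists true.
  by exists false; split.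
have [b bP] := fin_all_exists pick_bool.
have rP t t' : b (t, t') <-> exists g, act g t = t' by apply: bP.
exists (fun t t' => b (t, t')); split=> // [t|t t'|t2 t1 t3].
- by apply/rP; have [g g1] := galois_one; exists g; apply: act_fix.
- by apply/idP/idP=> /rP[g <-]; apply/rP; have [h [hg _]] := galois_inv g;
    exists h; apply: act_inv.
- move=> /rP[g <-] /rP[h <-]; apply/rP; have [k kE] := galois_comp h g.
  by exists k; apply: actM.
Qed.

(** Each orbit is identified with the conjugates of an element having the same stabiliser as a
    representative of the orbit. Injectivity is thus obtained within each orbit, not across
    orbits. *)
Lemma separating_function : exists theta : T -> Fs,
  (forall g t, theta (act g t) = g (theta t)) /\
  (forall g t, theta (act g t) = theta t -> act g t = t).
Proof.
have [r [rP rr rs rt]] := orbit_rel.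
pose rep t := odflt t [pick t' | r t t'].
have rep_rel t : r (rep t) t.
  by rewrite rs /rep; case: pickP => //= _; apply: rr.
have rep_eq t t' : r t t' -> rep t = rep t'.
  move=> tt'; rewrite /rep; rewrite (eq_pick (Q := r t')).
    by case: pickP => // /(_ t'); rewrite rr.
  move=> u; apply/idP/idP; apply: rt => //; by rewrite rs.
have [z zP] := fin_all_exists stabilizer_elt.
have [ga gaP] := fin_all_exists (fun t => (rP _ _).1 (rep_rel t)).
exists (fun t => ga t (z (rep t))); split=> [g t|g t].
  have [h [h1 h2]] := galois_inv (ga (act g t)).
  have rE : rep (act g t) = rep t by apply/esym/rep_eq/rP; exists g.
  have [k kE] := galois_comp g (ga t); have [l lE] := galois_comp h k.
  have lz : l (z (rep t)) = z (rep t).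
    apply/zP; rewrite (actM lE) (actM kE) gaP -{1}(gaP (act g t)) rE.
    by rewrite act_inv.
  by rewrite rE -{1}lz lE h2 kE.
have rE : rep (act g t) = rep t by apply/esym/rep_eq/rP; exists g.
rewrite rE => E; have [h [h1 h2]] := galois_inv (ga t).
have [l lE] := galois_comp h (ga (act g t)).
have /zP lr : l (z (rep t)) = z (rep t) by rewrite lE E h1.
have ga' := gaP (act g t); rewrite rE in ga'.
have := lr; rewrite (actM lE) ga' => /(congr1 (act (ga t))).
by rewrite (act_inv h2) gaP.
Qed.

(* Speiser's theorem for permutation modules: Vandermonde blocks, one for each
   orbit. *)
Lemma permutation_descent : exists B : T -> T -> Fs,
  (forall g k t, B k (act g t) = g (B k t)) /\
  forall y : T -> Fs, (forall k, \sum_t B k t * y t = 0) -> forall t, y t = 0.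
Proof.
have [r [rP rr rs rt]] := orbit_rel.
have [theta [thE th_inj]] := separating_function.
pose os k := [seq t <- enum T | r k t].
have os_eq k k' : r k k' -> os k = os k'.
  move=> kk'; apply: eq_filter => t.
  by apply/idP/idP; apply: rt => //; rewrite rs.
have mem_os k t : (t \in os k) = r k t by rewrite mem_filter mem_enum andbT.
(* The row [k] is supported on the orbit of [k], and its exponent is the position of [k] in that
   orbit. *)
exists (fun k t => if r k t then theta t ^+ index k (os k) else 0); split.
  move=> g k t; have rt' : r t (act g t) by apply/rP; exists g.
  have -> : r k (act g t) = r k t.
    by apply/idP/idP=> kt; apply: rt kt _; rewrite // rs.
  by case: ifP; rewrite ?rmorph0 ?rmorphXn ?thE.
move=> y yB t0; have uos : uniq (os t0) by rewrite filter_uniq ?enum_uniq.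
have t0os : t0 \in os t0 by rewrite mem_os.
have sum0 i : (i < size (os t0))%N -> \sum_(t <- os t0) theta t ^+ i * y t = 0.
  move=> ios; pose k := nth t0 (os t0) i; have kos : r t0 k by rewrite -mem_os
    mem_nth.
  rewrite -[RHS](yB k) [in LHS]/os big_filter big_enum_cond /= [RHS](bigID (r
    t0)) /=.
  rewrite [X in _ = _ + X]big1 ?addr0 => [|t /negPf t0t].
    apply: eq_bigr => t t0t; rewrite -(os_eq _ _ kos) index_uniq //.
    by rewrite (rt t0) // rs.
  suff -> : r k t = false by rewrite mul0r.
  by apply/negP=> kt; rewrite (rt _ _ _ kos kt) in t0t.
have sump (p : {poly Fs}) : (size p <= size (os t0))%N ->
    \sum_(t <- os t0) p.[theta t] * y t = 0.
  move=> sp; under eq_bigr => t _ do rewrite (horner_coef_wide _ sp) mulr_suml.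
  rewrite exchange_big big1 //= => i _.
  under eq_bigr do rewrite -mulrA.
  by rewrite -mulr_sumr sum0 ?mulr0.
(* It vanishes at every point of the orbit except [t0], so the relation for [q] isolates [y t0]. *)
pose q := \prod_(t <- rem t0 (os t0)) ('X - (theta t)%:P).
have rootq t : root q (theta t) = (theta t \in [seq theta t | t <- rem t0 (os
    t0)]).
  by rewrite -root_prod_XsubC big_map.
have := sump q; rewrite size_prod_XsubC size_rem // prednK;
    last by case: (os t0) t0os.
move=> /(_ (leqnn _)); rewrite (perm_big _ (perm_to_rem t0os)) big_cons /=.
rewrite big_seq big1 ?addr0 => [/eqP|t tos]; last first.
  suff /rootP -> : root q (theta t) by rewrite mul0r.
  by rewrite rootq; apply: map_f.
rewrite mulf_eq0 => /orP[|/eqP//]; rewrite -/(root _ _) rootq => /mapP[t];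
  rewrite mem_rem_uniq // !inE => /andP[tt0].
rewrite mem_os => /rP[g gt]; rewrite -gt => /esym/th_inj E.
by rewrite -gt E eqxx in tt0.
Qed.

End GaloisSet.
End Galois.

(** * Birational maps to projective spaces *)

Section AffineBirational.
Variables (K : fieldType) (Z : multiproj_set K) (J : finType) (h : J) (N : nat).
Variables (B : 'I_N -> J -> K) (B' : J -> 'I_N -> K).
Hypothesis BB' : forall k k', \sum_t B k t * B' t k' = (k == k')%:R.
Hypothesis B'B : forall t t', \sum_k B' t k * B k t' = (t == t')%:R.

Local Notation Y := (projective_space K 'I_N).

(** The coordinates indexed by [J] are linear forms in the homogeneous ones. For the twisted forms
    this change of basis has coefficients in Fs and absorbs the permutation of [J]. *)
Definition linear_coord (y : coords Y) (t : J) : K := \sum_k B' t k * y k.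

Definition affine_coord (y : coords Y) (t : J) : K :=
  linear_coord y t / linear_coord y h.

Definition of_linear (v : J -> K) : coords Y := [ffun k => \sum_t B k t * v t].

Lemma of_linearK v : linear_coord (of_linear v) =1 v.
Proof.
move=> t; rewrite /linear_coord.
under eq_bigr => k _ do rewrite ffunE mulr_sumr.
rewrite exchange_big /= (bigD1 t) //= [X in _ + X]big1 ?addr0 => [|t' t't].
  under eq_bigr do rewrite mulrA.
  by rewrite -mulr_suml B'B eqxx mul1r.
under eq_bigr do rewrite mulrA.
by rewrite -mulr_suml B'B eq_sym (negPf t't) mul0r.
Qed.

Lemma linear_coordK y k : \sum_t B k t * linear_coord y t = y k.
Proof.
rewrite /linear_coord; under eq_bigr => t _ do rewrite mulr_sumr.
rewrite exchange_big /= (bigD1 k) //= [X in _ + X]big1 ?addr0 => [|k' k'k].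
  under eq_bigr do rewrite mulrA.
  by rewrite -mulr_suml BB' eqxx mul1r.
under eq_bigr do rewrite mulrA.
by rewrite -mulr_suml BB' eq_sym (negPf k'k) mul0r.
Qed.

Lemma hom_linear_coord t :
  hom_fun (X := Y) (fun=> 1%N) (fun y => linear_coord y t).
Proof.
have hsum (r : seq 'I_N) :
    hom_fun (X := Y) (fun=> 1%N) (fun y => \sum_(k <- r) B' t k * y k).
  elim: r => [|k r IH].
    exists 0 => [m|y]; first by rewrite msupp0.
    by rewrite /eval_on meval0 big_nil.
  apply: (hom_fun_ext (X := Y) (f := fun y => B' t k * y k + \sum_(k <- r)
    B' t k * y k)).
    by move=> y; rewrite big_cons.
  apply: (hom_add (X := Y)) => //.
  apply: hom_fun_deg (hom_mul (hom_const Y (B' t k)) (hom_coord (X := Y) k))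
    => b.
  by rewrite add0n; case: b; rewrite eqxx.
exact: hsum.
Qed.

Variables (cond : (J -> K) -> K) (Psi : (J -> K) -> coords Z).
(** Quantifying over all function rings expresses that [cond] is a polynomial; it is then applied to
    regular functions on the source and on the target. *)
Hypothesis cond_ring : forall T (D : T -> Prop) R, fun_ring D R ->
  forall y : T -> J -> K, (forall t, R (fun u => y u t)) -> R (fun u =>
    cond (y u)).
Hypothesis Psi_field : forall T (D : T -> Prop) R, fun_field D R ->
  forall y : T -> J -> K, (forall t, R (fun u => y u t)) ->
  (forall u, D u -> y u h = 1) -> (forall u, D u -> cond (y u) != 0) ->
  forall t, R (fun u => Psi (y u) t).

Variables (U : coords Z -> Prop) (F : coords Z -> J -> K).
Hypothesis LZ : locus_closed Z.
Hypothesis oU : zariski_open U.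
Hypothesis F_reg : forall t, regular U (fun x => F x t).
Hypothesis FP : forall x, U x ->
  F x h = 1 /\ (cond (F x) != 0 -> same_point (Psi (F x)) x).
Hypothesis PsiP : forall y, y h = 1 -> cond y != 0 -> U (Psi y) /\ F (Psi y)
    = y.
Hypothesis cond_neq0 : exists2 y, y h = 1 & cond y != 0.

Definition source_open x : Prop := U x /\ cond (F x) != 0.

Lemma source_openP : zariski_open source_open.
Proof.
by apply: open_regular => //; apply: cond_ring (fun_field_ring (regular_field
  U)) _ _.
Qed.

Definition target_open (y : coords Y) : Prop :=
  (on y /\ linear_coord y h != 0) /\ cond (affine_coord y) != 0.

Lemma affine_coord_regular (V : coords Y -> Prop) t :
  (forall y, V y -> linear_coord y h != 0) -> regular V (fun y =>
    affine_coord y t).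
Proof. by apply: regular_frac; apply: hom_linear_coord. Qed.

Lemma target_openP : zariski_open target_open.
Proof.
apply: open_regular; first by apply: open_hom (hom_linear_coord h).
apply: cond_ring (fun_field_ring (regular_field _)) _ _ => t.
by apply: affine_coord_regular => y [].
Qed.

Lemma affine_coord_h y : linear_coord y h != 0 -> affine_coord y h = 1.
Proof. by move=> y0; rewrite /affine_coord divff. Qed.

Lemma target_of_linear v : v h = 1 -> cond v != 0 ->
  target_open (of_linear v) /\ affine_coord (of_linear v) = v.
Proof.
move=> v1 cv; have vE : affine_coord (of_linear v) = v.
  by apply: functional_extensionality => t; rewrite /affine_coord !of_linearK
    v1 divr1.
have l0 : linear_coord (of_linear v) h != 0 by rewrite of_linearK v1 oner_eq0.
split=> //; split; last by rewrite vE.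
split=> //; split=> // -[].
have [k yk] : exists k, of_linear v k != 0.
  apply: NNPP => nk; case/negP: l0; apply/eqP/big1 => k _.
  suff /eqP -> : of_linear v k == 0 by rewrite mulr0.
  by apply/negPn/negP=> yk; apply: nk; exists k.
by exists k.
Qed.

Variables (S : Type) (actZ : S -> coords Z -> coords Z)
  (actY : S -> coords Y -> coords Y) (actJ : S -> (J -> K) -> J -> K).
Hypothesis actZ_same : forall s x x',
  same_point x x' -> same_point (actZ s x) (actZ s x').
Hypothesis actY_linear : forall s y t, linear_coord (actY s y)
    t = actJ s (linear_coord y) t.
Hypothesis actJ_scale : forall s v, v h != 0 -> actJ s v h != 0 /\
  forall t, actJ s v t / actJ s v h = actJ s (fun t => v t / v h) t.
Hypothesis actJP : forall s v, v h = 1 -> cond v != 0 ->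
  cond (actJ s v) != 0 /\ same_point (Psi (actJ s v)) (actZ s (Psi v)).

(** The coordinate [h] is nonzero on the target and is scaled to 1; [actJ_scale] reduces
    equivariance to vectors so normalised. *)
Lemma affine_birational : equivariantly_birational actZ actY.
Proof.
apply: (birational_criterion (U := source_open) (V := target_open)
  (F := fun x => of_linear (F x)) (Psi := fun y => Psi (affine_coord y))) => //.
- exact: source_openP.
- exact: target_openP.
- by have [v v1 cv] := cond_neq0; exists (of_linear v);
  have [] := target_of_linear v1 cv.
- move=> k; have RR := fun_field_ring (regular_field source_open).
  apply: (fun_ext RR (f := fun x => \sum_t B k t * F x t)) => [x _|].
    by rewrite ffunE.
  apply: (fun_sum RR) => t _; apply: (fun_mul RR); first exact: (fun_const RR).
  by apply: regular_sub (F_reg t) => x [].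
- apply: Psi_field (regular_field _) _ _ _ _ => [t|y [[_ y0] _]|y []] //.
    by apply: affine_coord_regular => y [[]].
  exact: affine_coord_h.
- move=> x [Ux cx]; have [x1 xP] := FP Ux.
  by have [Vx ->] := target_of_linear x1 cx; split=> //; apply: xP.
- move=> y [[oy y0] cy]; have [UPsi FPsi] := PsiP (affine_coord_h y0) cy.
  split; first by split=> //; rewrite FPsi.
  rewrite FPsi; apply: same_point_sym.
  exists (fun=> (linear_coord y h)^-1) => [_|k]; first by rewrite invr_eq0.
  rewrite ffunE /affine_coord; under eq_bigr do rewrite mulrA.
  by rewrite -mulr_suml linear_coordK mulrC.
move=> s y [[oy y0] cy].
have [s0 sE] := actJ_scale s y0.
have aE : affine_coord (actY s y) = actJ s (affine_coord y).
  by apply: functional_extensionality => t; rewrite /affine_coord !actY_linear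
    sE.
have [cs Ps] := actJP s (affine_coord_h y0) cy.
rewrite aE; split=> //; split; last by rewrite aE.
rewrite actY_linear; split=> //; split=> // -[].
have [k yk] : exists k, actY s y k != 0.
  apply: NNPP => nk; case/negP: s0; rewrite -actY_linear; apply/eqP/big1 => k _.
  suff /eqP -> : actY s y k == 0 by rewrite mulr0.
  by apply/negPn/negP=> yk; apply: nk; exists k.
by exists k.
Qed.

End AffineBirational.

(** * The open set on which the chart is regular *)

Section ChartOpen.
Variables (K : fieldType) (Z : multiproj_set K) (I : finType) (e : nat)
  (O : {set I}).
Variables (i0 : I) (cardO : #|O| = (e.*2 + 3)%N) (U : coords Z -> Prop).
Variables (E : coords Z -> I -> bool + 'I_e -> K)
  (s : coords Z -> I * 'I_2 -> K * K).
Hypothesis oU : zariski_open U.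
Hypothesis E_reg : forall i t, regular U (fun z => E z i t).
Hypothesis s_reg : forall l, fun_vec (regular U) (fun z => s z l).

Definition chart_open z : Prop :=
  (U z /\ dets_fun i0 cardO (E z) (s z) != 0) /\ frames_fun i0 cardO (E z)
    (s z) != 0.

Lemma chart_openP : zariski_open chart_open.
Proof.
apply: open_regular; first apply: open_regular => //.
  apply: (fun_prod (fun_field_ring (regular_field U))) => j _.
  by apply: (fun_interp_det (fun_field_ring (regular_field U))) => // i.
set V := fun z => _; have VU z : V z -> U z by case.
have RV := regular_field V; have R1 := fun_field_ring RV.
have EV i t : regular V (fun z => E z i t) by apply: regular_sub VU (E_reg i t).
have sV l : fun_vec (regular V) (fun z => s z l).
  by have [s1 s2] := s_reg l; split; apply: regular_sub VU _.
have dets j z : V z -> interp_det i0 cardO (E z) (fun i => s z (i, j)) != 0.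
  by move=> [_ /prodf_neq0]; apply.
have fr j := fun_frames RV EV sV (dets j).
apply: (fun_mul R1); first apply: (fun_mul R1).
- by apply: (fun_prod R1) => j _; have [f1 f2] := fr j; apply: (fun_br R1).
- by have [f1 _] := fr 0; have [f2 _] := fr 1; apply: (fun_br R1).
- by apply: (fun_prod R1) => p _; have [f1 _] := fr p.2; apply: (fun_br R1).
Qed.

Lemma chart_of_regular t : regular chart_open (fun z =>
    chart_of i0 cardO (E z) (s z) t).
Proof.
have CU z : chart_open z -> U z by case=> -[].
apply: (fun_chart_of (regular_field chart_open)) => [i t'|l|z [[_ d] f]].
- exact: regular_sub CU (E_reg i t').
- by have [s1 s2] := s_reg l; split; apply: regular_sub CU _.
- exact: chartableP.
Qed.

End ChartOpen.

Section ChartPerm.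
Variables (I : finType) (e : nat) (O : {set I}).
Implicit Types (a : {perm I}) (tau : {perm 'I_2}) (t : chart e O).

Definition chart_origin : chart e O := inl (inl (false, false)).

Lemma chart_perm_origin a tau : chart_perm a tau chart_origin = chart_origin.
Proof. by rewrite /chart_perm /=; case: ifP. Qed.

Lemma chart_permM a a' tau tau' t :
  (forall i, (a i \in O) = (i \in O)) -> (forall i, (a' i \in O) = (i \in O)) ->
  chart_perm a tau (chart_perm a' tau' t) = chart_perm (a' * a)%g (tau' *
    tau)%g t.
Proof.
move=> aO a'O; case: t => [[[r r']|[j rk]]|[i j]] /=; last 2 first.
- by rewrite permM.
- have iO := valP i; congr (inr (_, _)); rewrite ?permM //.
  by apply: val_inj; rewrite !val_insubd !a'O iO /= !(aO, a'O) iO.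
rewrite permM.
by have [[t0 t1]|[t0 t1]] := tau_cases tau; have [[-> _]|[-> _]] := tau_cases
  tau';
  rewrite ?t0 ?t1.
Qed.

Lemma chart_perm1 t : chart_perm 1%g 1%g t = t.
Proof.
case: t => [[[r r']|[j rk]]|[i j]] /=; rewrite !perm1 //.
by congr (inr (_, _)); apply: val_inj; rewrite val_insubd (valP i).
Qed.

End ChartPerm.

Lemma fun_good (K : fieldType) (T : Type) (D : T -> Prop) (R : (T -> K) -> Prop)
    (RR : fun_ring D R) (I : finType) (e : nat) (O : {set I}) (i0 : I)
    (cardO : #|O| = (e.*2 + 3)%N) (E : T -> I -> bool + 'I_e -> K)
    (y : T -> chart e O -> K) :
  (forall i t', R (fun t => E t i t')) -> (forall t', R (fun t => y t t')) ->
  R (fun t => good_fun i0 cardO (E t) (y t)).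
Proof.
move=> RE Ry; apply: (fun_mul RR).
  by apply: (fun_prod RR) => p _; apply: (fun_br RR);
    apply: (fun_chart_config RR).
by apply: (fun_prod RR) => j _; apply: (fun_framed_det RR).
Qed.

Lemma hom_sub_coord (K : fieldType) (X : multiproj_set K)
    (t t' : Defs.coord X) :
  block t = block t' ->
  hom_fun (fun b => (block t == b) : nat) (fun x : coords X => x t - x t').
Proof.
move=> tt'; apply: (hom_fun_ext (f := fun x : coords X => x t + -1 * x t')).
  by move=> x; rewrite mulN1r.
apply: hom_add; first exact: hom_coord.
apply: hom_fun_deg (hom_mul (hom_const X (-1)) (hom_coord t')) => b.
by rewrite add0n tt'.
Qed.

Section Interior.
Variables (K : fieldType) (L : finType).

(** As q runs over all orderings of four labels, excluding the value 1 for every cross-ratio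
    excludes 0 and infinity too: what remains is the locus of smooth curves. *)
Definition interior_fun (x : coords (Mbar K L)) : K :=
  \prod_(q : quadruple L) (x (q, false) - x (q, true)).

Lemma interior_funP x : on x -> interior_fun x != 0 ->
  exists2 s, nondegenerate s & same_point (xr s) x.
Proof.
move=> ox /prodf_neq0 xd; apply: interior_config ox _ => q.
by rewrite -subr_eq0; apply: xd.
Qed.

Lemma interior_fun_xr (s : L -> K * K) : nondegenerate s ->
    interior_fun (xr s) != 0.
Proof. by move=> nd; apply/prodf_neq0=> q _; rewrite subr_eq0 xr_neq. Qed.

Lemma interior_coord_neq0 x t : on x -> interior_fun x != 0 -> x t != 0.
Proof.
move=> ox xd; have [s nd [c c0 cE]] := interior_funP ox xd.
by rewrite cE mulf_neq0 // xr_neq0.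
Qed.

End Interior.

Lemma xr_permute (F Fs : fieldType) (iota : {rmorphism F -> Fs}) (L : finType)
    (g : galois_group iota) (p : {perm L}) (s : L -> Fs * Fs) :
  permute_marks p (galois_act g (xr s)) =
  xr (fun l => map_vec g (s (p^-1%g l))).
Proof.
apply/ffunP=> -[q b]; rewrite !ffunE /= !tnth_map.
by case: b; rewrite !br_map_vec rmorphM.
Qed.

Lemma permute_marks_same (K : fieldType) (L : finType) (p : {perm L})
    (x x' : coords (Mbar K L)) :
  same_point x x' -> same_point (permute_marks p x) (permute_marks p x').
Proof.
move=> [c c0 cE]; exists (fun q => c (relabel_quadruple p^-1%g q)) => [q|[q b]].
  exact: c0.
by rewrite !ffunE /= cE.
Qed.

Lemma galois_act_same (F Fs : fieldType) (iota : {rmorphism F -> Fs})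
    (X : multiproj_set Fs) (g : galois_group iota) (x x' : coords X) :
  same_point x x' ->
  same_point (galois_act g x : coords X) (galois_act g x' : coords X).
Proof.
move=> [c c0 cE]; exists (fun b => g (c b)) => [b|t];
  first by rewrite fmorph_eq0.
by rewrite !ffunE cE rmorphM.
Qed.

Lemma chart_act_xr (F Fs : fieldType) (iota : {rmorphism F -> Fs}) (m e : nat)
    (O : {set 'I_m}) (i0 : 'I_m) (i0O : i0 \in O) (cardO : #|O| = (e.*2 + 3)%N)
    (g : galois_group iota) (a : 'S_m) (tau : 'S_2)
    (E E' : 'I_m -> bool + 'I_e -> Fs) (y y' : chart e O -> Fs) :
  (forall i, (a i \in O) = (i \in O)) ->
  (forall i t, E' (a i) t = g (E i t)) ->
  (forall t, y' (chart_perm a tau t) = g (y t)) ->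
  good_chart i0 cardO E y ->
  good_chart i0 cardO E' y' /\
  same_point (xr (chart_config E' y'))
    (permute_marks (pair_perm a tau) (galois_act g (xr (chart_config E y)))).
Proof.
move=> aO EE yy gd; split; first exact: (good_chart_act i0O (gal_bij g)
  aO EE yy gd).
have O1 : (1 < #|O|)%N by rewrite cardO addnC.
have [h [lam [h0 lam0 hE]]] := chart_config_act aO EE yy gd.1 O1.
apply: same_point_sym; rewrite xr_permute; apply: xr_equiv.
exists h, (fun l => lam ((pair_perm a tau)^-1%g l)); split=> // l.
have [[i j] <-] : exists l', pair_perm a tau l' = l.
  by exists ((pair_perm a tau)^-1%g l); rewrite permKV.
by rewrite permK permE /pair_fun /= hE.
Qed.

Section Components.
Variables (m : nat) (hm : (3 <= m)%N).

(** Since [hm] reads 2 < m, the indices used are 0 and 1. The first three labels normalise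
    configurations; the fourth completes a default quadruple. *)
Definition label0 : 'I_m * 'I_2 := (Ordinal (ltnW (ltnW hm)), 0).
Definition label1 : 'I_m * 'I_2 := (Ordinal (ltnW (ltnW hm)), 1).
Definition label2 : 'I_m * 'I_2 := (Ordinal (ltnW hm), 0).
Definition label3 : 'I_m * 'I_2 := (Ordinal (ltnW hm), 1).

Lemma uniq_labels : uniq [tuple label0; label1; label2; label3].
Proof. by []. Qed.

Lemma uniq_labels3 : uniq [:: label0; label1; label2].
Proof. by []. Qed.

Definition base_quadruple : quadruple ('I_m * 'I_2) :=
  exist (fun q : 4.-tuple ('I_m * 'I_2) => uniq q) _ uniq_labels.

Definition nf (K : fieldType) : coords (Mbar K ('I_m * 'I_2)%type)
    -> 'I_m * 'I_2 -> K * K :=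
  normal_form label0 label1 label2 base_quadruple.

Lemma card_labels : (3 <= #|{: 'I_m * 'I_2}|)%N.
Proof. by rewrite card_prod !card_ord (leq_trans hm) // leq_pmulr. Qed.

Lemma pair_perm_inj (a b : 'S_m) (s t : 'S_2) :
  pair_perm a s = pair_perm b t -> a = b /\ s = t.
Proof.
move=> /permP E; split; apply/permP=> i.
  by have := E (i, 0); rewrite !permE => -[].
by have := E (label0.1, i); rewrite !permE => -[].
Qed.

Lemma pair_permM (a b : 'S_m) (s t : 'S_2) :
  (pair_perm a s * pair_perm b t)%g = pair_perm (a * b) (s * t).
Proof. by apply/permP=> -[i j]; rewrite permM !permE /pair_fun /= !permM. Qed.

End Components.

(** * A Galois-stable basis on an odd set of indices *)

Section OddOrbit.
Variables (F Fs : fieldType) (iota : {rmorphism F -> Fs}).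
Hypothesis hFs : separable_closure iota.
Variables (m : nat) (hm : (3 <= m)%N) (hodd : odd m).
Variable (a : galois_group iota -> 'S_m).
Hypothesis aM : forall g h gh : galois_group iota,
  (forall x, gh x = g (h x)) -> forall i, a gh i = a g (a h i).
Hypothesis a_cont : exists s : seq Fs, forall g : galois_group iota,
  {in s, forall x, g x = x} -> forall i, a g i = i.

(* Some orbit is odd.  If it is a single point, a second orbit of even size is
   added to it; if all orbits are points, any three points will do. *)
Lemma equivariant_basis : exists (e : nat) (O : {set 'I_m})
    (E : 'I_m -> bool + 'I_e -> Fs),
  [/\ #|O| = (e.*2 + 3)%N, forall g i, (a g i \in O) = (i \in O),
      forall g i t, E (a g i) t = g (E i t) & generic_basis O E].
Proof.
have [r [rP rr rs rt]] := orbit_rel (act := fun g i => a g i) aM a_cont.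
have [theta [thE th_inj]] := separating_function hFs (act := fun g i =>
    a g i) aM a_cont.
pose orb i := [set i' | r i i'].
have orbA g i i' : (a g i' \in orb i) = (i' \in orb i).
  have ri : r i' (a g i') by apply/rP; exists g.
  by rewrite !inE; apply/idP/idP=> H; apply: rt H _; rewrite // rs.
have powE (th : 'I_m -> Fs) e : (forall g i, th (a g i) = g (th i)) ->
    forall g i t, powers (e := e) th (a g i) t = g (powers th i t).
  by move=> thA g i t; rewrite /powers thA rmorphXn.
have orb_inj i : {in orb i &, injective theta}.
  move=> j k; rewrite !inE => ij ik E.
  have /rP[g jk] : r j k by apply: rt ik; rewrite rs.
  by rewrite -jk; apply/esym/th_inj; rewrite jk.
have decomp (k : nat) : odd k -> (3 <= k)%N -> exists e, k = (e.*2 + 3)%N.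
  move=> ok k3; exists (k - 3)./2.
  have := odd_double_half (k - 3); rewrite oddB // ok /= add0n => ->.
  by rewrite subnK.
have [[i [oi i3]]|nC1] := classic (exists i, odd #|orb i| /\ (3 <= #|orb i|)%N).
  have [e cardO] := decomp _ oi i3.
  exists e, (orb i), (powers theta); split=> //; first exact: powE.
  by apply: powers_basis.
have odd1 i : odd #|orb i| -> orb i = [set i].
  move=> oi; have c1 : (#|orb i| <= 1)%N.
    rewrite leqNgt; apply/negP=> c1; apply: nC1; exists i; split=> //.
    by move: oi c1; case: #|orb i| => [|[|[|n]]].
  have ii : i \in orb i by rewrite inE rr.
  apply/esym/eqP; rewrite eqEcard sub1set ii cards1 //.
have [i1 oi1] : exists i, odd #|orb i|.
  (* Otherwise [m] would be a sum of even orbit sizes. *)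
  apply: NNPP => nodd; move: hodd; rewrite -[m]card_ord -cardsT.
  have eqr : {in [set: 'I_m] & &, equivalence_rel r}.
    move=> x y z _ _ _; split=> [|xy]; first exact: rr.
    by apply/idP/idP; apply: rt => //; rewrite rs.
  rewrite (card_partition (equivalence_partitionP eqr)).
  rewrite (big_morph odd oddD (erefl : odd 0 = false)) big1_seq // => A.
  move=> /andP[/imsetP[i _ ->] _]; apply/negbTE/negP=> oi; apply: nodd;
    exists i.
  by move: oi; rewrite (eq_card (B := orb i)) // => k; rewrite !inE.
have fix1 g : a g i1 = i1.
  have : a g i1 \in orb i1 by rewrite orbA inE rr.
  by rewrite odd1 // inE => /eqP.
have [[i2 ei2]|nev] := classic (exists i, ~~ odd #|orb i|).
  have i12 : i1 \notin orb i2.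
    rewrite inE; apply: contra ei2 => r21; suff -> : orb i2 = orb i1 by [].
    by apply/setP=> k; rewrite !inE; apply/idP/idP; apply: rt => //; rewrite rs.
  (* The value 0 at the fixed index is kept apart from the even orbit: if [theta] vanished there,
     its value would be Galois-fixed and the orbit a single point. *)
  pose th i := if i == i1 then 0 else theta i.
  have thA g i : th (a g i) = g (th i).
    rewrite /th -{1}(fix1 g) (inj_eq perm_inj).
    by case: eqP => _; rewrite ?rmorph0 ?thE.
  have th_neq0 i : i \in orb i2 -> theta i != 0.
    move=> ii2; apply: contraNneq ei2 => th0.
    suff -> : orb i2 = [set i] by rewrite cards1.
    apply/setP=> k; rewrite !inE; apply/idP/eqP=> [r2k|->];
      last by rewrite inE in ii2.
    have /rP[g <-] : r i k by apply: rt r2k; rewrite rs; rewrite inE in ii2.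
    by apply: th_inj; rewrite thE th0 rmorph0.
  have [e cardO] : exists e, #|i1 |: orb i2| = (e.*2 + 3)%N.
    apply: decomp; rewrite cardsU1 i12 ?oddD ?(negPf ei2) //.
    have: (0 < #|orb i2|)%N by apply/card_gt0P; exists i2; rewrite inE rr.
    by case: #|orb i2| ei2 => [|[|n]].
  exists e, (i1 |: orb i2), (powers th); split=> //; last 2 first.
  - exact: powE.
  - apply: powers_basis => // i j; rewrite !in_setU1 /th.
    case: (eqVneq i i1) => [->|_]; case: (eqVneq j i1) => [->|_] //=.
    + by move=> _ /th_neq0 th0 /esym /eqP; rewrite (negPf th0).
    + by move=> /th_neq0 th0 _ /eqP; rewrite (negPf th0).
    + exact: orb_inj.
  - by move=> g i; rewrite !in_setU1 orbA -{1}(fix1 g) (inj_eq perm_inj).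
have fixA g i : a g i = i.
  have : a g i \in orb i by rewrite orbA inE rr.
  rewrite odd1 ?inE => [/eqP //|]; apply/negPn/negP=> ei.
  by apply: nev; exists i.
pose j1 : 'I_m := Ordinal (ltnW (ltnW hm)).
pose j2 : 'I_m := Ordinal (ltnW hm).
pose j3 : 'I_m := Ordinal hm.
exists 0%N, [set j1; j2; j3], (three_basis Fs j1 j2); split.
- by rewrite -setUA cardsU1 cards2 !inE.
- by move=> g i; rewrite fixA.
- move=> g i t; rewrite fixA /three_basis.
  by case: (i == j1); last case: (i == j2); rewrite ?rmorph_nat ?rmorph1.
- exact: (@three_basisP Fs _ [set j1; j2; j3] j1 j2 j3 erefl).
Qed.

End OddOrbit.

Lemma inverse_coords (K : fieldType) (J : finType) (N : nat) (M : J -> J -> K) :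
  #|J| = N ->
  (forall y : J -> K, (forall k, \sum_t M k t * y t = 0) -> forall t,
    y t = 0) ->
  exists (f : 'I_N -> J) (B' : J -> 'I_N -> K),
    (forall k k', \sum_t M (f k) t * B' t k' = (k == k')%:R) /\
    (forall t t', \sum_k B' t k * M (f k) t' = (t == t')%:R).
Proof.
move=> HN inj; case: N / HN.
have det0 : sys_det (erefl #|J|) M != 0 by apply: sys_det_neq0.
pose MM := sys_mx (erefl #|J|) M.
have uM : MM \in unitmx by rewrite unitmxE unitfE.
have ME (k l : 'I_#|J|) : MM k l = M (enum_val k) (enum_val l).
  by rewrite mxE cast_ord_id.
exists enum_val, (fun t k => invmx MM (enum_rank t) k); split=> [k k'|t t'].
  have /matrixP/(_ k k') := mulmxV uM; rewrite !mxE => <-.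
  rewrite (reindex (@enum_val J J)); last by apply: onW_bij;
    apply: enum_val_bij.
  by apply: eq_bigr => l _; rewrite ME enum_valK.
have /matrixP/(_ (enum_rank t) (enum_rank t')) := mulVmx uM.
rewrite !mxE (inj_eq enum_rank_inj) => <-.
by apply: eq_bigr => l _; rewrite ME enum_rankK.
Qed.

(** * Rationality of the twisted forms *)

Section TwistedForm.
Variables (m : nat) (hm : (3 <= m)%N) (hodd : odd m) (A : {group 'S_m}).
Variables (F Fs : fieldType) (iota : {rmorphism F -> Fs}).
Hypothesis hFs : separable_closure iota.
Variable rho : galois_group iota -> {perm 'I_m * 'I_2}.
Hypothesis rho_hom : galois_hom rho.
Hypothesis rho_cont : krull_continuous rho.
Hypothesis rhoA : forall g, rho g \in diagonal_group A.

Lemma rho_components : exists (a : galois_group iota -> 'S_m)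
    (tau : galois_group iota -> 'S_2), forall g,
      rho g = pair_perm (a g) (tau g).
Proof.
pose p g := odflt (1%g, 1%g) [pick p : 'S_m * 'S_2 | rho g == pair_perm p.1
  p.2].
exists (fun g => (p g).1), (fun g => (p g).2) => g; rewrite /p.
case: pickP => [q /eqP //|/= np].
by have /imset2P[a s _ _ E] := rhoA g; have := np (a, s); rewrite E eqxx.
Qed.

Lemma twisted_rational : rational_form (twisted_act rho).
Proof.
have [a [tau rhoE]] := rho_components.
have atauM (g h gh : galois_group iota) : (forall x, gh x = g (h x)) ->
    a gh = (a h * a g)%g /\ tau gh = (tau h * tau g)%g.
  move=> ghE; apply: (pair_perm_inj hm); rewrite -pair_permM -!rhoE.
  by apply/permP=> i; rewrite permM (rho_hom ghE).
have [g1 g1E] := galois_one iota.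
have atau1 (g : galois_group iota) : (forall x,
    g x = x) -> a g = 1%g /\ tau g = 1%g.
  (* Records with the same underlying map need not be equal. Such a g is a composite of itself with
     itself in the sense of [galois_hom], so its image is idempotent. *)
  move=> gE; have [] := atauM g g g; first by move=> x; rewrite gE.
  by move=> /(canLR (mulgK _)); rewrite mulgV => <- /(canLR (mulgK _));
    rewrite mulgV => <-.
have [s0 s0P] := rho_cont g1.
have atau_cont (g : galois_group iota) : {in s0, forall x,
    g x = x} -> a g = 1%g /\ tau g = 1%g.
  move=> gs; have [<- <-] := atau1 g1 g1E; apply: (pair_perm_inj hm).
  by rewrite -!rhoE; apply: s0P => x xs; rewrite gs // g1E.
have aM (g h gh : galois_group iota) : (forall x, gh x = g (h x)) -> forall i,
    a gh i = a g (a h i).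
  by move=> /atauM[-> _] i; rewrite permM.
have a_cont : exists s : seq Fs, forall g : galois_group iota,
    {in s, forall x, g x = x} -> forall i, a g i = i.
  by exists s0 => g /atau_cont[-> _] i; rewrite perm1.
have [e [O [E [cardO aO EE basisE]]]] := equivariant_basis hFs hm hodd aM
    a_cont.
have [i0 i0O] : exists i0, i0 \in O by apply/card_gt0P; rewrite cardO addnC.
pose J := chart e O.
pose act g : J -> J := chart_perm (a g) (tau g).
have actM (g h gh : galois_group iota) :
    (forall x, gh x = g (h x)) -> forall t, act gh t = act g (act h t).
  by move=> /atauM[aE tE] t; rewrite /act chart_permM ?aE ?tE.
have act_cont : exists s : seq Fs, forall g : galois_group iota,
    {in s, forall x, g x = x} -> forall t, act g t = t.
  by exists s0 => g /atau_cont[aE tE] t; rewrite /act aE tE chart_perm1.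
have [M [ME Minj]] := permutation_descent hFs actM act_cont.
have [d cardJ] : exists d, #|J| = d.+1.
  by exists #|J|.-1; rewrite prednK //; apply/card_gt0P;
    exists (chart_origin e O).
have [f [B' [BB' B'B]]] := inverse_coords cardJ Minj.
pose inv g : J -> J := chart_perm (a g)^-1%g (tau g)^-1%g.
have aVO g i : ((a g)^-1%g i \in O) = (i \in O) by rewrite -(aO g) permKV.
have actK g : cancel (act g) (inv g).
  by move=> t; rewrite /act /inv chart_permM // !mulgV chart_perm1.
have invK g : cancel (inv g) (act g).
  by move=> t; rewrite /act /inv chart_permM // !mulVg chart_perm1.
pose actJ (g : galois_group iota) (v : J -> Fs) t := g (v (inv g t)).
pose L : finType := ('I_m * 'I_2)%type.
pose X := Mbar Fs L.
pose U0 (x : coords X) := on x /\ interior_fun x != 0.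
have oU0 : zariski_open U0.
  have [e' he'] := hom_prod (X := X) (index_enum (quadruple L)) (P := predT)
    (fun q _ => @hom_sub_coord Fs X (q, false) (q, true) erefl).
  exact: open_hom he'.
have nf_reg l : fun_vec (regular U0) (fun x => nf hm x l).
  apply: (fun_normal_form _ _ _ _ (regular_field U0)) => q.
  apply: (regular_frac (hom_coord (X := X) (q, false)) (hom_coord (X := X) (q,
    true))).
  by move=> x [ox xi]; apply: interior_coord_neq0.
have E_reg i t : regular U0 (fun=> E i t).
  exact: (fun_const (fun_field_ring (regular_field U0))).
pose E' := fun (_ : coords X) => E.
pose F' (x : coords X) := chart_of i0 cardO E (nf hm x).
have nfP x : U0 x -> nondegenerate (nf hm x) /\ same_point (xr (nf hm x)) x.
  move=> [ox /prodf_neq0 xi]; apply: normal_form_interior => // q.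
  by rewrite -subr_eq0; apply: xi.
have Finf := separably_closed_infinite hFs.
exists d.
apply: (@affine_birational Fs X J (chart_origin e O) d.+1 (fun k =>
  M (f k)) B' BB' B'B
  (fun y => good_fun i0 cardO E y) (fun y => xr (chart_config E y)) _ _
  (chart_open i0 cardO U0 E' (@nf m hm Fs)) F' (@Mbar_locus_closed _ _)
    _ _ _ _ _
  _ (twisted_act rho) _ actJ).
- move=> T D R RR y Ry; apply: (fun_good RR) => // i t; exact: (fun_const RR).
- move=> T D R RR y Ry _ _; apply: (fun_xr (fun_field_ring RR)) => l.
  apply: (fun_chart_config (fun_field_ring RR)) => // i t.
  exact: (fun_const (fun_field_ring RR)).
- exact: chart_openP.
- exact: chart_of_regular.
- move=> x [[Ux d0] f0]; have ch := chartableP d0 f0; have [nd nfx] := nfP x Ux.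
  split; first by rewrite /F' /= divff //; case: ch.
  move=> /good_funP gd; have [_ ce] := chart_ofP i0O nd ch gd.
  apply: same_point_trans nfx; apply: same_point_sym; exact: xr_equiv.
- move=> y y1 /good_funP gd; have nd := gd.1.
  have ce := normal_formP (base_quadruple hm) (uniq_labels3 hm) nd.
  have [ch yE] := chart_of_config i0O gd y1 ce.
  split; last exact: functional_extensionality.
  split; last exact: chartable_frames.
  split; last exact: chartable_dets.
  split; [exact: (xr_on nd (card_labels hm)) | exact: interior_fun_xr].
(* The origin entry is forced to be 1, so that genericity is tested within the affine slice. *)
- pose yy (v : {ffun J -> Fs}) (t : J) := if t == chart_origin e O then 1 else
  v t.
  have [] := @generic_good Fs _ e O i0 i0O cardO J Finf (fun=> E) yy E basisE.
  + by move=> i t; apply: (fun_const (line_poly_ring Fs J)).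
  + move=> t; rewrite /yy; case: eqP => _; last exact: line_poly_coord.
    exact: (fun_const (line_poly_ring Fs J)).
  + move=> y0 y01; exists [ffun t => y0 t] => //.
    apply: functional_extensionality => t; rewrite /yy ffunE.
    by case: eqP => // ->.
  + by move=> _ [v gv]; exists (yy v) => //; rewrite /yy eqxx.
- move=> g x x' xx'; apply: permute_marks_same;
  exact: (galois_act_same (X := X)).
- move=> g y t.
  (* The equivariance of [M] turns the permutation of [J] into the plain Galois action on the
     homogeneous coordinates. *)
  suff -> : galois_act g y = of_linear (fun k =>
    M (f k)) (actJ g (linear_coord B' y)).
    by rewrite (of_linearK B'B).
  apply/ffunP=> k; rewrite !ffunE -[in LHS](linear_coordK BB' y k) rmorph_sum.
  rewrite [RHS](reindex (act g)) /=; last first.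
    by exists (inv g) => t' _; [apply: actK | apply: invK].
  by apply: eq_bigr => t' _; rewrite rmorphM ME /actJ actK.
- move=> g v v0; rewrite /actJ /inv chart_perm_origin fmorph_eq0; split=> // t.
  by rewrite fmorph_div.
- move=> g v v1 /good_funP gd.
  have [gd' sp] := chart_act_xr (y' := actJ g v) i0O (aO g) (EE g)
    (fun t => congr1 (fun u => g (v u)) (actK g t)) gd.
  by split; [apply/good_funP | rewrite /twisted_act rhoE].
Qed.

End TwistedForm.

(** * Stable linearization *)

Section CrossRatioInvariants.
Variables (K : fieldType) (m : nat).
Implicit Types s : 'I_m * 'I_2 -> K * K.

Definition inv_num s i : K :=
  \prod_(k | k != i) (br (s (i, 0)) (s (k, 0)) * br (s (i, 1)) (s (k, 1))).

Definition inv_den s i : K :=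
  \prod_(k | k != i) (br (s (i, 0)) (s (k, 1)) * br (s (i, 1)) (s (k, 0))).

Definition cr_inv s i : K := inv_num s i / inv_den s i.

Lemma inv_den_neq0 s i : nondegenerate s -> inv_den s i != 0.
Proof.
by move=> nd; apply/prodf_neq0=> k ki; apply: mulf_neq0; apply: nd;
  rewrite xpair_eqE negb_and [i == k]eq_sym ki.
Qed.

Lemma cr_invE s i : cr_inv s i = \prod_(k | k != i)
  ((br (s (i, 0)) (s (k, 0)) * br (s (i, 1)) (s (k, 1))) /
   (br (s (i, 0)) (s (k, 1)) * br (s (i, 1)) (s (k, 0)))).
Proof. by rewrite big_split /= prodfV. Qed.

(** In each factor the numerator and the denominator involve the same four points, so that the
    common factor [c] cancels. *)
Lemma cr_inv_equiv s s' : config_equiv s s' -> cr_inv s' =1 cr_inv s.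
Proof.
move=> [g [lam [g0 lam0 sE]]] i; rewrite !cr_invE; apply: eq_bigr => k _.
rewrite !sE !br_scal !br_lin.
set d := br g.1 g.2 in g0 *; pose c := lam (i, 0) * lam (k, 0) * lam (i,
  1) * lam (k, 1) * d * d.
have c0 : c != 0 by rewrite !mulf_neq0.
rewrite -[RHS]mul1r -(divff c0) mulf_div; congr (_ / _); rewrite /c; ring.
Qed.

(** Exchanging the p_k with the q_k only swaps the two brackets in each numerator and in each
    denominator, so only [a] moves these functions. *)
Lemma cr_inv_act (sigma : {rmorphism K -> K}) (a : 'S_m) (tau : 'S_2) s s' :
  (forall i j, s' (a i, tau j) = map_vec sigma (s (i, j))) ->
  forall i, cr_inv s' (a i) = sigma (cr_inv s i).
Proof.
move=> sE i; rewrite !cr_invE rmorph_prod (reindex_inj (@perm_inj _ a)) /=.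
apply: eq_big => [k|k _]; first by rewrite (inj_eq perm_inj).
rewrite fmorph_div !rmorphM -!br_map_vec -!sE.
have [[-> ->]|[-> ->]] := tau_cases tau => //.
by congr (_ / _); rewrite mulrC.
Qed.

Lemma vandermonde_det (x : 'I_m -> K) : injective x ->
  sys_det (erefl #|'I_m|) (fun i k : 'I_m => x i ^+ k) != 0.
Proof.
move=> x_inj; apply: sys_det_neq0 => c cP.
pose p := \poly_(k < m) (if insub k is Some k' then c k' else 0).
have pc (k : 'I_m) : p`_k = c k by rewrite coef_poly ltn_ord valK.
have p0 : p = 0.
  apply/eqP/negPn/negP=> pn0.
  have := max_poly_roots pn0 (rs := [seq x i | i <- enum 'I_m]).
  rewrite map_inj_uniq // enum_uniq size_map -cardE card_ord.
  have -> : all (root p) [seq x i | i <- enum 'I_m].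
    apply/allP=> _ /mapP[i _ ->]; rewrite /root (horner_coef_wide _ (size_poly
      _ _)).
    by apply/eqP; rewrite -[RHS](cP i); apply: eq_bigr => k _; rewrite pc mulrC.
  by move=> /(_ isT isT); rewrite ltnNge size_poly.
by move=> k; rewrite -pc p0 coef0.
Qed.

(* The functions [cr_inv s i], which are permuted like the indices i, trivialize
   the permutation representation on the i. *)
Definition twist s (c : 'I_m -> K) (i : 'I_m) : K := \sum_(k < m)
    cr_inv s i ^+ k * c k.

Definition untwist s (th : 'I_m -> K) : 'I_m -> K :=
  sys_sol (erefl #|'I_m|) (fun i k : 'I_m => cr_inv s i ^+ k) th.

Lemma untwistK s th : injective (cr_inv s) -> twist s (untwist s th) =1 th.
Proof. by move=> /vandermonde_det det0 i; apply: (sys_solP th det0). Qed.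

Lemma twist_uniq s c th : injective (cr_inv s) -> twist s c =1 th ->
  untwist s th =1 c.
Proof. by move=> /vandermonde_det det0 cE k; rewrite /untwist -(sys_sol_uniq
  det0 cE). Qed.

End CrossRatioInvariants.

(** * The linear model *)

Section LinearModel.
Variables (m e : nat).

(** With [O] everything, the chart has 4 + 4e = 2m-2 entries when m = 2e+3; the m further ones are
    the thetas, matched by the factor P^m. *)
Definition model : finType := (chart e [set: 'I_m] + 'I_m)%type.

Definition model_origin : model := inl (chart_origin e [set: 'I_m]).

Definition model_perm (a : 'S_m) (tau : 'S_2) (t : model) : model :=
  match t with inl c => inl (chart_perm a tau c) | inr i => inr (a i) end.

Lemma model_permM a a' tau tau' t :
  model_perm a tau (model_perm a' tau' t) = model_perm (a' * a) (tau' * tau) t.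
Proof.
case: t => [c|i] /=; last by rewrite permM.
by rewrite chart_permM // => i; rewrite !inE.
Qed.

Lemma model_perm1 t : model_perm 1 1 t = t.
Proof. by case: t => [c|i] /=; rewrite ?chart_perm1 ?perm1. Qed.

Variable (K : fieldType) (hm : (3 <= m)%N) (cardO : #|[set: 'I_m]| =
  (e.*2 + 3)%N).
Implicit Types (v : model -> K) (z : 'I_m -> K).

Let i0 : 'I_m := (label0 hm).1.
Local Notation i0O := (in_setT i0).

Definition mchart v : chart e [set: 'I_m] -> K := fun c => v (inl c).
Definition mtheta v : 'I_m -> K := fun i => v (inr i).
Definition mconfig v : 'I_m * 'I_2 -> K * K :=
  chart_config (powers (mtheta v)) (mchart v).

(** Distinctness of the [cr_inv], with the denominators cleared to obtain a polynomial. *)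
Definition separating_fun v : K :=
  \prod_(p : 'I_m * 'I_m | p.1 != p.2)
    (inv_num (mconfig v) p.1 * inv_den (mconfig v) p.2 -
     inv_num (mconfig v) p.2 * inv_den (mconfig v) p.1).

(** The last factor excludes symmetric pairing matrices: the exchange of the p_i with the q_i
    transposes the matrix, and must not fix it for the action to be free. *)
Definition mcond v : K :=
  good_fun i0 cardO (powers (mtheta v)) (mchart v) * separating_fun v *
  (pairing (mchart v) false true - pairing (mchart v) true false).

Lemma mcondP v : mcond v != 0 ->
  [/\ good_chart i0 cardO (powers (mtheta v)) (mchart v),
      injective (cr_inv (mconfig v)) &
      pairing (mchart v) false true != pairing (mchart v) true false].
Proof.
rewrite mulf_eq0 negb_or => /andP[]; rewrite mulf_eq0 negb_or.
move=> /andP[/good_funP gd /prodf_neq0 sep]; rewrite subr_eq0 => pr;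
  split=> // i j E; apply/eqP/negPn/negP=> ij.
case/negP: (sep (i, j) ij); rewrite subr_eq0 /=.
have [nd _] := gd; have d0 k := inv_den_neq0 k nd.
by rewrite -(eqr_div _ _ (d0 i) (d0 j)) -/(cr_inv _ i) -/(cr_inv _ j) E.
Qed.

Lemma mcond_neq0 v : good_chart i0 cardO (powers (mtheta v)) (mchart v) ->
  injective (cr_inv (mconfig v)) ->
  pairing (mchart v) false true != pairing (mchart v) true false ->
  mcond v != 0.
Proof.
move=> gd inj pr; apply: mulf_neq0; last by rewrite subr_eq0.
apply: mulf_neq0; first exact/good_funP.
have [nd _] := gd; have d0 k := inv_den_neq0 k nd.
apply/prodf_neq0=> -[i j] /= ij; rewrite subr_eq0.
by rewrite -(eqr_div _ _ (d0 i) (d0 j)) (inj_eq inj).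
Qed.

(** The framed p_i depends on i only through theta_i, and the p_i are distinct. *)
Lemma mtheta_inj v : good_chart i0 cardO (powers (mtheta v)) (mchart v) ->
  injective (mtheta v).
Proof.
move=> [nd _] i j E; apply/eqP/negPn/negP=> ij.
have := nd (i, 0) (j, 0); rewrite xpair_eqE negb_and ij => /(_ isT).
rewrite /chart_config /= !framed_in ?inE //.
have -> : ev2 (powers (mtheta v)) (pencil (mchart v) 0) i =
          ev2 (powers (mtheta v)) (pencil (mchart v) 0) j.
  by rewrite /ev2; congr (_, _); apply: eq_bigr => t _; rewrite /powers E.
by rewrite /br mulrC subrr eqxx.
Qed.

Section Functions.
Variables (T : Type) (D : T -> Prop) (R : (T -> K) -> Prop).

Lemma fun_mcond (RR : fun_ring D R) (v : T -> model -> K) :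
  (forall t, R (fun u => v u t)) -> R (fun u => mcond (v u)).
Proof.
move=> Rv; have Rp i t : R (fun u => powers (e := e) (mtheta (v u)) i t).
  by apply: (fun_exp RR); apply: Rv.
have Rs l : fun_vec R (fun u => mconfig (v u) l).
  by apply: (fun_chart_config RR) => // t; apply: Rv.
have Rn i : R (fun u => inv_num (mconfig (v u)) i).
  by apply: (fun_prod RR) => k _; apply: (fun_mul RR); apply: (fun_br RR).
have Rd i : R (fun u => inv_den (mconfig (v u)) i).
  by apply: (fun_prod RR) => k _; apply: (fun_mul RR); apply: (fun_br RR).
apply: (fun_mul RR); last by apply: (fun_sub RR); apply: Rv.
apply: (fun_mul RR); first by apply: (fun_good RR) => // t; apply: Rv.
by apply: (fun_prod RR) => p _; apply: (fun_sub RR); apply: (fun_mul RR).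
Qed.

Lemma fun_cr_inv (RR : fun_field D R) (s : T -> 'I_m * 'I_2 -> K * K) i :
  (forall u, D u -> nondegenerate (s u)) -> (forall l,
    fun_vec R (fun u => s u l)) ->
  R (fun u => cr_inv (s u) i).
Proof.
move=> nd Rs; have R1 := fun_field_ring RR.
apply: (fun_div RR) => [u /nd||]; first exact: inv_den_neq0.
  by apply: (fun_prod R1) => k _; apply: (fun_mul R1); apply: (fun_br R1).
by apply: (fun_prod R1) => k _; apply: (fun_mul R1); apply: (fun_br R1).
Qed.

End Functions.

Lemma mcond_generic (Kinf : infinite_field K) :
  exists2 v, v model_origin = 1 & mcond v != 0.
Proof.
pose RR := line_poly_ring K model.
pose vv (w : {ffun model -> K}) (t : model) : K :=
  if t == model_origin then 1 else w t.
have vv_line t : line_poly (fun w => vv w t).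
  rewrite /vv; case: eqP => _; last exact: line_poly_coord.
  exact: (fun_const RR).
have [x x_inj] : exists x : 'I_m -> K, injective x.
  have [s us sm] := Kinf m; exists (fun i => nth 0 s i) => i j /eqP.
  have ms (k : 'I_m) : (k < size s)%N by apply: ltn_trans sm.
  by rewrite nth_uniq // => /eqP; apply: val_inj.
have vvE (y0 : chart e [set: 'I_m] -> K) (th : 'I_m -> K) :
    pairing y0 false false = 1 ->
    exists2 w, mtheta (vv w) = th & mchart (vv w) = y0.
  move=> y01; exists [ffun t : model => match t with inl c =>
    y0 c | inr i => th i end].
    by apply: functional_extensionality => i; rewrite /mtheta /vv ffunE.
  apply: functional_extensionality => c; rewrite /mchart /vv ffunE.
  by case: eqP => // -[->].
suff [_ [w cw]] : generic (fun w => mcond (vv w)).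
  by exists (vv w) => //; rewrite /vv eqxx.
apply: (generic_mul Kinf); first apply: (generic_mul Kinf).
- have basis := @powers_basis K _ e _ cardO x (in2W x_inj).
  apply: (generic_good i0O cardO Kinf basis) => [i t|t|y0 y01].
  + by apply: (fun_exp RR); apply: vv_line.
  + exact: vv_line.
  + have [w thE yE] := vvE y0 x y01; exists w => //.
    by rewrite thE.
- apply: (generic_prod Kinf) => -[i j] /= ij.
  have Rs l : fun_vec (@line_poly K model) (fun w => mconfig (vv w) l).
    apply: (fun_chart_config RR) => [k t|t]; last exact: vv_line.
    by apply: (fun_exp RR); apply: vv_line.
  split.
    by apply: (fun_sub RR); apply: (fun_mul RR); apply: (fun_prod RR) => k _;
      apply: (fun_mul RR); apply: (fun_br RR).
  have [k ki kj] : exists2 k, k != i & k != j.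
    have : (0 < #|~: [set i; j]|)%N.
      rewrite -(ltn_add2l #|[set i; j]|) cardsC addn0 card_ord cards2 ij.
      exact: hm.
    by case/card_gt0P=> k; rewrite !inE negb_or => /andP[]; exists k.
  (* With theta_i = theta_k = 0 the points p_i and p_k coincide, which kills the numerator at i,
     while theta_j differs from all other values. This witness is not a good chart, but each factor
     may have its own. *)
  pose th l := if l == k then 0 else x l - x i.
  pose y0 := mk_chart (e := e) (O := [set: 'I_m]) (fun r r' =>
    (r == r')%:R) (fun _ _ => 0) (fun=> 0 : K).
  have [w thE yE] := vvE y0 th erefl; exists w.
  have thi : th i = 0 by rewrite /th eq_sym (negPf ki) subrr.
  have thk : th k = 0 by rewrite /th eqxx.
  have thj l : l != j -> th l != th j.
    move=> lj; rewrite /th [j == k]eq_sym (negPf kj); case: (l == k).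
      by rewrite eq_sym subr_eq0 (inj_eq x_inj) eq_sym.
    by rewrite (inj_eq (addIr _)) (inj_eq x_inj).
  have fE l j' : framed (powers th) y0 j' l = (1, th l).
    by rewrite framed_mk /basis_vec inE /powers /= expr0 expr1.
  have pE l : mconfig (vv w) (l, 0) = (1, th l).
    by rewrite /mconfig /chart_config /= thE yE fE.
  have qE l : mconfig (vv w) (l, 1) = (- th l, 1).
    rewrite /mconfig /chart_config /= thE yE fE /lin /dual_mx /pairing /=.
    by rewrite oppr0 mul0r add0r mul1r mul0r addr0 mulN1r.
  have -> : inv_num (mconfig (vv w)) i = 0.
    by rewrite /inv_num (bigD1 k) //= !pE thi thk /br /= mulr0 mul0r subrr
      !mul0r.
  rewrite mul0r sub0r oppr_eq0 mulf_neq0 //.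
    apply/prodf_neq0=> l lj; rewrite !pE !qE /br /=.
    have lj0 : th l - th j != 0 by rewrite subr_eq0 thj.
    rewrite [X in X != 0](_ : _ = (th l - th j) * (th l - th j)); last by ring.
    exact: mulf_neq0.
  apply/prodf_neq0=> l li; rewrite !pE !qE thi /br /=.
  rewrite [X in X != 0](_ : _ = -1); last by ring.
  by rewrite oppr_eq0 oner_eq0.
- split; first by apply: (fun_sub RR); apply: vv_line.
  pose y0 := mk_chart (e := e) (O := [set: 'I_m]) (fun r r' =>
    (~~ r)%:R) (fun _ _ => 0) (fun=> 0 : K).
  have [w _ yE] := vvE y0 x erefl; exists w.
  by rewrite yE /pairing /= subr0 oner_eq0.
Qed.

End LinearModel.

(** * The equivariant birational map to the linear model *)

Section StableLinearization.
Variables (m e : nat) (hm : (3 <= m)%N) (cardO : #|[set: 'I_m]| = (e.*2 + 3)%N).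
Variables (A : {group 'S_m}).
Variables (F Fs : fieldType) (iota : {rmorphism F -> Fs}).
Hypothesis hFs : separable_closure iota.

Local Notation L := ('I_m * 'I_2)%type.
Local Notation X := (Mbar Fs L).
Local Notation P := (projective_space Fs 'I_m.+1).
Local Notation Z := (product X P).
Local Notation J := (model m e).
Local Notation G := (diagonal_group A).
Let i0 : 'I_m := (label0 hm).1.

(** The thetas are permuted by A whereas P^m carries the trivial action. Its affine coordinates are
    therefore the coefficients expressing the thetas through powers of the [cr_inv], which are
    invariant; the last homogeneous coordinate is scaled to 1. *)
Definition model_coord (v : J -> Fs) (t : Defs.coord Z) : Fs :=
  match t with
  | inl u => xr (mconfig v) u
  | inr k => if unlift ord_max k is Some k' then
               untwist (mconfig v) (mtheta v) k' else 1
  end.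

Definition model_point (v : J -> Fs) : coords Z := [ffun t => model_coord v t].

Definition moduli_coords (z : coords Z) : coords X := fst_coords z.

Definition affine_twist (z : coords Z) (k : 'I_m) : Fs :=
  z (inr (lift ord_max k)) / z (inr ord_max).

Definition source_theta (z : coords Z) : 'I_m -> Fs :=
  twist (nf hm (moduli_coords z)) (affine_twist z).

Definition source_model (z : coords Z) (t : J) : Fs :=
  match t with
  | inl c => chart_of i0 cardO (powers (source_theta z))
    (nf hm (moduli_coords z)) c
  | inr i => source_theta z i
  end.

Definition source_interior (z : coords Z) : Prop :=
  on z /\ interior_fun (moduli_coords z) * z (inr ord_max) != 0.

Lemma source_interiorP z : source_interior z ->
  [/\ on (moduli_coords z), interior_fun (moduli_coords z) != 0 &
      z (inr ord_max) != 0].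
Proof.
move=> [[z0 [lz _]]]; rewrite mulf_eq0 negb_or => /andP[zi zm]; split=> //.
split=> // q; have [[t|k] //= [tq] zt] := z0 (inl q).
by exists t; rewrite // ffunE.
Qed.

Lemma source_interior_open : zariski_open source_interior.
Proof.
have [e' he'] := hom_prod (X := Z) (index_enum (quadruple L)) (P := predT)
  (fun q _ => @hom_sub_coord Fs Z (inl (q, false)) (inl (q, true)) erefl).
apply: open_hom (hom_fun_ext _ (hom_mul he' (hom_coord (X := Z)
  (inr ord_max)))) => z.
by congr (_ * _); apply: eq_bigr => q _; rewrite !ffunE.
Qed.

Lemma source_nf z : source_interior z -> nondegenerate (nf hm (moduli_coords
    z)) /\
  same_point (xr (nf hm (moduli_coords z))) (moduli_coords z).
Proof.
move=> /source_interiorP[ox /prodf_neq0 xi _];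
  apply: normal_form_interior => // q.
by rewrite -subr_eq0; apply: xi.
Qed.

Lemma nf_regular l : fun_vec (regular source_interior) (fun z =>
    nf hm (moduli_coords z) l).
Proof.
have RR := regular_field source_interior.
apply: (fun_normal_form _ _ _ _ RR) => q.
apply: (fun_ext (fun_field_ring RR) (f := fun z => z (inl (q,
  false)) / z (inl (q, true)))).
  by move=> z _; rewrite !ffunE.
apply: (regular_frac (hom_coord (X := Z) (inl (q,
  false))) (hom_coord (X := Z) (inl (q, true)))).
move=> z /source_interiorP[ox xi _].
by have := interior_coord_neq0 (q, true) ox xi; rewrite ffunE.
Qed.

Lemma source_theta_regular i : regular source_interior (fun z =>
    source_theta z i).
Proof.
have RR := regular_field source_interior; have R1 := fun_field_ring RR.
apply: (fun_sum R1) => k _; apply: (fun_mul R1).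
  apply: (fun_exp R1); apply: (fun_cr_inv RR) => [z /source_nf[]//|l].
  exact: nf_regular.
apply: (regular_frac (hom_coord (X := Z) (inr (lift ord_max k)))
  (hom_coord (X := Z) (inr ord_max))).
by move=> z /source_interiorP[].
Qed.

Definition linear_source : coords Z -> Prop :=
  chart_open i0 cardO source_interior (fun z => powers (source_theta z))
    (fun z => nf hm (moduli_coords z)).

Lemma powers_regular i t :
  regular source_interior (fun z => powers (e := e) (source_theta z) i t).
Proof.
apply: (fun_exp (fun_field_ring (regular_field _)));
  exact: source_theta_regular.
Qed.

Lemma linear_source_open : zariski_open linear_source.
Proof.
apply: chart_openP; [exact: source_interior_open | exact: powers_regular |
  exact: nf_regular].
Qed.

Lemma source_model_regular t : regular linear_source (fun z =>
    source_model z t).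
Proof.
case: t => [c|i].
  by apply: chart_of_regular; [exact: powers_regular | exact: nf_regular].
by apply: regular_sub (source_theta_regular i) => z [[]].
Qed.

Lemma product_locus_closed : locus_closed Z.
Proof.
move=> z z' [c c0 cE] [lz _]; split=> //.
apply: Mbar_locus_closed lz; exists (fun q => c (inl q)) => [q|u];
  first exact: c0.
by rewrite !ffunE cE.
Qed.

Lemma same_point_product (z z' : coords Z) :
  same_point (fst_coords z : coords X) (fst_coords z' : coords X) ->
  (forall k, z' (inr k) = z (inr k) * (z' (inr ord_max) / z (inr ord_max))) ->
  z (inr ord_max) != 0 -> z' (inr ord_max) != 0 -> same_point z z'.
Proof.
move=> [c c0 cE] kE z0 z0'.
exists (fun b => match b with inl q => c q | inr _ =>
    z' (inr ord_max) / z (inr ord_max) end).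
  by case=> [q|[]] //; rewrite mulf_neq0 ?invr_eq0.
case=> [u|k] /=; last by rewrite kE mulrC.
by have := cE u; rewrite !ffunE.
Qed.

Lemma model_point_fst v : fst_coords (model_point v) = xr (mconfig v)
    :> coords X.
Proof. by apply/ffunP=> u; rewrite ffunE [LHS]ffunE. Qed.

Lemma model_point_max v : model_point v (inr ord_max) = 1.
Proof. by rewrite ffunE /= unlift_none. Qed.

Lemma fun_model_point (T : Type) (D : T -> Prop) (R : (T -> Fs) -> Prop)
    (RR : fun_field D R) (v : T -> J -> Fs) :
  (forall t, R (fun u => v u t)) -> (forall u,
    D u -> mcond hm cardO (v u) != 0) ->
  forall t, R (fun u => model_point (v u) t).
Proof.
move=> Rv cv t; have R1 := fun_field_ring RR.
apply: (fun_ext R1 (f := fun u => model_coord (v u) t)) => [u _|].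
  by rewrite ffunE.
have Rs l : fun_vec R (fun u => mconfig (v u) l).
  apply: (fun_chart_config R1) => [i t'|t']; last exact: Rv.
  by apply: (fun_exp R1); apply: Rv.
case: t => [q|k] /=; first exact: (fun_xr R1).
case: unlift => [k'|]; last exact: (fun_const R1).
apply: (fun_sys_sol RR) => [u /cv/mcondP[_ inj _]|i l|i].
- exact: vandermonde_det.
- apply: (fun_exp R1); apply: (fun_cr_inv RR) => // u /cv/mcondP[[nd _] _ _].
  exact: nd.
- exact: Rv.
Qed.

Lemma source_modelP z : linear_source z ->
  source_model z (model_origin m e) = 1 /\
  (mcond hm cardO (source_model z) != 0 -> same_point (model_point
    (source_model z)) z).
Proof.
move=> [[Uz d0] f0]; have ch := chartableP d0 f0; have [nd nfx] := source_nf Uz.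
split; first by rewrite /= divff //; case: ch.
move=> /mcondP[gd inj _]; have [_ ce] := chart_ofP (in_setT i0) nd ch gd.
have [_ _ zm] := source_interiorP Uz.
(* The invariants agree on the normal form and on the chart configuration, so untwisting undoes the
   twist made by [source_theta]. *)
have crE := cr_inv_equiv ce.
have cr_fun : cr_inv (mconfig (source_model z))
    = cr_inv (nf hm (moduli_coords z)).
  exact: functional_extensionality.
apply: same_point_product => [|k||]; rewrite ?model_point_max ?oner_eq0 //.
  rewrite model_point_fst; apply: same_point_trans nfx.
  by apply: same_point_sym; apply: xr_equiv.
rewrite divr1 ffunE /=; case: unliftP => [k' ->|->]; last by rewrite mul1r.
have -> : untwist (mconfig (source_model z)) (mtheta (source_model z))
    k' = affine_twist z k'.
  by apply: (twist_uniq inj) => i; rewrite /twist cr_fun.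
by rewrite /affine_twist divfK.
Qed.

Lemma model_pointP v : v (model_origin m e) = 1 -> mcond hm cardO v != 0 ->
  linear_source (model_point v) /\ source_model (model_point v) = v.
Proof.
move=> v1 /mcondP[gd inj _]; have nd := gd.1.
have ce := normal_formP (base_quadruple hm) (uniq_labels3 hm) nd.
have xE : moduli_coords (model_point v) = xr (mconfig v) := model_point_fst v.
have thE : source_theta (model_point v) = mtheta v.
  apply: functional_extensionality => i; rewrite -[RHS](untwistK (mtheta v)
    inj).
  rewrite /source_theta /twist xE; apply: eq_bigr => k _.
  rewrite (cr_inv_equiv ce); congr (_ * _).
  by rewrite /affine_twist model_point_max divr1 ffunE /= liftK.
have [ch yE] := chart_of_config (in_setT i0) gd v1 ce.
split; last first.
  apply: functional_extensionality => -[c|i] /=; last by rewrite thE.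
  by rewrite thE xE; apply: yE.
rewrite /linear_source /chart_open thE xE.
split; last exact: chartable_frames.
split; last exact: chartable_dets.
have [x0 lx] := xr_on nd (card_labels hm).
split; last by rewrite xE model_point_max mulr1; apply: interior_fun_xr.
split; last by split=> //; rewrite model_point_fst.
case=> [q|[]]; last by exists (inr ord_max); rewrite // model_point_max
  oner_eq0.
have [u uq xu] := x0 q; exists (inl u); first exact: (congr1 inl uq).
by rewrite ffunE.
Qed.

Definition comps (p : {perm L}) : 'S_m * 'S_2 :=
  odflt (1%g, 1%g) [pick c : 'S_m * 'S_2 | p == pair_perm c.1 c.2].

Lemma compsP p : p \in G -> p = pair_perm (comps p).1 (comps p).2.
Proof.
move=> /imset2P[a s _ _ E]; rewrite /comps; case: pickP => [c /eqP //|/(_ (a,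
  s))].
by rewrite E eqxx.
Qed.

Lemma comps1 : comps 1%g = (1%g, 1%g).
Proof.
have E := compsP (group1 G).
have E1 : pair_perm 1 1 = 1%g :> {perm L}.
  by apply/permP=> -[i j]; rewrite permE /pair_fun /= !perm1.
have [] := pair_perm_inj hm (etrans (esym E) (esym E1)).
by case: (comps 1%g) => a s /= -> ->.
Qed.

Lemma compsM p q : p \in G -> q \in G ->
  comps (p * q)%g = ((comps p).1 * (comps q).1, (comps p).2 * (comps q).2)%g.
Proof.
move=> pG qG.
have E : pair_perm (comps (p * q)%g).1 (comps (p * q)%g).2 =
    pair_perm ((comps p).1 * (comps q).1) ((comps p).2 * (comps q).2).
  by rewrite -pair_permM -!compsP ?groupM.
have [] := pair_perm_inj hm E.
by case: (comps (p * q)%g) => a s /= -> ->.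
Qed.

Definition model_act (p : {perm L}) : J -> J := model_perm (comps p).1 (comps
    p).2.

Lemma model_actM p q t : p \in G -> q \in G ->
  model_act (p * q)%g t = model_act q (model_act p t).
Proof. by move=> pG qG; rewrite /model_act compsM // model_permM. Qed.

Lemma model_act1 t : model_act 1%g t = t.
Proof. by rewrite /model_act comps1 model_perm1. Qed.

Lemma model_act_origin p : model_act p (model_origin m e) = model_origin m e.
Proof. by congr inl; apply: chart_perm_origin. Qed.

Lemma model_actK p : p \in G -> cancel (model_act p) (model_act p^-1%g).
Proof. by move=> pG t; rewrite -model_actM ?groupV // mulgV model_act1. Qed.

Lemma model_actVK p : p \in G -> cancel (model_act p^-1%g) (model_act p).
Proof. by move=> pG t; rewrite -model_actM ?groupV // mulVg model_act1. Qed.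

(** Matrices act on row vectors, in accordance with the left-to-right product of permutations. *)
Definition model_mx (p : {perm L}) : 'M[F]_#|J| :=
  \matrix_(i, j) (model_act p (enum_val i) == enum_val j)%:R.

Lemma model_mx_repr : mx_repr G model_mx.
Proof.
split=> [|p q pG qG]; apply/matrixP=> i j; rewrite !mxE.
  by rewrite model_act1 (inj_eq enum_val_inj).
rewrite (bigD1 (enum_rank (model_act p (enum_val i))))
  //= !mxE enum_rankK eqxx mul1r.
rewrite big1 ?addr0 ?model_actM // => k ki; rewrite !mxE.
case: eqP => [E|_]; last by rewrite mul0r.
by case/eqP: ki; rewrite E enum_valK.
Qed.

Definition model_repr : mx_representation F G #|J| := MxRepresentation
    model_mx_repr.

Definition source_act (s : galois_group iota * subg_of G) (z : coords Z)
    : coords Z :=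
  product_act (permute_marks (sgval s.2)) id (galois_act s.1 z : coords Z).

Definition model_action (s : galois_group iota * subg_of G) (v : J -> Fs)
    (t : J) : Fs :=
  s.1 (v (model_act (sgval s.2)^-1%g t)).

Lemma source_act_fst s z : fst_coords (source_act s z) =
  permute_marks (sgval s.2) (galois_act s.1 (fst_coords z) : coords X)
    :> coords X.
Proof.
apply/ffunP=> u; rewrite ffunE [LHS]ffunE /=.
by congr (permute_marks _ _ _); apply/ffunP=> u'; rewrite !ffunE.
Qed.

Lemma source_act_snd s z k : source_act s z (inr k) = s.1 (z (inr k)).
Proof. by rewrite !ffunE. Qed.

Lemma source_act_inl s z q b : source_act s z (inl (q, b)) =
  s.1 (z (inl (relabel_quadruple (sgval s.2)^-1%g q, b))).
Proof. by rewrite !ffunE. Qed.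

Lemma source_act_same s z z' :
  same_point z z' -> same_point (source_act s z) (source_act s z').
Proof.
move=> [c c0 cE].
exists (fun b => match b with
  | inl q => s.1 (c (inl (relabel_quadruple (sgval s.2)^-1%g q)))
  | inr u => s.1 (c (inr u)) end) => [[q|u]|[[q b]|k]] /=;
    rewrite ?fmorph_eq0 //.
  by rewrite !source_act_inl cE rmorphM.
by rewrite !source_act_snd cE rmorphM.
Qed.

Lemma model_action_point s v : v (model_origin m e)
    = 1 -> mcond hm cardO v != 0 ->
  mcond hm cardO (model_action s v) != 0 /\
  same_point (model_point (model_action s v)) (source_act s (model_point v)).
Proof.
case: s => g u v1 /mcondP[gd inj pr]; set s := (g, u).
have pG := subgP u; pose a := (comps (sgval u)).1;
    pose tau := (comps (sgval u)).2.
have pE : sgval u = pair_perm a tau := compsP pG.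
have vE t : model_action s v (model_perm a tau t) = g (v t).
  by rewrite /model_action /= -/(model_act (sgval u) t) model_actK.
have aO i : (a i \in [set: 'I_m]) = (i \in [set: 'I_m]) by rewrite !inE.
have thE i : mtheta (model_action s v) (a i) = g (mtheta v i).
  exact: (vE (inr i)).
have EE i t : powers (e := e) (mtheta (model_action s v)) (a i)
    t = g (powers (mtheta v) i t).
  by rewrite /powers thE rmorphXn.
have yE c : mchart (model_action s v) (chart_perm a tau c) = g (mchart v c).
  exact: (vE (inl c)).
have [gd' sp] := chart_act_xr (in_setT i0) aO EE yE gd.
have O1 : (1 < #|[set: 'I_m]|)%N by rewrite cardO addnC.
have [h [lam [h0 lam0 hE]]] := chart_config_act aO EE yE gd.1 O1.
have crE i : cr_inv (mconfig (model_action s v)) (a i) = g (cr_inv (mconfig v)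
    i).
  pose s' l := map_vec g (mconfig v ((pair_perm a tau)^-1%g l)).
  have ce : config_equiv s' (mconfig (model_action s v)).
    exists h, (fun l => lam ((pair_perm a tau)^-1%g l)); split=> // l.
    have [[i' j'] <-] : exists l', pair_perm a tau l' = l.
      by exists ((pair_perm a tau)^-1%g l); rewrite permKV.
    by rewrite /s' permK permE /pair_fun /= /mconfig hE.
  rewrite (cr_inv_equiv ce); apply: (cr_inv_act (tau := tau)) => i' j.
  have -> : (a i', tau j) = pair_perm a tau (i', j) by rewrite permE.
  by rewrite /s' permK.
have inj' : injective (cr_inv (mconfig (model_action s v))).
  move=> i j; rewrite -(permKV a i) -(permKV a j) !crE => /fmorph_inj/inj E.
  by rewrite E.
split.
  apply: mcond_neq0 => //.
  have bE r r' : mchart (model_action s v) (inl (inl (if tau 0 == 0 then (r,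
      r') else (r', r)))) =
      g (mchart v (inl (inl (r, r')))) := yE (inl (inl (r, r'))).
  have := bE true false; have := bE false true; rewrite /pairing.
  by case: (tau 0 == 0) => -> ->; rewrite (inj_eq (fmorph_inj _)) // eq_sym.
apply: same_point_product; rewrite ?source_act_snd ?model_point_max ?rmorph1
  ?oner_eq0 //.
  by rewrite model_point_fst source_act_fst /= pE model_point_fst.
move=> k; rewrite source_act_snd divr1 mulr1 !ffunE /=.
case: unlift => [k'|]; last by rewrite rmorph1.
(* The coefficients are moved by Galois alone: permuting by [a] the equations that define them
   leaves their solution in place. *)
apply/esym; apply: (twist_uniq inj' (c := fun k =>
  g (untwist (mconfig v) (mtheta v) k))) => i.
rewrite -(permKV a i) thE -[in RHS](untwistK (mtheta v) inj) rmorph_sum.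
by apply: eq_bigr => l _; rewrite crE rmorphM rmorphXn.
Qed.

Lemma source_cond_regular :
  zariski_open (source_open (mcond hm cardO) linear_source source_model).
Proof.
apply: source_openP => [T D R RR v||t]; [exact: (fun_mcond hm cardO RR)
  | | exact: source_model_regular].
exact: linear_source_open.
Qed.

(** If p fixes a point, it fixes the model vector. Distinct thetas then make the permutation of the
    indices trivial, and the asymmetry of the pairing matrix excludes the exchange. *)
Lemma model_generically_free :
  generically_free G (fun p => product_act (permute_marks p)
    id : coords Z -> coords Z).
Proof.
exists (source_open (mcond hm cardO) linear_source source_model).
  split; first exact: source_cond_regular.
  have [v v1 cv] := mcond_generic hm cardO (separably_closed_infinite hFs).
  have [Uv vE] := model_pointP v1 cv.
  by exists (model_point v); split=> //; rewrite vE.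
move=> z p [Uz cz] pG pz; have [v1 /(_ cz) vz] := source_modelP Uz.
set v := source_model z in v1 cz vz.
(* The geometric action is the joint action paired with a trivial Galois element. *)
have [g1 g1E] := galois_one iota; pose s := (g1, subg G p).
have [cs ss] := model_action_point s v1 cz.
have s1 : model_action s v (model_origin m e) = 1.
  by rewrite /model_action model_act_origin /= g1E.
have actE : source_act s z = product_act (permute_marks p) id z.
  rewrite /source_act /= subgK //; congr (product_act _ _ _).
  by apply/ffunP=> t; rewrite ffunE g1E.
have same : same_point (model_point (model_action s v)) (model_point v).
  apply: same_point_trans ss _.
  apply: same_point_trans (source_act_same s vz) _; rewrite actE.
  exact: same_point_trans pz (same_point_sym vz).
have [Us sE] := model_pointP s1 cs; have [Uv vE] := model_pointP v1 cz.
have fix_v t : v (model_act p^-1%g t) = v t.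
  have := regular_same (source_model_regular t) Us Uv same.
  by rewrite sE vE /model_action /= subgK // g1E.
have fixv t : v (model_act p t) = v t by rewrite -fix_v model_actK.
have [gd _ pr] := mcondP cz; have th_inj := mtheta_inj gd.
have a1 : (comps p).1 = 1%g.
  by apply/permP=> i; rewrite perm1; apply: th_inj; apply: (fixv (inr i)).
have t1 : (comps p).2 = 1%g.
  have [[t0 t1]|[t0 _]] := tau_cases (comps p).2.
    by apply/permP=> j; rewrite perm1; case: (I2_cases j) => ->.
  case/eqP: pr; have := fixv (inl (inl (inl (true, false)))).
  by rewrite /model_act /= t0.
rewrite (compsP pG) a1 t1; apply/permP=> -[i j].
by rewrite permE /pair_fun /= !perm1.
Qed.

Lemma stably_linear : stably_linearizable iota G (@permute_marks Fs L).
Proof.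
exists m; split; first exact: model_generically_free.
exists #|J|, model_repr.
(* The model carries the permutation representation on [J], already defined over F, so the change of
   basis is a mere enumeration. *)
pose B (k : 'I_#|J|) (t : J) : Fs := (enum_val k == t)%:R.
have BB' k k' : \sum_t B k t * B k' t = (k == k')%:R.
  rewrite (bigD1 (enum_val k)) //= big1 ?addr0 => [|t /negPf tk].
    by rewrite /B eqxx mul1r (inj_eq enum_val_inj) eq_sym.
  by rewrite /B eq_sym tk mul0r.
have B'B t t' : \sum_k B k t * B k t' = (t == t')%:R.
  rewrite (bigD1 (enum_rank t)) //= big1 ?addr0 => [|k kt].
    by rewrite /B enum_rankK eqxx mul1r.
  rewrite /B; case: eqP => [E|_]; last by rewrite mul0r.
  by case/eqP: kt; rewrite -E enum_valK.
have lcE y t : linear_coord (fun t k => B k t) y t = y (enum_rank t).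
  rewrite /linear_coord (bigD1 (enum_rank t)) //= big1 ?addr0 => [|k kt].
    by rewrite /B enum_rankK eqxx mul1r.
  rewrite /B; case: eqP => [E|_]; last by rewrite mul0r.
  by case/eqP: kt; rewrite -E enum_valK.
apply: (@affine_birational Fs Z J (model_origin m e) #|J| B (fun t k =>
  B k t) BB' B'B
  (mcond hm cardO) model_point _ _ linear_source source_model
    product_locus_closed
  linear_source_open source_model_regular source_modelP model_pointP _ _
    source_act _
  model_action source_act_same).
- by move=> T D R RR v; apply: (fun_mcond hm cardO RR).
- by move=> T D R RR v Rv _ cv t; apply: (fun_model_point RR).
- exact: mcond_generic (separably_closed_infinite hFs).
- move=> s y t; rewrite lcE ffunE; have pG := subgP s.2.
  rewrite (bigD1 (enum_rank (model_act (sgval s.2)^-1%g t)))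
    //= big1 ?addr0 => [|k kt].
    rewrite !mxE !enum_rankK model_actVK // eqxx rmorph1 mulr1 ffunE.
    by rewrite /model_action lcE.
  rewrite !mxE enum_rankK; case: eqP => [E|_]; last by rewrite rmorph0 mulr0.
  by case/eqP: kt; rewrite -E model_actK // enum_valK.
- move=> s v v0; rewrite /model_action model_act_origin fmorph_eq0;
  split=> // t.
  by rewrite fmorph_div.
- exact: model_action_point.
Qed.

End StableLinearization.

Local Close Scope ring_scope.

Theorem theorem19 (m : nat) (hm : 3 <= m) (hodd : odd m) (A : {group 'S_m}) :
  (forall (F Fs : fieldType) (iota : {rmorphism F -> Fs})
          (hFs : separable_closure iota)
          (rho : galois_group iota -> {perm 'I_m * 'I_2}),
     galois_hom rho -> krull_continuous rho ->
     (forall g, rho g \in diagonal_group A) ->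
     rational_form (twisted_act rho))
  /\
  (forall (F Fs : fieldType) (iota : {rmorphism F -> Fs})
          (hFs : separable_closure iota),
     stably_linearizable iota (diagonal_group A)
       (@permute_marks Fs ('I_m * 'I_2)%type)).
Proof.
split=> F Fs iota hFs; first by move=> rho; apply: twisted_rational.
(* For (b) all indices are used, with e = (m-3)/2; this halving is exact because m is odd. *)
have cardO : #|[set: 'I_m]| = ((m - 3)./2.*2 + 3).
  rewrite cardsT card_ord; have := odd_double_half (m - 3).
  by rewrite oddB // hodd /= add0n => ->; rewrite subnK.
exact: (stably_linear hm cardO).
Qed.
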